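(* Let $\phi:\mathbb{Z}_{\ge 0}\to\mathbb{Q}$ be the function $$\phi(s)=\frac{s+r(s)}{3},$$ where $r$ is periodic with period $6$ and takes the values $r(0)=3,\ r(1)=-1,\ r(2)=1,\ r(3)=0,\ r(4)=2,\ r(5)=-2$. Then for every integer $s\ge 0$ the multiplicity of $S^{s\cdot(7,5,0)}$ in $S^3(S^{4s})$ and the multiplicity of $S^{s\cdot(7,5,0)}$ in $S^{4s}(S^3)$ are both equal to $\phi(s)$, i.e. $$m^{3,4s}_{(7s,5s,0)}=m^{4s,3}_{(7s,5s,0)}=\phi(s).$$ Moreover, there do not exist a positive integer $n$ and rational vectors $a,b,c\in\mathbb{Q}^n$ such that $\phi$ equals the counting function $s\mapsto \#(P(a,sb,c)\cap\mathbb{Z})$ of a one-dimensional inhomogeneous polytope $P(a,b,c)$. In particular, $\phi$ is not an Ehrhart function of any rational polyhedron, i.e. there is no rational polyhedron $P\subset\mathbb{Q}^m$ (for any $m$) with $\phi(s)=\#(sP\cap\mathbb{Z}^m)$ for all integers $s\ge 0$.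
   Context: Plethysm coefficients: for integers $d,k\ge 0$ and a partition $\lambda$ of $dk$, the coefficient $m^{d,k}_\lambda$ is defined by the decomposition $$S^d(S^kW)=\bigoplus_{\lambda} m^{d,k}_\lambda\, S^\lambda W$$ into irreducible $GL(W)$-representations, the sum being over partitions $\lambda$ of $dk$. Here $W$ is a finite-dimensional complex vector space of sufficiently large dimension (the coefficient of $S^\lambda W$ does not depend on $\dim W$ as long as $\dim W$ is at least the number of nonzero parts of $\lambda$), $S^k$ denotes the symmetric power and $S^\lambda$ the Schur functor (irreducible representation) associated with $\lambda$. For a partition $\lambda=(\lambda_1,\dots,\lambda_l)$ and an integer $s$, $s\cdot\lambda=(s\lambda_1,\dots,s\lambda_l)$; trailing zeros are ignored. Inhomogeneous (shifted) rational polytope: for a rational $n\times m$ matrix $A$ and rational vectors $b,c\in\mathbb{Q}^n$, it is given by the system of inequalities $P(A,b,c)=\{x\in\mathbb{Q}^m: Ax\le b+c\}$, with dilations $P(A,sb,c)=\{x\in\mathbb{Q}^m: Ax\le sb+c\}$ for integers $s\ge 0$. Its counting function is $s\mapsto\#(P(A,sb,c)\cap\mathbb{Z}^m)$, and its dimension is the dimension of $P(A,sb,c)$ for large $s$. When $m=1$, the matrix $A$ is a vector $a\in\mathbb{Q}^n$ and $P(a,sb,c)=\{x\in\mathbb{Q}: a_ix\le sb_i+c_i,\ i=1,\dots,n\}$. *)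

(* Defs.v *)
From HB Require Import structures.
From mathcomp Require Import all_boot all_order all_fingroup all_algebra.
From mathcomp Require Import boolp classical_sets functions cardinality reals.
From mathcomp Require Export complex.

Set Implicit Arguments.
Unset Strict Implicit.
Unset Printing Implicit Defensive.

Import Order.TTheory GRing.Theory Num.Theory.
Local Open Scope ring_scope.

(* A tensor in V^{(x) d} is the family of its coordinates, indexed by words of
   length d, with respect to the basis of V^{(x) d} induced by
   vbasis fullv : the word u stands for e_(u 0) (x) ... (x) e_(u (d-1)).      *)

Section TensorPower.
Variable F : fieldType.
Implicit Types (d : nat) (U V : vectType F).

Definition tens d V : vectType F :=
  {ffun {ffun 'I_d -> 'I_(\dim {:V})} -> F^o}.

Definition tens_fun d U V (f : 'Hom(U, V)) (x : tens d U) : tens d V :=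
  [ffun v : {ffun 'I_d -> 'I_(\dim {:V})} =>
     \sum_(u : {ffun 'I_d -> 'I_(\dim {:U})})
       (x u : F) *
       \prod_(i < d) coord (vbasis {:V}) (v i) (f (vbasis {:U})`_(u i))].

Lemma tens_fun_is_linear d U V (f : 'Hom(U, V)) : linear (@tens_fun d U V f).
Proof.
move=> a x y; apply/ffunP=> v; rewrite !ffunE /GRing.scale /= mulr_sumr.
rewrite -big_split; apply: eq_bigr => u _.
by rewrite !ffunE mulrDl mulrA.
Qed.

HB.instance Definition _ d U V (f : 'Hom(U, V)) :=
  GRing.isLinear.Build F (tens d U) (tens d V) *:%R (@tens_fun d U V f)
    (@tens_fun_is_linear d U V f).

Definition tens_map d U V (f : 'Hom(U, V)) : 'Hom(tens d U, tens d V) :=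
  linfun (@tens_fun d U V f).

Definition tperm_fun d V (s : 'S_d) (x : tens d V) : tens d V :=
  [ffun u : {ffun 'I_d -> 'I_(\dim {:V})} => x [ffun i => u (s i)]].

Lemma tperm_fun_is_linear d V (s : 'S_d) : linear (@tperm_fun d V s).
Proof. by move=> a x y; apply/ffunP=> u; rewrite !ffunE. Qed.

HB.instance Definition _ d V (s : 'S_d) :=
  GRing.isLinear.Build F (tens d V) (tens d V) *:%R (@tperm_fun d V s)
    (@tperm_fun_is_linear d V s).

(* Permutation of the tensor factors. *)
Definition tens_perm d V (s : 'S_d) : 'End(tens d V) :=
  linfun (@tperm_fun d V s).

Lemma tens_map_perm d U V (f : 'Hom(U, V)) (s : 'S_d) :
  (tens_map d f \o tens_perm U s = tens_perm V s \o tens_map d f)%VF.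
Proof.
apply/lfunP=> x; rewrite !comp_lfunE /= !lfunE /=; apply/ffunP=> v.
rewrite !ffunE.
pose h (t : 'S_d) (u : {ffun 'I_d -> 'I_(\dim {:U})}) := [ffun i => u (t i)].
have hK t : cancel (h t) (h t^-1%g).
  by move=> u; apply/ffunP=> i; rewrite !ffunE permKV.
rewrite [RHS](reindex_inj (can_inj (hK s))) /=.
apply: eq_bigr => u _; rewrite ffunE; congr (_ * _).
rewrite [LHS](reindex_inj (@perm_inj _ s)) /=.
by apply: eq_bigr => i _; rewrite !ffunE.
Qed.

Lemma tens_map1 d V : tens_map d (\1%VF : 'End(V)) = \1%VF.
Proof.
apply/lfunP=> x; rewrite !lfunE /=; apply/ffunP=> v; rewrite ffunE.
rewrite (bigD1 v) //= [X in _ + X]big1 => [|u neq_uv]; last first.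
  have [i neq_i] : exists i, u i != v i.
    apply/existsP; apply: contraR neq_uv => /existsPn eq_uv.
    by apply/eqP/ffunP=> i; apply/eqP; move: (eq_uv i); rewrite negbK.
  rewrite (bigD1 i) //= id_lfunE coord_free ?(basis_free (vbasisP _)) //.
  by rewrite (negPf neq_i) mul0r mulr0.
rewrite addr0 big1 ?mulr1 // => i _.
by rewrite id_lfunE coord_free ?(basis_free (vbasisP _)) // eqxx.
Qed.

Lemma tens_map_comp d U V (T : vectType F) (g : 'Hom(V, T)) (f : 'Hom(U, V)) :
  tens_map d (g \o f)%VF = (tens_map d g \o tens_map d f)%VF.
Proof.
apply/lfunP=> x; rewrite comp_lfunE /= !lfunE /=; apply/ffunP=> w.
rewrite !ffunE.
under [RHS]eq_bigr => v _ do rewrite ffunE mulr_suml.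
rewrite exchange_big /=; apply: eq_bigr => u _.
under [RHS]eq_bigr => v _ do rewrite -mulrA -big_split /=.
rewrite -mulr_sumr; congr (_ * _).
rewrite -(bigA_distr_bigA (fun i j =>
  coord (vbasis {:V}) j (f (vbasis {:U})`_(u i)) *
  coord (vbasis {:T}) (w i) (g (vbasis {:V})`_j))) /=.
apply: eq_bigr => i _; rewrite comp_lfunE.
rewrite {1}(coord_vbasis (memvf (f (vbasis {:U})`_(u i)))).
by rewrite !linear_sum /=; apply: eq_bigr => j _; rewrite !linearZ.
Qed.

End TensorPower.

Section SubFunctors.
Variable F : fieldType.
Implicit Types (d : nat) (lam : seq nat) (U V : vectType F).

(* Meaningful when f maps X into Y, as in sym_map_stable and
   schur_map_stable.                                                          *)
Definition restr U V (X : {vspace U}) (Y : {vspace V}) (f : 'Hom(U, V)) :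
    'Hom(subvs_of X, subvs_of Y) :=
  (linfun (vsproj Y) \o f \o linfun vsval)%VF.

(* S^d V as the symmetric tensors; in characteristic 0 this is canonically
   isomorphic to the quotient of V^{(x) d} by the permutation of factors.     *)
Definition symtens d V : {vspace tens d V} :=
  (\bigcap_(s : 'S_d) fixedSpace (tens_perm V s))%VS.

Definition Sym d V : vectType F := subvs_of (symtens d V).

Definition sym_map d U V (f : 'Hom(U, V)) : 'Hom(Sym d U, Sym d V) :=
  restr (symtens d U) (symtens d V) (tens_map d f).

Lemma sym_map_stable d U V (f : 'Hom(U, V)) :
  (tens_map d f @: symtens d U <= symtens d V)%VS.
Proof.
apply/subvP=> _ /memv_imgP[x xS ->]; rewrite memvE.
apply/subv_bigcapP=> s _; rewrite -memvE; apply/fixedSpaceP.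
rewrite -comp_lfunE -tens_map_perm comp_lfunE; congr (tens_map d f _).
by apply/fixedSpaceP; move: xS; rewrite memvE => /subv_bigcapP/(_ s isT).
Qed.

(* The boxes of the Young diagram of lam are numbered 0, ..., |lam| - 1 row by
   row: reshape_index lam i is the row, reshape_offset lam i the column of
   box i. The Young symmetrizer is c_lam = a_lam b_lam, where a_lam is the
   sum of the permutations preserving the rows and b_lam the signed sum of
   those preserving the columns; the Schur functor is
   S^lam V = c_lam (V^{(x) |lam|}).                                           *)
Definition row_sym lam V : 'End(tens (sumn lam) V) :=
  \sum_(s : 'S_(sumn lam)
        | [forall i, reshape_index lam (s i) == reshape_index lam i])
     tens_perm V s.

Definition col_alt lam V : 'End(tens (sumn lam) V) :=
  \sum_(s : 'S_(sumn lam)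
        | [forall i, reshape_offset lam (s i) == reshape_offset lam i])
     (-1) ^+ s *: tens_perm V s.

Definition schurtens lam V : {vspace tens (sumn lam) V} :=
  limg (row_sym lam V \o col_alt lam V)%VF.

Definition Schur lam V : vectType F := subvs_of (schurtens lam V).

Definition schur_map lam U V (f : 'Hom(U, V)) : 'Hom(Schur lam U, Schur lam V) :=
  restr (schurtens lam U) (schurtens lam V) (tens_map (sumn lam) f).

Lemma schur_map_stable lam U V (f : 'Hom(U, V)) :
  (tens_map (sumn lam) f @: schurtens lam U <= schurtens lam V)%VS.
Proof.
have permE s x : tens_map _ f (tens_perm U s x) = tens_perm V s (tens_map _ f x).
  by rewrite -!comp_lfunE tens_map_perm.
have comR : (tens_map _ f \o row_sym lam U = row_sym lam V \o tens_map _ f)%VF.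
  apply/lfunP=> x; rewrite !comp_lfunE !sum_lfunE linear_sum /=.
  by apply: eq_bigr => s _; rewrite permE.
have comC : (tens_map _ f \o col_alt lam U = col_alt lam V \o tens_map _ f)%VF.
  apply/lfunP=> x; rewrite !comp_lfunE !sum_lfunE linear_sum /=.
  by apply: eq_bigr => s _; rewrite !scale_lfunE linearZ /= permE.
rewrite /schurtens -limg_comp comp_lfunA comR -comp_lfunA comC comp_lfunA.
by rewrite limg_comp limgS ?subvf.
Qed.

End SubFunctors.

Definition is_partition n (lam : seq nat) : bool :=
  [&& sorted geq lam, 0%N \notin lam & sumn lam == n].

Definition partition_of n :=
  {lam : n.-bseq 'I_n.+1 | is_partition n [seq val i | i <- lam]}.

Definition parts n (lam : partition_of n) : seq nat :=
  [seq val i | i <- val lam].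

Lemma parts_ex n (lam : seq nat) :
  is_partition n lam -> exists mu : partition_of n, parts mu = lam.
Proof.
move=> plam; have /and3P[_ lam0 /eqP sum_lam] := plam.
have sz : (size lam <= n)%N.
  rewrite -sum_lam; elim: lam {plam sum_lam} lam0 => //= x l IHl.
  rewrite inE negb_or eq_sym -lt0n => /andP[x_gt0 /IHl le_l].
  by rewrite -add1n leq_add.
have le_n x : x \in lam -> (x <= n)%N.
  rewrite -sum_lam => xlam; rewrite (perm_sumn (perm_to_rem xlam)) /=.
  exact: leq_addr.
have sz' : (size [seq (inord x : 'I_n.+1) | x <- lam] <= n)%N by rewrite size_map.
have E : [seq val i | i <- [seq (inord x : 'I_n.+1) | x <- lam]] = lam.
  rewrite -map_comp -[RHS]map_id; apply/eq_in_map => x /le_n le_x /=.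
  by rewrite inordK.
have pmu : is_partition n [seq val i | i <- Bseq sz'] by rewrite /= E.
by exists (exist _ (Bseq sz') pmu).
Qed.

Definition nzparts (lam : seq nat) : seq nat := [seq x <- lam | x != 0%N].

(* An isomorphism of GL(W)-representations between S^d(S^k W) and the direct
   sum, over the partitions lam of d * k, of m lam copies of S^lam W, given by
   its components f. Only the values of m on partitions of d * k matter.      *)
Definition plethysm_decomposition (F : fieldType) (W : vectType F) (d k : nat)
    (m : seq nat -> nat) : Prop :=
  exists f : forall lam : partition_of (d * k),
      'I_(m (parts lam)) -> 'Hom(Schur (parts lam) W, Sym d (Sym k W)),
  [/\ forall lam j, lker (f lam j) = 0%VS,
      forall lam j (g : 'End(W)), lker g = 0%VS ->
        (f lam j \o schur_map (parts lam) g
         = sym_map d (sym_map k g) \o f lam j)%VF,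
      directv (\sum_(i : {lam : partition_of (d * k) & 'I_(m (parts lam))})
                 limg (f (tag i) (tagged i)))
    & (\sum_(i : {lam : partition_of (d * k) & 'I_(m (parts lam))})
         limg (f (tag i) (tagged i)))%VS = fullv].

(* c is the coefficient of S^lam W in S^d(S^k W), for every W whose dimension
   is at least the number of nonzero parts of lam (otherwise S^lam W = 0 and
   the decomposition does not determine the coefficient).                     *)
Definition plethysm_coefficient (F : fieldType) (d k : nat) (lam : seq nat)
    (c : nat) : Prop :=
  forall W : vectType F, (size (nzparts lam) <= \dim {:W})%N ->
    (exists m, plethysm_decomposition W d k m) /\
    (forall m, plethysm_decomposition W d k m -> m (nzparts lam) = c).

Local Open Scope classical_set_scope.

Definition polyhedron n m (A : 'M[rat]_(n, m)) (b : 'cV[rat]_n) :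
    set 'cV[rat]_m :=
  [set x | forall i, (A *m x) i 0 <= b i 0].

Definition inhom_polytope n m (A : 'M[rat]_(n, m)) (b c : 'cV[rat]_n) :
    set 'cV[rat]_m :=
  polyhedron A (b + c).

Definition dilate m (s : nat) (P : set 'cV[rat]_m) : set 'cV[rat]_m :=
  [set s%:R *: x | x in P].

(* P is nonempty and the direction of its affine hull has dimension d. *)
Definition has_dim m (P : set 'cV[rat]_m) (d : nat) : Prop :=
  P !=set0 /\
  exists U : {vspace 'cV[rat]_m},
    [/\ \dim U = d,
        forall x y, P x -> P y -> x - y \in U
      & forall U' : {vspace 'cV[rat]_m},
          (forall x y, P x -> P y -> x - y \in U') -> (U <= U')%VS].

Definition inhom_has_dim n m (A : 'M[rat]_(n, m)) (b c : 'cV[rat]_n) (d : nat) :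
    Prop :=
  exists s0 : nat, forall s : nat, (s0 <= s)%N ->
    has_dim (inhom_polytope A (s%:R *: b) c) d.

Definition lattice_points m (P : set 'cV[rat]_m) : set 'cV[int]_m :=
  [set z | P (map_mx intr z)].

(* P contains finitely many lattice points, and their number is q. *)
Definition lattice_count m (P : set 'cV[rat]_m) (q : rat) : Prop :=
  exists2 k : nat, (lattice_points P #= `I_k)%card & q = k%:R.

Definition r_periodic (s : nat) : rat :=
  [:: 3; -1; 1; 0; 2; -2]`_(s %% 6).

Definition phi (s : nat) : rat := (s%:R + r_periodic s) / 3.

(* Main.v *)
Require Import Defs.
From HB Require Import structures.
From mathcomp Require Import all_boot all_order all_fingroup all_algebra.
From mathcomp Require Import boolp classical_sets functions cardinality reals.
From mathcomp Require Import complex.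
From mathcomp Require Import zify ring lra.

(* Multiplicities. S^d(S^k W) is the space of tensors in W^{(x) dk} fixed by
   the wreath product of S_k and S_d, i.e. the image of an idempotent e of the
   group algebra A of S_{dk}. The Young symmetrizers c_lam satisfy
   c_lam A c_lam = C c_lam and c_lam A c_mu = 0, and no nonzero h in A has
   h A c_lam = 0 for all lam, since the central elements
   sum_g g c_lam g^-1 are linearly independent and as numerous as the
   conjugacy classes. Dual bases of e A c_lam and c_lam A e for the pairing
   into C c_lam then decompose e, hence e W^{(x) dk}, into copies of the
   c_lam W^{(x) dk}. The coefficients are recovered from weight spaces: the
   weight (a, b) with a >= b occurs once in S^lam W if lam has at most two rows
   and lam_2 <= b, and not otherwise, while in S^d(S^k W) it occurs as often as
   there are partitions of b in a d x k box. So the coefficient of (7s, 5s) is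
   p(5s) - p(5s - 1), where p counts partitions in a 3 x 4s box, and this is
   computed by comparing the two sets of partitions.

   One-dimensional inhomogeneous polytopes. For large s the counting function
   is floor(us + v) + floor(u's + v') + 1, so its second differences are at
   least -2, whereas phi(s-1) - 2 phi(s) + phi(s+1) = -3 for 6 | s.

   Polyhedra. Let X_s be the set of lattice points of sP. Convexity gives
   X_s + X_t in X_(s+t), and phi takes the values 0, 1, 1, 2, 1, 3 at
   1, 2, 3, 4, 5, 6 and 3 at 8. These few values already force a lattice point
   in P or a second one in 5P. *)

Set Implicit Arguments.
Unset Strict Implicit.
Unset Printing Implicit Defensive.

Import Order.TTheory GRing.Theory Num.Theory.
Local Open Scope ring_scope.

(** * Lattice points of dilated polyhedra *)

(** Semisimplicity of the group algebra is never invoked. Its role is played by the involution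
    [galg_star]: the product of [galg_star x] with [x] vanishes only for [x = 0], and this
    positivity shows that Young symmetrizers and their central averages have nonzero square and that
    the pairing into the multiples of a symmetrizer is nondegenerate. Equivariance of a
    decomposition is exploited at a single invertible element, a diagonal map with entries 2, 3, 5,
    5, ...: its eigenvalue 2^a 3^b isolates the weight (a, b), so coefficients are read off
    dimensions of eigenspaces and no characters are needed. Passing from b to b - 1 loses exactly
    the two-row shape with second part b. The two plethysms agree because a d x k box and a k x d
    box contain equally many partitions of b; here both sets are put in bijection with the same
    pairs (y, z). For polyhedra no boundedness or vertex structure is available, only the finite
    numbers of lattice points; everything is deduced from rational convex combinations of a few of
    them. *)

Lemma card_eq_seq (T : eqType) (X : set T) (k : nat) : (X #= `I_k)%card ->
  exists s : seq T, [/\ uniq s, size s = k & forall x, X x <-> x \in s].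
Proof.
elim: k X => [|k IHk] X.
  rewrite II0 card_eq0 => /eqP ->.
  by exists [::].
move/eq_cardSP=> [x Xx /IHk [s [us szs sP]]].
exists (x :: s); split=> /=.
- rewrite us andbT; apply/negP => /sP [_ /=]; exact.
- by rewrite szs.
move=> y; rewrite inE; split=> [Xy|/orP[/eqP->//|/sP[]//]].
by case: eqP => //= neq_yx; apply/sP.
Qed.

Lemma card_eq_uniq_mem (T : eqType) (X : set T) (k : nat) (s : seq T) (x : T) :
  (X #= `I_k)%card -> uniq s -> size s = k -> (forall y, y \in s -> X y) ->
  X x -> x \in s.
Proof.
move=> /card_eq_seq[t [ut szt tP]] us szs sX Xx.
have sub : {subset s <= t} by move=> y /sX/tP.
by rewrite (uniq_min_size us sub _).2 ?szs ?szt //; apply/tP.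
Qed.

Lemma card_eq_fresh (T : eqType) (X : set T) (k : nat) (s : seq T) :
  (X #= `I_k)%card -> (size s < k)%N -> exists2 x, x \notin s & X x.
Proof.
move=> /card_eq_seq[t [ut <- tP]] lt_st.
have [/allP sub|/allPn[x xt xs]] := boolP (all (mem s) t).
  by have := uniq_leq_size ut sub; rewrite leqNgt lt_st.
by exists x => //; apply/tP.
Qed.

Lemma lattice_count_nat m (P : set 'cV[rat]_m) (k : nat) :
  lattice_count P k%:R -> (lattice_points P #= `I_k)%card.
Proof. by case=> k' PE /eqP; rewrite eqr_nat => /eqP ->. Qed.

Section ConeOfPolyhedron.
Variables (n m : nat) (A : 'M[rat]_(n, m)) (b : 'cV[rat]_n).

Let X s := lattice_points (dilate s (polyhedron A b)).

(** For [s = 0] this would fail: the dilate is then at most the origin, while the inequalities cut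
    out the recession cone. *)
Lemma dilateP s (z : 'cV[int]_m) : (0 < s)%N ->
  X s z <-> forall i, (A *m map_mx intr z) i 0 <= s%:R * b i 0.
Proof.
move=> s_gt0; have s0 : (0 : rat) < s%:R by rewrite ltr0n.
split=> [[x Px /= <-] i|Hz].
  by rewrite -scalemxAr mxE ler_pM2l.
exists (s%:R^-1 *: map_mx intr z); last by rewrite scalerA divff ?gt_eqF ?scale1r.
by move=> i; rewrite -scalemxAr mxE mulrC ler_pdivrMr // mulrC.
Qed.

(** The pairs (z, s) with z in sP form a convex cone. Dividing by [c] produces lattice points that
    are not sums of known ones, such as halves and quarters. *)
Lemma dilate_comb s (z : 'cV[int]_m) s1 (z1 : 'cV[int]_m) s2 (z2 : 'cV[int]_m)
    (u v : nat) (c : int) :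
  (0 < s)%N -> (0 < s1)%N -> (0 < s2)%N -> 0 < c ->
  X s1 z1 -> X s2 z2 -> c *: z = u%:Z *: z1 + v%:Z *: z2 ->
  c * s%:Z = (u * s1 + v * s2)%N%:Z -> X s z.
Proof.
move=> s_gt0 s1_gt0 s2_gt0 c_gt0 /(dilateP _ s1_gt0) X1 /(dilateP _ s2_gt0) X2.
move=> zE sE; apply/(dilateP _ s_gt0) => i.
have c0 : (0 : rat) < c%:~R by rewrite ltr0z.
have sQ : c%:~R * s%:R = u%:R * s1%:R + v%:R * s2%:R :> rat.
  by have := congr1 (fun e : int => e%:~R : rat) sE; rewrite /= intrM -!pmulrn natrD !natrM.
rewrite -(ler_pM2l c0) mulrA sQ.
have -> : c%:~R * (A *m map_mx intr z) i 0 =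
    u%:R * (A *m map_mx intr z1) i 0 + v%:R * (A *m map_mx intr z2) i 0.
  have := congr1 (fun w => (A *m map_mx intr w) i 0) zE.
  rewrite map_mxD !map_mxZ mulmxDr -!scalemxAr !mxE => ->.
  by [].
rewrite mulrDl -!mulrA.
by apply: lerD; apply: ler_wpM2l.
Qed.

End ConeOfPolyhedron.

Lemma phiE s : phi s = (s%:R + r_periodic (s %% 6)) / 3.
Proof. by rewrite /phi /r_periodic modn_mod. Qed.

(* [lia] does not identify matrix entries whose types are only convertible. *)
Local Ltac intlin :=
  repeat match goal with |- context [@fun_of_matrix ?T ?m ?n ?M ?i ?j] =>
    let e := fresh "e" in
    set e := (M i j : int); clearbody e end; lia.

Lemma phi_not_ehrhart : ~ (exists (n m : nat) (A : 'M[rat]_(n, m)) (b : 'cV[rat]_n),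
  forall s : nat, lattice_count (dilate s (polyhedron A b)) (phi s)).
Proof.
move=> [n [m [A [b H]]]].
pose X s := lattice_points (dilate s (polyhedron A b)).
have cX s (k : nat) : phi s = k%:R -> (X s #= `I_k)%card.
  by move=> phis; apply: lattice_count_nat; rewrite -phis.
have X1 : (X 1%N #= `I_0)%card by apply: cX.
have X2 : (X 2%N #= `I_1)%card by apply: cX.
have X3 : (X 3%N #= `I_1)%card by apply: cX.
have X4 : (X 4%N #= `I_2)%card by apply: cX.
have X5 : (X 5%N #= `I_1)%card by apply: cX.
have X6 : (X 6%N #= `I_3)%card by apply: cX.
have X8 : (X 8%N #= `I_3)%card by apply: cX.
have E1 z : ~ X 1%N z by move=> Xz; have : z \in [::] by apply: (card_eq_uniq_mem X1).
have [x _ Xx] : exists2 x : 'cV[int]_m, x \notin [::] & X 2%N x.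
  exact: card_eq_fresh X2 _.
have [y _ Xy] : exists2 y : 'cV[int]_m, y \notin [::] & X 3%N y.
  exact: card_eq_fresh X3 _.
have entry (M N : 'cV[int]_m) : M = N -> forall i j, M i j = N i j by move=> ->.
have comb := @dilate_comb n m A b.
have Xxx : X 4%N (x + x).
  apply: (comb 4%N _ 2%N x 2%N x 1%N 1%N 1) => //.
  by rewrite !scale1r.
have [z + Xz] : exists2 z : 'cV[int]_m, z \notin [:: x + x] & X 4%N z.
  exact: card_eq_fresh X4 _.
rewrite inE => neq_z.
(* If x is twice a lattice vector, then x / 2 is a lattice point of P, contradicting phi(1) = 0. *)
have X1half (t u : 'cV[int]_m) : x = t + t - (u + u) -> False.
  move=> xE; apply: (E1 (t - u)).
  apply: (comb 1%N _ 2%N x 2%N x 1%N 0%N 2) => //.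
  rewrite scale1r scale0r addr0 xE.
  by apply/matrixP=> i j; rewrite !mxE; ring.
(* The three sums of two points of [X 4] are distinct, and phi(8) = 3, so they exhaust [X 8]. *)
have mem8 t : X 8%N t -> t \in [:: x + x + x + x; x + x + z; z + z].
  apply: (card_eq_uniq_mem X8) => //=.
    rewrite !inE !andbT !negb_or.
    have -> : x + x + x + x = x + x + (x + x) by rewrite !addrA.
    rewrite (inj_eq (addrI _)) (inj_eq (addIr _)) ![x + x == z]eq_sym neq_z /= andbT.
    apply/eqP=> E; move/eqP: neq_z; apply.
    apply/matrixP=> i j; have := entry _ _ E i j.
    by rewrite !mxE; intlin.
  move=> y'; rewrite !inE => /or3P[] /eqP ->.
  - apply: (comb 8%N _ 4%N (x + x) 4%N (x + x) 1%N 1%N 1) => //.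
    by rewrite !scale1r addrA.
  - apply: (comb 8%N _ 4%N (x + x) 4%N z 1%N 1%N 1) => //.
    by rewrite !scale1r.
  - apply: (comb 8%N _ 4%N z 4%N z 1%N 1%N 1) => //.
    by rewrite !scale1r.
(* The level is 2 + 2 * 3 = 8. The first and the last of the three possible equations make x
   even. *)
have : x + (y + y) \in [:: x + x + x + x; x + x + z; z + z].
  apply: mem8; apply: (comb 8%N _ 2%N x 3%N y 1%N 2%N 1) => //.
  by rewrite !scale1r; congr (_ + _); rewrite -mulr2n -scaler_nat.
rewrite !inE => /or3P[/eqP/entry E|/eqP/entry E|/eqP/entry E].
- apply: (X1half y x); apply/matrixP=> i j.
  by move: (E i j); rewrite !mxE; intlin.
- have zE : z = y + y - x.
    by apply/matrixP=> i j; move: (E i j); rewrite !mxE; intlin.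
  (* A third point of [X 6]: since t + x lies in [X 8] and differs from the first two points there,
     it equals 2 z, so t = 4 y - 3 x. *)
  have [t neq_t Xt] : exists2 t : 'cV[int]_m, t \notin [:: x + x + x; x + z] & X 6%N t.
    exact: card_eq_fresh X6 _.
  have /mem8 : X 8%N (t + x).
    apply: (comb 8%N _ 6%N t 2%N x 1%N 1%N 1) => //.
    by rewrite !scale1r.
  move: neq_t; rewrite !inE negb_or => /andP[neq1 neq2].
  rewrite (inj_eq (addIr _)) (negPf neq1) /= [x + x + z]addrAC.
  rewrite (inj_eq (addIr _)) (negPf neq2) /= => /eqP/entry tE.
  have X5a : X 5%N (x + y).
    apply: (comb 5%N _ 2%N x 3%N y 1%N 1%N 1) => //.
    by rewrite !scale1r.
  (* This is (3 t + x) / 4, with levels 3 * 6 + 2 = 4 * 5. As phi(5) = 1 it equals x + y, hence 3 x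
     = 2 y and x is even. *)
  have X5b : X 5%N (y + y + y - x - x).
    apply: (comb 5%N _ 6%N t 2%N x 3%N 1%N 4) => //.
    apply/matrixP=> i j; move: (tE i j); rewrite zE !mxE; intlin.
  have /entry E5 : x + y = y + y + y - x - x.
    apply/eqP; rewrite -mem_seq1.
    by apply: (card_eq_uniq_mem X5) => // u; rewrite inE => /eqP ->.
  apply: (X1half y x); apply/matrixP=> i j.
  by move: (E5 i j); rewrite !mxE; intlin.
- apply: (X1half z y); apply/matrixP=> i j.
  by move: (E i j); rewrite !mxE; intlin.
Qed.

(** * One-dimensional inhomogeneous polytopes *)

(** The lexicographically least pair of slope and intercept gives the line that is eventually
    lowest. *)
Lemma eventually_min_line (l : seq (rat * rat)) : l != [::] ->
  exists2 p, p \in l & exists s0 : nat, forall s : nat, (s0 <= s)%N ->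
    forall q, q \in l -> s%:R * p.1 + p.2 <= s%:R * q.1 + q.2.
Proof.
elim: l => [//|q l IHl] _.
have [->|/IHl[p pl [s0 Hp]]] := eqVneq l [::].
  by exists q; [rewrite inE eqxx|exists 0%N => s _ q'; rewrite inE => /eqP ->].
have two (u v : rat * rat) : u.1 < v.1 \/ (u.1 = v.1 /\ u.2 <= v.2) ->
    exists s1 : nat, forall s : nat, (s1 <= s)%N ->
      s%:R * u.1 + u.2 <= s%:R * v.1 + v.2.
  case=> [lt_uv|[-> le_uv]]; last by exists 0%N => s _; rewrite lerD2l.
  (* Beyond the abscissa where the two lines cross. *)
  exists (Num.bound `|(u.2 - v.2) / (v.1 - u.1)|) => s le_s.
  have d_gt0 : 0 < v.1 - u.1 by rewrite subr_gt0.
  have : (u.2 - v.2) / (v.1 - u.1) <= s%:R.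
    apply: le_trans (ler_norm _) _; apply: ltW.
    by apply: lt_le_trans (archi_boundP (normr_ge0 _)) _; rewrite ler_nat.
  rewrite ler_pdivrMr //; nra.
have [le_pq|le_qp] : (p.1 < q.1 \/ (p.1 = q.1 /\ p.2 <= q.2)) \/
    (q.1 < p.1 \/ (q.1 = p.1 /\ q.2 <= p.2)).
- have [lt|lt|E] := ltgtP p.1 q.1; [by left; left|by right; left|].
  by case/orP: (le_total p.2 q.2) => le2; [left|right]; right.
- have [s1 H1] := two _ _ le_pq.
  exists p; first by rewrite inE pl orbT.
  exists (maxn s0 s1) => s; rewrite geq_max => /andP[le0 le1] q'.
  by rewrite inE => /orP[/eqP ->|]; [apply: H1|apply: Hp].
have [s1 H1] := two _ _ le_qp.
exists q; first by rewrite inE eqxx.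
exists (maxn s0 s1) => s; rewrite geq_max => /andP[le0 le1] q'.
rewrite inE => /orP[/eqP -> //|q'l].
by apply: le_trans (H1 _ le1) (Hp _ le0 _ q'l).
Qed.

(** The count is a successor because an empty interval does not determine [hi - lo]. *)
Lemma card_int_interval (X : set 'cV[int]_1) (k : nat) (lo hi : int) :
  (X #= `I_k.+1)%card -> (forall z, X z <-> lo <= z 0 0 <= hi) ->
  hi - lo + 1 = k.+1.
Proof.
move=> /card_eq_seq[s [us szs sP]] XP.
have Xs z : (z \in s) = (lo <= z 0 0 <= hi).
  by apply/idP/idP=> [/sP/XP|/XP/sP].
have le_lohi : lo <= hi.
  case: s szs {us sP} Xs => //= z s _ /(_ z); rewrite inE eqxx /=.
  by move/esym/andP=> [/le_trans]; apply.
pose t := [seq (\col_(i < 1) (lo + i0%:Z) : 'cV[int]_1) | i0 <- iota 0 (absz (hi - lo + 1))].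
have ut : uniq t.
  rewrite map_inj_uniq ?iota_uniq // => i j /(congr1 (fun M : 'cV[int]_1 => M 0 0)).
  by rewrite !mxE => /addrI [].
have /perm_size : perm_eq s t.
  apply: uniq_perm => // z; rewrite Xs; apply/idP/mapP.
    move=> /andP[le1 le2]; exists (absz (z 0 0 - lo)%R).
      by rewrite mem_iota; lia.
    by apply/matrixP=> i j; rewrite !ord1 mxE; lia.
  case=> i; rewrite mem_iota => /andP[_ lt_i] ->; rewrite mxE; lia.
rewrite szs size_map size_iota; lia.
Qed.

(** Residues 0, 1 and 5 suffice: at 6k - 1, 6k, 6k + 1 the values are 2k - 1, 2k + 1, 2k. *)
Lemma phi_affine s : phi (6 * s) = (2 * s).+1%:R
  /\ phi (6 * s).+1 = (2 * s)%:R /\ phi (6 * s.+1).-1 = (2 * s).+1%:R.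
Proof.
have E : (6 * s.+1).-1 = (6 * s + 5)%N by lia.
have E0 : ((6 * s) %% 6 = 0)%N by lia.
have E1 : ((6 * s).+1 %% 6 = 1)%N by lia.
have E5 : ((6 * s + 5) %% 6 = 5)%N by lia.
rewrite E !phiE E0 E1 E5 /r_periodic /= -[(6 * s).+1]addn1 -[(2 * s).+1]addn1.
by rewrite !(natrM, natrD); split; [|split]; lra.
Qed.

(** The outer floors add up to more than 2 (su + u + v) - 2, hence to more than twice the middle
    floor minus 2, and all terms are integers. *)
Lemma floor_second_difference (u v : rat) (s : nat) :
  2 * Num.floor (s.+1%:R * u + v) - 1 <=
  Num.floor (s%:R * u + v) + Num.floor (s.+2%:R * u + v).
Proof.
set x := Num.floor (s.+1%:R * u + v).
set y := Num.floor (s%:R * u + v); set z := Num.floor (s.+2%:R * u + v).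
have Hx : x%:~R <= s.+1%:R * u + v by rewrite floor_le.
have Hy : s%:R * u + v < (y + 1)%:~R by rewrite floorD1_gt.
have Hz : s.+2%:R * u + v < (z + 1)%:~R by rewrite floorD1_gt.
suff : (2 * x - 1)%:~R < (y + z + 1)%:~R :> rat by rewrite ltr_int; lia.
move: Hx Hy Hz; rewrite -!natr1 !(intrD, intrM, intrB) /=; lra.
Qed.

Section OneDimensional.
Variables (n : nat) (a b c : 'cV[rat]_n).

Let X s := lattice_points (inhom_polytope a (s%:R *: b) c).

Lemma inhom_pointP s (z : 'cV[int]_1) :
  X s z <-> forall i, a i 0 * (z 0 0)%:~R <= s%:R * b i 0 + c i 0.
Proof.
rewrite /X /lattice_points /inhom_polytope /polyhedron /=; split=> H i; have := H i.
  by rewrite !mxE big_ord1 mxE.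
by rewrite !mxE big_ord1 mxE.
Qed.

(** Otherwise the whole ray z, z + 1, z + 2, ... satisfies the inequalities. *)
Lemma inhom_bounded s (t : seq 'cV[int]_1) (z : 'cV[int]_1) :
  X s z -> (forall x, X s x -> x \in t) -> exists i, 0 < a i 0.
Proof.
move=> Xz tP; have [//|noa] := pselect (exists i, 0 < a i 0).
pose w := [seq (\col_(i < 1) (z 0 0 + i0%:Z) : 'cV[int]_1) | i0 <- iota 0 (size t).+1].
have uw : uniq w.
  rewrite map_inj_uniq ?iota_uniq // => i j /(congr1 (fun M : 'cV[int]_1 => M 0 0)).
  by rewrite !mxE => /addrI [].
have : (size w <= size t)%N.
  apply: uniq_leq_size => // _ /mapP[i _ ->]; apply/tP/inhom_pointP => j.
  move/inhom_pointP/(_ j): Xz; apply: le_trans; rewrite mxE intrD mulrDr gerDl.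
  apply: mulr_le0_ge0; last by rewrite ler0n.
  by rewrite leNgt; apply/negP=> ai; apply: noa; exists j.
by rewrite size_map size_iota ltnn.
Qed.

Lemma inhom_upper : (exists i, 0 < a i 0) ->
  exists u v : rat, exists s0 : nat, forall s : nat, (s0 <= s)%N ->
    forall z : int, (forall i, 0 < a i 0 -> a i 0 * z%:~R <= s%:R * b i 0 + c i 0) <->
      z <= Num.floor (s%:R * u + v).
Proof.
move=> [i0 ai0].
pose l := [seq (b i 0 / a i 0, c i 0 / a i 0) | i <- enum 'I_n & 0 < a i 0].
have lP i : 0 < a i 0 -> (b i 0 / a i 0, c i 0 / a i 0) \in l.
  by move=> ai; apply/mapP; exists i; rewrite // mem_filter ai mem_enum.
have [] := @eventually_min_line l; first by apply/eqP=> l0; have := lP _ ai0; rewrite l0.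
move=> [u v] uvl [s0 Hs0]; exists u, v, s0 => t le_t z.
have E i x : 0 < a i 0 -> (a i 0 * x <= t%:R * b i 0 + c i 0) =
    (x <= t%:R * (b i 0 / a i 0) + c i 0 / a i 0).
  by move=> ai; rewrite mulrA -mulrDl ler_pdivlMr // mulrC.
rewrite floor_ge_int; split=> [H|H i ai].
  case/mapP: uvl => i; rewrite mem_filter => /andP[ai _] [-> ->].
  by rewrite -E //; apply: H.
by rewrite E //; apply: le_trans H (Hs0 _ le_t _ (lP _ ai)).
Qed.

End OneDimensional.

Lemma phi_not_inhom (n : nat) (a b c : 'cV[rat]_n) :
  ~ (forall s : nat, lattice_count (inhom_polytope a (s%:R *: b) c) (phi s)).
Proof.
move=> H; pose X s := lattice_points (inhom_polytope a (s%:R *: b) c).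
have cX s (k : nat) : phi s = k%:R -> (X s #= `I_k)%card.
  by move=> phis; apply: lattice_count_nat; rewrite -phis.
have X0 : (X 0%N #= `I_1)%card by apply: cX.
have [t [_ _ tP]] := card_eq_seq X0.
have [z _ Xz] := card_eq_fresh X0 (s := [::]) isT.
have [] := @inhom_upper _ a b c.
  by apply: (inhom_bounded (t := t) Xz) => x Xx; apply/tP.
move=> u [v [s0 Hu]].
(* Lower bounds on z are upper bounds on -z. *)
have [] := @inhom_upper _ (- a) b c.
  apply: (@inhom_bounded _ (- a) b c 0%N [seq - x | x <- t] (- z)).
    move: Xz => /inhom_pointP Xz; apply/inhom_pointP => i.
    by have := Xz i; rewrite !mxE mulrNz mulrNN.
  move=> x Xx; rewrite -[x]opprK; apply: map_f; apply/tP.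
  move: Xx => /inhom_pointP Xx; apply/inhom_pointP => i.
  by have := Xx i; rewrite !mxE mulrNz mulNr mulrN.
move=> u' [v' [s1 Hl]].
have count s k : (s0 <= s)%N -> (s1 <= s)%N -> phi s = k.+1%:R ->
    Num.floor (s%:R * u + v) + Num.floor (s%:R * u' + v') + 1 = k.+1.
  move=> le0 le1 /cX Xk; rewrite -[Num.floor (_ * u' + _)]opprK.
  apply: (card_int_interval Xk) => y.
  (* The point w witnesses the inequalities with a_i = 0, which do not involve the variable. *)
  have [w _ /inhom_pointP Xw] := card_eq_fresh Xk (s := [::]) isT.
  have Hu' := Hu _ le0 (y 0 0); have Hl' := Hl _ le1 (- y 0 0).
  rewrite lerNl; split=> [/inhom_pointP Xy|/andP[/Hl' yl /Hu' yu]].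
    apply/andP; split; [apply/Hl' => i _|apply/Hu' => i _]; last exact: Xy.
    by rewrite mxE mulrNz mulrNN.
  apply/inhom_pointP => i; have [ai|ai|ai] := ltgtP (a i 0) 0.
  - by have := yl i; rewrite mxE mulrNz mulrNN oppr_gt0; apply.
  - exact: yu.
  - by have := Xw i; rewrite ai !mul0r.
(* The three arguments 6k - 1, 6k, 6k + 1 lie beyond both thresholds, and k is positive so that its
   predecessor gives the value at 6k - 1. *)
pose k := (maxn s0 s1).+1.
have [p0 [p1 _]] := phi_affine k; have [_ [_ pm]] := phi_affine k.-1.
have le0 : (s0 <= k)%N by rewrite /k; lia.
have le1 : (s1 <= k)%N by rewrite /k; lia.
have k_gt0 : (0 < k)%N by [].
clearbody k.
have c0 : _ = (2 * k).+1%:Z := count (6 * k)%N (2 * k)%N ltac:(lia) ltac:(lia) p0.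
have c1 : _ = (2 * k).-1.+1%:Z := count (6 * k).+1 (2 * k).-1 ltac:(lia) ltac:(lia)
  (etrans p1 (congr1 (fun i => i%:R) (esym (prednK (n := 2 * k) ltac:(lia))))).
have cm : _ = (2 * k.-1).+1%:Z := count (6 * k).-1 (2 * k.-1)%N ltac:(lia) ltac:(lia)
  (etrans (congr1 (fun i => phi (6 * i).-1) (esym (prednK k_gt0))) pm).
have := floor_second_difference u v (6 * k).-1.
have := floor_second_difference u' v' (6 * k).-1.
have Ek : (6 * k).-1.+1 = (6 * k)%N by lia.
rewrite Ek; move: c0 c1 cm.
set A := Num.floor _; set B := Num.floor _; set C := Num.floor _.
set A' := Num.floor _; set B' := Num.floor _; set C' := Num.floor _.
clearbody A B C A' B' C'; lia.
Qed.

(** * Group algebras *)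

Section GroupAlgebra.
Variables (C : numClosedFieldType) (gT : finGroupType).

Definition galg := {ffun gT -> C^o}.
HB.instance Definition _ := Vector.on galg.

Implicit Types (x y z : galg) (g h : gT).

Definition galg_delta g : galg := [ffun h => (h == g)%:R].
Definition galg_mul x y : galg := [ffun g => \sum_h (x h : C) * y (h^-1 * g)%g].
(** The adjoint in the regular representation, for the inner product in which the group elements are
    orthonormal. *)
Definition galg_star x : galg := [ffun g => (x g^-1%g : C)^*].

Fact galg_mulA : associative galg_mul.
Proof.
move=> x y z; apply/ffunP=> g; rewrite !ffunE.
under eq_bigr => h _ do rewrite ffunE mulr_sumr.
under [RHS]eq_bigr => h _ do rewrite ffunE mulr_suml.
rewrite [RHS]exchange_big /=; apply: eq_bigr => h _.
rewrite [RHS](reindex_inj (mulgI h)) /=; apply: eq_bigr => k _.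
by rewrite mulKg invMg mulrA mulgA.
Qed.

Fact galg_mul1l : left_id (galg_delta 1%g) galg_mul.
Proof.
move=> x; apply/ffunP=> g; rewrite ffunE (bigD1 1%g) //= ffunE eqxx mul1r.
by rewrite invg1 mul1g big1 ?addr0 // => h /negPf h1; rewrite ffunE h1 mul0r.
Qed.

Fact galg_mul1r : right_id (galg_delta 1%g) galg_mul.
Proof.
move=> x; apply/ffunP=> g; rewrite ffunE (bigD1 g) //= ffunE mulVg eqxx mulr1.
rewrite big1 ?addr0 // => h /negPf hg; rewrite ffunE -eq_mulVg1 hg mulr0 //.
Qed.

Fact galg_mulDl : left_distributive galg_mul +%R.
Proof.
move=> x y z; apply/ffunP=> g; rewrite !ffunE -big_split /=.
by apply: eq_bigr => h _; rewrite ffunE mulrDl.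
Qed.

Fact galg_mulDr : right_distributive galg_mul +%R.
Proof.
move=> x y z; apply/ffunP=> g; rewrite !ffunE -big_split /=.
by apply: eq_bigr => h _; rewrite ffunE mulrDr.
Qed.

Fact galg_1neq0 : galg_delta 1%g != 0.
Proof.
by apply/eqP=> /ffunP/(_ 1%g)/eqP; rewrite !ffunE eqxx oner_eq0.
Qed.

HB.instance Definition _ := GRing.Zmodule_isNzRing.Build galg
  galg_mulA galg_mul1l galg_mul1r galg_mulDl galg_mulDr galg_1neq0.

Fact galg_scalerAl (a : C) x y : a *: (x * y) = (a *: x) * y.
Proof.
apply/ffunP=> g; rewrite !ffunE scaler_sumr; apply: eq_bigr => h _.
by rewrite ffunE /GRing.scale /= mulrA.
Qed.

HB.instance Definition _ := GRing.Lmodule_isLalgebra.Build C galg galg_scalerAl.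

Fact galg_scalerAr (a : C) x y : a *: (x * y) = x * (a *: y).
Proof.
apply/ffunP=> g; rewrite !ffunE scaler_sumr; apply: eq_bigr => h _.
by rewrite ffunE /GRing.scale /= mulrCA.
Qed.

HB.instance Definition _ := GRing.Lalgebra_isAlgebra.Build C galg galg_scalerAr.

Lemma galg_mulE x y g : (x * y) g = \sum_h (x h : C) * y (h^-1 * g)%g.
Proof. by rewrite ffunE. Qed.

Lemma galg_deltaE g h : galg_delta g h = (h == g)%:R :> C.
Proof. by rewrite ffunE. Qed.

Lemma galg_deltaM g h : galg_delta (g * h)%g = galg_delta g * galg_delta h.
Proof.
apply/ffunP=> k; rewrite galg_mulE (bigD1 g) //= !ffunE eqxx mul1r.
rewrite big1 ?addr0 => [|i /negPf ig]; last by rewrite ffunE ig mul0r.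
by congr (nat_of_bool _)%:R; rewrite -[RHS](inj_eq (mulgI g)) mulKVg.
Qed.

Lemma galg_sum x : x = \sum_g (x g : C) *: galg_delta g.
Proof.
apply/ffunP=> h; rewrite sum_ffunE (bigD1 h) //= !ffunE eqxx big1 ?addr0.
  by rewrite /GRing.scale /= mulr1.
by move=> g /negPf gh; rewrite !ffunE eq_sym gh scaler0.
Qed.

Lemma galg_starK : involutive galg_star.
Proof. by move=> x; apply/ffunP=> g; rewrite !ffunE invgK conjCK. Qed.

Lemma galg_starM x y : galg_star (x * y) = galg_star y * galg_star x.
Proof.
apply/ffunP=> g; rewrite ffunE !galg_mulE rmorph_sum /=.
rewrite (reindex_inj (mulgI g^-1%g)) /=; apply: eq_bigr => h _.
by rewrite rmorphM mulrC !ffunE !invMg !invgK -mulgA mulgV mulg1.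
Qed.

Lemma galg_star0 : galg_star 0 = 0.
Proof. by apply/ffunP=> g; rewrite !ffunE conjC0. Qed.

(* The value at 1 of [x^* x] is the sum of the squared moduli of [x]. *)
Lemma galg_starM_eq0 x : galg_star x * x = 0 -> x = 0.
Proof.
move/ffunP/(_ 1%g); rewrite galg_mulE [RHS]ffunE => /eqP.
rewrite (reindex_inj invg_inj) /= psumr_eq0 => [/allP x0|h _]; last first.
  by rewrite ffunE !invgK mulg1 mulrC mul_conjC_ge0.
apply/ffunP=> g; rewrite [RHS]ffunE; apply/eqP.
have := x0 g; rewrite mem_index_enum => /(_ isT) /=.
by rewrite ffunE !invgK mulg1 mulrC mul_conjC_eq0.
Qed.

Lemma galg_Mstar_eq0 x : x * galg_star x = 0 -> x = 0.
Proof.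
rewrite -{1}[x]galg_starK => /galg_starM_eq0 E.
by rewrite -[x]galg_starK E galg_star0.
Qed.

End GroupAlgebra.

(** * Young symmetrizers *)

Section Diagrams.
Variable I : finType.
Implicit Types (row col : I -> nat).

(* The boxes of a Young diagram, numbered by I: no box is repeated, and every
   column is an initial segment of rows. *)
Definition diagram row col :=
  (forall i j, row i = row j -> col i = col j -> i = j) /\
  (forall i r, (r <= row i)%N -> exists j, row j = r /\ col j = col i).

(** For the diagram of lam this is lam_1 + ... + lam_r, so comparing these numbers is the dominance
    order. *)
Definition below row (r : nat) := #|[pred i | (row i < r)%N]|.

Lemma below_col row col r :
  below row r = (\sum_(c < (\max_i col i).+1)
                   #|[pred i | (row i < r)%N && (col i == c)]|)%N.
Proof.
rewrite /below -sum1_card (partition_big (fun i => inord (col i) : 'I_(\max_i col i).+1) xpredT) //=.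
apply: eq_bigr => c _; rewrite -sum1_card; apply: eq_bigl => i.
rewrite !inE; congr (_ && _); rewrite -val_eqE /= inordK // ltnS.
exact: leq_bigmax.
Qed.

Variables (row row' col' : I -> nat).
Hypothesis D' : diagram row' col'.
Hypothesis sep : forall i j, row i = row j -> col' i = col' j -> i = j.

(** If column c of the second diagram reaches row r, it has a box in every row above, and by [sep]
    the first numbering has at most one box of the column in each of these rows. Otherwise the whole
    column lies above row r. *)
Lemma column_le r c :
  (#|[pred i | (row i < r)%N && (col' i == c)]| <=
   #|[pred i | (row' i < r)%N && (col' i == c)]|)%N.
Proof.
have [/existsP[k /andP[/eqP colk rowk]]|/existsPn no] :=
  boolP [exists k, (col' k == c) && (r <= row' k)%N]; last first.
  apply: subset_leq_card; apply/fintype.subsetP=> i; rewrite !inE => /andP[_ ci].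
  by rewrite ci andbT ltnNge; have := no i; rewrite ci.
have ex i : exists j, (row i < r)%N -> row' j = row i /\ col' j = c.
  have [lt_ir|] := boolP (row i < r)%N; last by exists i.
  have [j [rj cj]] := D'.2 k (row i) (ltnW (leq_trans lt_ir rowk)).
  by exists j; rewrite cj.
have [f Hf] := choice ex.
have injf : {in [pred i | (row i < r)%N && (col' i == c)] &, injective f}.
  move=> i j; rewrite !inE => /andP[ri /eqP ci] /andP[rj /eqP cj] fij.
  by apply: sep; rewrite ?ci ?cj // -(Hf i ri).1 -(Hf j rj).1 fij.
rewrite -(card_in_image injf); apply: subset_leq_card.
apply/fintype.subsetP=> y /fintype.imageP[i Pi ->]; move: Pi; rewrite !inE => /andP[ri _].
by have [-> ->] := Hf i ri; rewrite ri eqxx.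
Qed.

Lemma below_le r : (below row r <= below row' r)%N.
Proof. by rewrite !(below_col _ col'); apply: leq_sum => c _; apply: column_le. Qed.

(** Equal sums over the columns force equality in [column_le] for every column, so each box can be
    moved within its [col'] column to the row prescribed by [row]. *)
Lemma below_eq_perm : (forall r, below row r = below row' r) ->
  exists h : {perm I}, forall i, row' (h i) = row i /\ col' (h i) = col' i.
Proof.
move=> eq_below.
have col_eq r i : #|[pred k | (row k < r)%N && (col' k == col' i)]| =
                  #|[pred k | (row' k < r)%N && (col' k == col' i)]|.
  have := eq_below r; rewrite !(below_col _ col') => /eqP.
  rewrite (leqif_sum (fun (c : 'I_(\max_j col' j).+1) _ => leqif_eq (column_le r c))).2 => /forallP.
  have lt_i : (col' i < (\max_j col' j).+1)%N by rewrite ltnS; exact: leq_bigmax.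
  by move/(_ (Ordinal lt_i))/eqP.
have ex i : exists j, row' j = row i /\ col' j = col' i.
  (* Raising the bound from [row i] to its successor gains the box i for [row]; the counts for
     [row'] agree, so they gain a box as well. *)
  pose P s (f : I -> nat) := [pred k | (f k < s)%N && (col' k == col' i)].
  have ltP : (#|P (row i) row'| < #|P (row i).+1 row'|)%N.
    rewrite -!col_eq; apply: proper_card; apply/fintype.properP; split.
      by apply/fintype.subsetP=> k; rewrite !inE => /andP[/ltnW ltk ->]; rewrite ltnS ltk.
    by exists i; rewrite !inE ?ltnn // ltnS leqnn eqxx.
  have [|j] := @fintype.subsetPn _ (P (row i).+1 row') (P (row i) row') _.
    by apply/negP=> /subset_leq_card; rewrite leqNgt ltP.
  rewrite !inE => /andP[lt_j /eqP cj]; rewrite cj eqxx andbT -leqNgt => le_j.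
  by exists j; split=> //; apply/eqP; rewrite eqn_leq le_j andbT -ltnS.
have [f Hf] := choice ex.
have injf : injective f.
  move=> i j fij; apply: sep; first by rewrite -(Hf i).1 -(Hf j).1 fij.
  by rewrite -(Hf i).2 -(Hf j).2 fij.
by exists (perm injf) => i; rewrite permE.
Qed.

End Diagrams.

Section YoungSymmetrizer.
Variables (C : numClosedFieldType) (I : finType).
Local Notation A := (galg C {perm I}).
Local Notation "'δ' s" := (@galg_delta C _ s) (at level 9).
Implicit Types (row col : I -> nat) (s g : {perm I}) (x : A).

Definition keeps row s := [forall i, row (s i) == row i].
Definition sym_of row : A := \sum_(s | keeps row s) δ s.
Definition alt_of col : A := \sum_(s | keeps col s) (-1) ^+ s *: δ s.
Definition young row col : A := sym_of row * alt_of col.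

Lemma keepsP row s : reflect (forall i, row (s i) = row i) (keeps row s).
Proof. exact: 'forall_eqP. Qed.

Lemma keepsM row s g : keeps row s -> keeps row g -> keeps row (s * g)%g.
Proof. by move=> /keepsP ks /keepsP kg; apply/keepsP=> i; rewrite permM kg ks. Qed.

Lemma keepsV row s : keeps row s^-1%g = keeps row s.
Proof.
apply/keepsP/keepsP=> ks i; first by rewrite -ks permK.
by rewrite -ks permKV.
Qed.

Lemma keepsMl row s g : keeps row s -> keeps row (s * g)%g = keeps row g.
Proof.
move=> ks; apply/idP/idP=> [|/(keepsM ks)//] ksg.
by rewrite -(mulKg s g); apply: keepsM; rewrite ?keepsV.
Qed.

Lemma keepsMr row s g : keeps row s -> keeps row (g * s)%g = keeps row g.
Proof. by move=> ks; rewrite -keepsV invMg keepsMl ?keepsV. Qed.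

Lemma mul_delta_sym row s : keeps row s -> δ s * sym_of row = sym_of row.
Proof.
move=> ks; rewrite /sym_of mulr_sumr [RHS](reindex_inj (mulgI s)) /=.
by apply: eq_big => [g|g _]; rewrite ?keepsMl // galg_deltaM.
Qed.

Lemma mul_sym_delta row s : keeps row s -> sym_of row * δ s = sym_of row.
Proof.
move=> ks; rewrite /sym_of mulr_suml [RHS](reindex_inj (mulIg s)) /=.
by apply: eq_big => [g|g _]; rewrite ?keepsMr // galg_deltaM.
Qed.

Lemma mul_delta_alt col s : keeps col s -> δ s * alt_of col = (-1) ^+ s *: alt_of col.
Proof.
move=> ks; rewrite /alt_of mulr_sumr scaler_sumr [RHS](reindex_inj (mulgI s)) /=.
apply: eq_big => [g|g _]; rewrite ?keepsMl // galg_deltaM scalerA odd_permM.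
by rewrite signr_addb mulrA -signr_addb addbb mul1r scalerAr.
Qed.

Lemma mul_alt_delta col s : keeps col s -> alt_of col * δ s = (-1) ^+ s *: alt_of col.
Proof.
move=> ks; rewrite /alt_of mulr_suml scaler_sumr [RHS](reindex_inj (mulIg s)) /=.
apply: eq_big => [g|g _]; rewrite ?keepsMr // galg_deltaM scalerA odd_permM.
by rewrite addbC signr_addb mulrA -signr_addb addbb mul1r scalerAl.
Qed.

Lemma star_delta s : galg_star (δ s) = δ s^-1%g.
Proof.
apply/ffunP=> g; rewrite !ffunE conjC_nat; congr (nat_of_bool _)%:R.
by rewrite -(inj_eq invg_inj) invgK.
Qed.

Lemma galg_starD (x y : A) : galg_star (x + y) = galg_star x + galg_star y.
Proof. by apply/ffunP=> g; rewrite !ffunE rmorphD. Qed.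

Lemma galg_starZ (a : C) (x : A) : galg_star (a *: x) = a^* *: galg_star x.
Proof. by apply/ffunP=> g; rewrite !ffunE rmorphM. Qed.

Lemma galg_star_sum (J : finType) (P : pred J) (F : J -> A) :
  galg_star (\sum_(j | P j) F j) = \sum_(j | P j) galg_star (F j).
Proof. by apply: (big_morph _ galg_starD); apply: galg_star0. Qed.

Lemma star_sym row : galg_star (sym_of row) = sym_of row.
Proof.
rewrite /sym_of galg_star_sum [RHS](reindex_inj invg_inj) /=.
by apply: eq_big => [s|s _]; rewrite ?keepsV ?star_delta.
Qed.

Lemma star_alt col : galg_star (alt_of col) = alt_of col.
Proof.
rewrite /alt_of galg_star_sum [RHS](reindex_inj invg_inj) /=.
apply: eq_big => [s|s _]; rewrite ?keepsV // galg_starZ star_delta odd_permV.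
by rewrite rmorphXn rmorphN1.
Qed.

Lemma sym_idem row : sym_of row * sym_of row = #|[pred s | keeps row s]|%:R *: sym_of row.
Proof.
rewrite {1}/sym_of mulr_suml (eq_bigr (fun=> sym_of row)) => [|s ks].
  by rewrite sumr_const scaler_nat.
exact: mul_delta_sym.
Qed.

Lemma alt_idem col : alt_of col * alt_of col = #|[pred s | keeps col s]|%:R *: alt_of col.
Proof.
rewrite {1}/alt_of mulr_suml (eq_bigr (fun=> alt_of col)) => [|s ks].
  by rewrite sumr_const scaler_nat.
by rewrite -scalerAl mul_delta_alt // scalerA -signr_addb addbb scale1r.
Qed.

Lemma keeps_tperm row i j : row i = row j -> keeps row (tperm i j).
Proof. by move=> E; apply/keepsP=> k; case: tpermP => [->|->|]. Qed.

(** The transposition of i and j is absorbed by the row sum and, moved across g, leaves the column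
    sum with a sign, so the product is its own negative. *)
Lemma sym_alt_vanish row col' g i j : i != j -> row i = row j ->
  col' (g i) = col' (g j) -> sym_of row * δ g * alt_of col' = 0.
Proof.
move=> neq_ij rij cij; set t := tperm i j.
have kt : keeps row t by apply: keeps_tperm.
have kt' : keeps col' (t ^ g)%g by rewrite tpermJ; apply: keeps_tperm.
have E : sym_of row * δ g * alt_of col' = - (sym_of row * δ g * alt_of col').
  rewrite -{1}(mul_sym_delta kt) -[_ * δ t * δ g]mulrA -galg_deltaM.
  have -> : (t * g = g * t ^ g)%g by rewrite conjgE !mulgA mulgV mul1g.
  rewrite galg_deltaM -!mulrA mul_delta_alt // tpermJ odd_tperm.
  by rewrite (inj_eq perm_inj) neq_ij expr1 scaleN1r !mulrN.
have: sym_of row * δ g * alt_of col' *+ 2 = 0 by rewrite mulr2n {1}E addNr.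
by rewrite -scaler_nat => /eqP; rewrite scaler_eq0 pnatr_eq0 => /eqP.
Qed.

Lemma diagram_perm row col g : diagram row col ->
  diagram (fun i => row (g i)) (fun i => col (g i)).
Proof.
move=> [inj down]; split=> [i j r c|i r /down[j [rj cj]]].
  by apply: (@perm_inj _ g); apply: inj.
by exists (g^-1%g j); rewrite permKV.
Qed.

Lemma below_perm row g r : below (fun i => row (g i)) r = below row r.
Proof.
rewrite /below -!sum1_card [RHS](reindex_inj (@perm_inj _ g)) /=.
exact: eq_bigl.
Qed.

Lemma sym_alt_cases row row' col' g :
  sym_of row * δ g * alt_of col' = 0 \/
  (forall i j, row i = row j -> col' (g i) = col' (g j) -> i = j).
Proof.
have [/existsP[i /existsP[j /and3P[ne /eqP r /eqP c]]]|/existsPn no] :=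
  boolP [exists i, exists j, [&& i != j, row i == row j & col' (g i) == col' (g j)]].
  by left; apply: (sym_alt_vanish ne).
right=> i j r c; apply/eqP/negPn/negP=> ne.
by have /existsPn/(_ j) := no i; rewrite ne r c !eqxx.
Qed.

Lemma galg_sandwich (a b x : A) : a * x * b = \sum_g (x g : C) *: (a * δ g * b).
Proof.
rewrite {1}[x]galg_sum mulr_sumr mulr_suml; apply: eq_bigr => g _.
by rewrite -scalerAr -scalerAl.
Qed.

Lemma sym_alt_eq0 row row' col' x r : diagram row' col' ->
  (below row' r < below row r)%N -> sym_of row * x * alt_of col' = 0.
Proof.
move=> D' lt_r; rewrite galg_sandwich big1 // => g _.
have [->|sep] := @sym_alt_cases row row' col' g; first by rewrite scaler0.
have := below_le (diagram_perm g D') sep r.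
by rewrite below_perm leqNgt lt_r.
Qed.

(** The adjoint reverses products and fixes both sums. *)
Lemma alt_sym_eq0 row row' col' x r : diagram row' col' ->
  (below row' r < below row r)%N -> alt_of col' * x * sym_of row = 0.
Proof.
move=> D' lt_r; have := congr1 (@galg_star _ _) (sym_alt_eq0 (galg_star x) D' lt_r).
by rewrite !galg_starM star_sym star_alt galg_starK galg_star0 mulrA.
Qed.

(** Depending on which partial sum is larger, either the outer factors a ... b' or the inner factors
    b ... a' already annihilate everything between them. *)
Lemma young_orthogonal row col row' col' x : diagram row col -> diagram row' col' ->
  (exists r, below row r != below row' r) ->
  young row col * x * young row' col' = 0.
Proof.
move=> D D' [r]; rewrite /young neq_ltn.
have -> : sym_of row * alt_of col * x * (sym_of row' * alt_of col') =
  sym_of row * (alt_of col * x * sym_of row') * alt_of col' by rewrite !mulrA.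
case/orP=> lt_r; last exact: (sym_alt_eq0 _ D' lt_r).
by rewrite (alt_sym_eq0 _ D lt_r) mulr0 mul0r.
Qed.

Section OneDiagram.
Variables (row col : I -> nat).
Hypothesis D : diagram row col.

(** When a g b does not vanish by a transposition, [below_eq_perm] yields h such that h g preserves
    rows and g^-1 h g preserves columns. Then g is the first times the inverse of the second, and a
    g b is a b up to sign. *)
Lemma sym_alt_scalar x : exists k : C, sym_of row * x * alt_of col = k *: young row col.
Proof.
have scal g : exists k : C, sym_of row * δ g * alt_of col = k *: young row col.
  have [->|sep] := @sym_alt_cases row row col g; first by exists 0; rewrite scale0r.
  have [r|h Hh] := below_eq_perm (diagram_perm g D) sep; first by rewrite below_perm.
  pose r := (h * g)%g; pose c := (g^-1 * h * g)%g.
  have kr : keeps row r by apply/keepsP=> i; rewrite permM; case: (Hh i).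
  have kc : keeps col c^-1%g.
    rewrite keepsV; apply/keepsP=> i; rewrite !permM.
    by have [_ ->] := Hh (g^-1%g i); rewrite permKV.
  have -> : g = (r * c^-1)%g by rewrite /r /c !invMg !mulgA invgK mulgK mulgV mul1g.
  exists ((-1) ^+ c^-1%g).
  by rewrite galg_deltaM mulrA mul_sym_delta // -mulrA mul_delta_alt // -scalerAr.
have [k Hk] := choice scal.
exists (\sum_g (x g : C) * k g); rewrite galg_sandwich scaler_suml; apply: eq_bigr => g _.
by rewrite Hk scalerA.
Qed.

Lemma young_scalar x : exists k : C, young row col * x * young row col = k *: young row col.
Proof.
have [k Hk] := sym_alt_scalar (alt_of col * x * sym_of row).
by exists k; rewrite -Hk /young !mulrA.
Qed.

(** Only the identity preserves both rows and columns, so 1 arises from a single product of a row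
    and a column permutation. *)
Lemma young_at1 : young row col 1%g = 1 :> C.
Proof.
rewrite /young galg_mulE (bigD1 1%g) //= [X in _ + X]big1 ?addr0 => [|s s1].
  have sym1 : sym_of row 1%g = 1 :> C.
    rewrite /sym_of sum_ffunE (bigD1 1%g) /=; last by apply/keepsP=> i; rewrite perm1.
    by rewrite ffunE eqxx big1 ?addr0 // => s /andP[_ /negPf s1]; rewrite ffunE eq_sym s1.
  rewrite sym1 mul1r invg1 mul1g /alt_of sum_ffunE (bigD1 1%g) /=.
    rewrite !ffunE eqxx odd_perm1 scale1r big1 ?addr0 // => s /andP[_ /negPf s1].
    by rewrite !ffunE eq_sym s1 scaler0.
  by apply/keepsP=> i; rewrite perm1.
have [kr|nkr] := boolP (keeps row s); last first.
  have -> : sym_of row s = 0; last exact: mul0r.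
  rewrite /sym_of sum_ffunE big1 // => g kg; rewrite ffunE.
  by case: eqP kg => // <-; rewrite (negPf nkr).
have -> : alt_of col (s^-1 * 1)%g = 0; last exact: mulr0.
rewrite /alt_of sum_ffunE big1 // => g kg; rewrite !ffunE mulg1.
case: eqP kg => [<-|]; last by rewrite scaler0.
rewrite keepsV => /keepsP kc; case/eqP: s1.
by apply/permP=> i; rewrite perm1; apply: D.1; rewrite ?kc //; apply/keepsP.
Qed.

Lemma young_neq0 : young row col != 0.
Proof. by apply/eqP=> /ffunP/(_ 1%g)/eqP; rewrite young_at1 ffunE oner_eq0. Qed.

(* If abab = 0 then (aba)(aba)^* = 0, as a and b are self-adjoint and idempotent
   up to scalars; so aba = 0, and then (ab)(ab)^* = 0. *)
Lemma young_sqr : exists2 n : C, n != 0 & young row col * young row col = n *: young row col.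
Proof.
have [n Hn] := young_scalar 1; rewrite mulr1 in Hn; exists n => //.
apply/eqP=> n0; move: Hn; rewrite n0 scale0r => yy0.
set a := sym_of row in yy0 *; set b := alt_of col in yy0 *.
have aba0 : a * b * a = 0.
  apply: galg_Mstar_eq0; rewrite !galg_starM star_sym star_alt.
  have -> : a * b * a * (a * (b * a)) = a * b * (a * a) * b * a by rewrite !mulrA.
  rewrite sym_idem -scalerAr -!scalerAl.
  by move: yy0; rewrite /young -/a -/b mulrA => ->; rewrite mul0r scaler0.
have ab0 : a * b = 0.
  apply: galg_Mstar_eq0; rewrite !galg_starM star_sym star_alt.
  have -> : a * b * (b * a) = a * (b * b) * a by rewrite !mulrA.
  by rewrite alt_idem -scalerAr -!scalerAl -/b aba0 scaler0.
by have /eqP := young_neq0; rewrite /young -/a -/b ab0.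
Qed.

End OneDiagram.
End YoungSymmetrizer.

(** * Cycle types *)

Section CycleType.
Variable T : finType.
Implicit Types s t : {perm T}.

Definition orbit_sizes s := [seq fingraph.order s x | x <- enum (froots s)].

Lemma sumn_orbit_sizes s : sumn (orbit_sizes s) = #|T|.
Proof.
rewrite sumnE big_map big_enum /= -sum1_card.
rewrite [RHS](partition_big (froot s) (froots s)) /=; last first.
  by move=> x _; apply: roots_root; apply/fconnect_sym/perm_inj.
apply: eq_bigr => r /eqP rr; rewrite /fingraph.order -sum1_card; apply: eq_bigl => x.
have syms : connect_sym (frel s) by apply/fconnect_sym/perm_inj.
by rewrite !inE -{2}rr root_connect // syms.
Qed.

(** Orbit roots r of s are matched with roots y r of t of the same order, and s^k r is sent to t^k
    (y r). *)
Lemma same_orbit_sizes_conj s t : perm_eq (orbit_sizes s) (orbit_sizes t) ->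
  exists p : {perm T}, t = (s ^ p)%g.
Proof.
have syms u : connect_sym (frel (u : {perm T})) by apply/fconnect_sym/perm_inj.
case/(perm_iotaP 0%N) => Is permI EI.
pose rs := enum (froots s); pose rt := enum (froots t).
have szI : size Is = size rt by rewrite (perm_size permI) size_iota size_map.
have uI : uniq Is by rewrite (perm_uniq permI) iota_uniq.
have ltI i : i \in Is -> (i < size rt)%N.
  by rewrite (perm_mem permI) mem_iota size_map.
have szs : size rs = size Is.
  by have := congr1 size EI; rewrite !size_map.
pose y r := nth r rt (nth 0%N Is (index r rs)).
have idx r : froots s r -> (index r rs < size Is)%N.
  by move=> rr; rewrite -szs index_mem mem_enum.
have y_root r : froots s r -> froots t (y r).
  move=> rr; have : y r \in rt by apply/mem_nth/ltI/mem_nth/idx.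
  by rewrite mem_enum.
have y_order r : froots s r -> fingraph.order t (y r) = fingraph.order s r.
  move=> rr; have := congr1 (fun l => nth 0%N l (index r rs)) EI.
  rewrite (nth_map r) ?index_mem ?mem_enum // nth_index ?mem_enum // => ->.
  rewrite (nth_map 0%N) ?idx // (nth_map r) //.
  exact/ltI/mem_nth/idx.
have y_inj r r' : froots s r -> froots s r' -> y r = y r' -> r = r'.
  move=> rr rr' /eqP; rewrite /y (set_nth_default r') ?nth_uniq ?enum_uniq //.
  - by move=> /eqP /(index_inj r); apply; rewrite mem_enum.
  - exact: idx.
  - exact: idx.
  - exact/ltI/mem_nth/idx.
  - exact/ltI/mem_nth/idx.
  - exact/ltI/mem_nth/idx.
have root_s x : froots s (froot s x) by apply: roots_root.
pose f x := iter (findex s (froot s x) x) t (y (froot s x)).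
have conn x : fconnect s (froot s x) x by rewrite syms connect_root.
have f_iter r k : froots s r -> (k < fingraph.order s r)%N -> f (iter k s r) = iter k t (y r).
  move=> rr lt_k; rewrite /f.
  have -> : froot s (iter k s r) = r.
    by rewrite -[RHS](eqP rr); apply/esym/eqP; rewrite root_connect // fconnect_iter.
  by rewrite findex_iter.
have fs x : f (s x) = t (f x).
  set r := froot s x; have lt_k := findex_max (conn x).
  have Ex := iter_findex (conn x); move: lt_k Ex; rewrite -/r.
  set k := findex s r x => lt_k Ex.
  have -> : s x = iter k.+1 s r by rewrite iterS Ex.
  rewrite -[f x]/(iter k t (y r)) -iterS.
  (* At the last element of an orbit both sides return to the root, because [y] preserves orders. *)
  have [lt_k1|ge_k1] := ltnP k.+1 (fingraph.order s r); first by rewrite f_iter ?root_s.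
  have Ek : k.+1 = fingraph.order s r by apply/eqP; rewrite eqn_leq lt_k ge_k1.
  rewrite Ek (iter_order (@perm_inj _ s)) -(y_order _ (root_s x)) -/r.
  rewrite (iter_order (@perm_inj _ t)).
  by rewrite (f_iter r 0%N) ?root_s // -Ek.
have f_inj : injective f.
  move=> x x' E.
  have [rx rx'] := (root_s x, root_s x').
  have kx := findex_max (conn x); have kx' := findex_max (conn x').
  have Er : froot s x = froot s x'.
    apply: y_inj => //; rewrite -(eqP (y_root _ rx)) -(eqP (y_root _ rx')).
    have c u : froot t (f u) = froot t (y (froot s u)).
      by apply/eqP; rewrite root_connect // syms fconnect_iter.
    by rewrite -!c E.
  have Ek : findex s (froot s x) x = findex s (froot s x') x'.
    have := congr1 (findex t (y (froot s x))) E.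
    by rewrite /f -Er !findex_iter ?y_order // -?Er // Er.
  by rewrite -(iter_findex (conn x)) -(iter_findex (conn x')) -Ek Er.
exists (perm f_inj); apply/permP=> z; rewrite conjgE !permM.
have [w ->] : exists w, z = perm f_inj w by exists ((perm f_inj)^-1%g z); rewrite permKV.
by rewrite permK !permE fs.
Qed.

End CycleType.

(** * Completeness of the Young symmetrizers *)

Lemma reshape_index_cons n sh i :
  reshape_index (n :: sh) i = if (i < n)%N then 0%N else (reshape_index sh (i - n)).+1.
Proof.
rewrite /reshape_index /=; case: ltnP => [lt_in|le_ni].
  by have /eqP -> : (i.+1 - n == 0)%N by rewrite subn_eq0.
by rewrite subSn //.
Qed.

Lemma reshape_index_lt sh i r : (i < sumn sh)%N ->
  (reshape_index sh i < r)%N = (i < sumn (take r sh))%N.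
Proof.
elim: sh i r => [//|n sh IHsh] i [|r] //= lt_i; rewrite reshape_index_cons.
case: (ltnP i n) => [lt_in|le_ni]; first by rewrite ltn_addr.
rewrite ltnS IHsh; last by rewrite ltn_subLR.
by rewrite ltn_subLR.
Qed.

Section PartitionDiagram.
Variables (N : nat) (lam : seq nat).
Hypothesis plam : is_partition N lam.

Definition rowi (lam : seq nat) (i : 'I_N) := reshape_index lam i.
Definition coli (lam : seq nat) (i : 'I_N) := reshape_offset lam i.

Lemma partition_sumn : sumn lam = N.
Proof. by case/and3P: plam => _ _ /eqP. Qed.

Lemma partition_mono r s : (r <= s)%N -> (nth 0 lam s <= nth 0 lam r)%N.
Proof.
case/and3P: plam => srt _ _ le_rs.
have [lt_s|ge_s] := ltnP s (size lam); last by rewrite (nth_default 0%N ge_s).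
have tr : transitive geq by move=> a b c /= ab bc; apply: leq_trans bc ab.
by apply: (sorted_leq_nth tr leqnn 0%N srt) => //; rewrite inE // (leq_ltn_trans le_rs).
Qed.

Lemma partition_diagram : diagram (rowi lam) (coli lam).
Proof.
have lt_sum (i : 'I_N) : (i < sumn lam)%N by rewrite partition_sumn.
split=> [i j|i r].
  rewrite /rowi /coli => ri ci; apply: val_inj => /=.
  by rewrite -[LHS](reshape_indexK lam) ri ci reshape_indexK.
rewrite /rowi /coli => le_r.
have lt_c : (reshape_offset lam i < nth 0 lam r)%N.
  exact: leq_trans (reshape_offsetP (lt_sum i)) (partition_mono le_r).
have lt_f : (flatten_index lam r (reshape_offset lam i) < N)%N.
  by have := flatten_indexP lt_c; rewrite partition_sumn.
by exists (Ordinal lt_f); rewrite /= flatten_indexKl // flatten_indexKr.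
Qed.

Lemma below_rowi r : below (rowi lam) r = sumn (take r lam).
Proof.
have le_N : (sumn (take r lam) <= N)%N.
  by rewrite -partition_sumn -{2}(cat_take_drop r lam) sumn_cat leq_addr.
rewrite /below -sum1_card.
rewrite (eq_bigl (fun i : 'I_N => (i < sumn (take r lam))%N)) => [|i].
  rewrite -(big_ord_widen_cond _ xpredT (fun=> 1%N) le_N) sum1_card.
  by rewrite cardT size_enum_ord.
by rewrite inE reshape_index_lt ?partition_sumn.
Qed.

End PartitionDiagram.

Lemma nth_inj_nonzero (s t : seq nat) : 0%N \notin s -> 0%N \notin t ->
  (forall r, nth 0 s r = nth 0 t r)%N -> s = t.
Proof.
move=> s0 t0 E.
have sz (u v : seq nat) : (0%N \notin u) -> (forall r, nth 0 u r = nth 0 v r)%N ->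
    (size u <= size v)%N.
  move=> u0 Euv; rewrite leqNgt; apply/negP=> lt_vu.
  have := mem_nth 0%N lt_vu; rewrite Euv nth_default // => mem0.
  by rewrite mem0 in u0.
apply: (@eq_from_nth _ 0%N) => [|r _]; last exact: E.
by apply/eqP; rewrite eqn_leq !sz.
Qed.

Lemma partition_below_neq N lam mu : is_partition N lam -> is_partition N mu ->
  lam != mu -> exists r, below (@rowi N lam) r != below (@rowi N mu) r.
Proof.
move=> pl pm; apply: contra_neqP => no; apply: nth_inj_nonzero.
- by case/and3P: pl.
- by case/and3P: pm.
have E r : sumn (take r lam) = sumn (take r mu).
  rewrite -(below_rowi pl) -(below_rowi pm); apply/eqP/negPn/negP=> ne.
  by apply: no; exists r.
have take_sumn (l : seq nat) r : sumn (take r.+1 l) = (sumn (take r l) + nth 0 l r)%N.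
  by elim: l r => [|x l IHl] [|r] //=; rewrite ?take0 ?addn0 ?add0n // IHl addnA.
move=> r; have := E r.+1; rewrite !take_sumn E.
exact: addnI.
Qed.

Lemma parts_partition N (lam : partition_of N) : is_partition N (parts lam).
Proof. exact: (valP lam). Qed.

Lemma parts_inj N : injective (@parts N).
Proof.
move=> lam mu; rewrite /parts => /(inj_map val_inj) E.
by apply: val_inj; apply: val_inj.
Qed.

Lemma orbit_sizes_partition N (s : 'S_N) : is_partition N (sort geq (orbit_sizes s)).
Proof.
apply/and3P; split.
- by apply: sort_sorted => a b; apply: leq_total.
- rewrite mem_sort; apply/mapP=> -[x _ /esym/eqP].
  by apply/negP; rewrite -lt0n; apply/card_gt0P; exists x; rewrite inE connect0.
by rewrite (perm_sumn (permEl (perm_sort _ _))) sumn_orbit_sizes card_ord.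
Qed.

Definition cycle_type N (s : 'S_N) : partition_of N :=
  projT1 (cid (parts_ex (orbit_sizes_partition s))).

Lemma cycle_type_conj N (s t : 'S_N) : cycle_type s = cycle_type t ->
  exists p : 'S_N, t = (s ^ p)%g.
Proof.
move/(congr1 (@parts N)); rewrite /cycle_type; do 2! case: cid => ? /= ->.
move=> E; apply: same_orbit_sizes_conj.
have tr : transitive geq by move=> a b c /= ab bc; apply: leq_trans bc ab.
have anti : antisymmetric geq by move=> a b; rewrite andbC => /anti_leq.
have tot : total geq by move=> a b; apply: leq_total.
by apply/(perm_sortP tot tr anti).
Qed.

Section Completeness.
Variables (C : numClosedFieldType) (N : nat).
Local Notation A := (galg C 'S_N).
Local Notation "'δ' s" := (@galg_delta C _ s) (at level 9).

Definition youngp (lam : seq nat) : A := young C (@rowi N lam) (@coli N lam).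

Lemma youngp_orthogonal lam mu (x : A) : is_partition N lam -> is_partition N mu ->
  lam != mu -> youngp lam * x * youngp mu = 0.
Proof.
move=> pl pm ne; apply: young_orthogonal; try exact: partition_diagram.
exact: partition_below_neq.
Qed.

Definition central_young lam : A := \sum_(g : 'S_N) δ g * youngp lam * δ g^-1%g.

Lemma central_youngC lam (x : A) : central_young lam * x = x * central_young lam.
Proof.
rewrite [x]galg_sum mulr_sumr mulr_suml; apply: eq_bigr => h _.
rewrite -scalerAr -scalerAl; congr (_ *: _).
rewrite /central_young mulr_sumr mulr_suml [LHS](reindex_inj (mulgI h)) /=.
apply: eq_bigr => g _; rewrite -!mulrA -galg_deltaM invMg mulgKV galg_deltaM.
by rewrite -mulrA.
Qed.

Lemma central_young_at1 lam : is_partition N lam -> central_young lam 1%g = (#|{: 'S_N}|)%:R :> C.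
Proof.
move=> pl; rewrite /central_young sum_ffunE (eq_bigr (fun=> 1)); last first.
  move=> g _; rewrite galg_mulE (bigD1 g) //= mulg1 galg_deltaE eqxx mulr1.
  rewrite big1 ?addr0 => [|h /negPf hg]; last first.
    by rewrite galg_deltaE mulg1 (inj_eq invg_inj) hg mulr0.
  rewrite galg_mulE (bigD1 g) //= galg_deltaE eqxx mul1r mulVg young_at1 ?big1 ?addr0 //.
    by move=> h /negPf hg; rewrite galg_deltaE hg mul0r.
  exact: partition_diagram.
by rewrite sumr_const.
Qed.

(** A central z commutes with its adjoint, so z z = 0 makes the square of the self-adjoint
    [galg_star z * z] vanish; positivity, used twice, then gives z = 0. *)
Lemma central_young_sqr_neq0 lam : is_partition N lam ->
  central_young lam * central_young lam != 0.
Proof.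
move=> pl; set z := central_young lam.
have z0 : z != 0.
  apply/eqP=> /ffunP/(_ 1%g)/eqP; rewrite /z central_young_at1 // ffunE pnatr_eq0.
  by apply/negP; rewrite -lt0n; apply/card_gt0P; exists 1%g.
apply: contra_neq z0 => zz0; apply: galg_starM_eq0; apply: galg_starM_eq0.
rewrite galg_starM galg_starK -mulrA central_youngC.
have -> : galg_star z * (galg_star z * z * z) = galg_star z * galg_star z * (z * z).
  by rewrite !mulrA.
by rewrite zz0 mulr0.
Qed.

Lemma central_young_orthogonal lam mu : is_partition N lam -> is_partition N mu ->
  lam != mu -> central_young lam * central_young mu = 0.
Proof.
move=> pl pm ne; rewrite /central_young mulr_suml big1 // => g _.
rewrite mulr_sumr big1 // => h _.
have -> : δ g * youngp lam * δ g^-1%g * (δ h * youngp mu * δ h^-1%g) =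
  δ g * (youngp lam * (δ g^-1%g * δ h) * youngp mu) * δ h^-1%g by rewrite !mulrA.
by rewrite youngp_orthogonal // mulr0 mul0r.
Qed.

Local Notation CF := {ffun partition_of N -> C^o}.

Definition class_fun (f : CF) : A := [ffun s => f (cycle_type s)].
Definition central_comb (f : CF) : A :=
  \sum_(lam : partition_of N) (f lam : C) *: central_young (parts lam).

Fact class_fun_is_linear : linear class_fun.
Proof. by move=> a f g; apply/ffunP=> s; rewrite !ffunE. Qed.
HB.instance Definition _ :=
  GRing.isLinear.Build C CF A *:%R class_fun class_fun_is_linear.

Fact central_comb_is_linear : linear central_comb.
Proof.
move=> a f g; rewrite /central_comb scaler_sumr -big_split /=.
by apply: eq_bigr => lam _; rewrite !ffunE scalerDl scalerA.
Qed.
HB.instance Definition _ :=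
  GRing.isLinear.Build C CF A *:%R central_comb central_comb_is_linear.

Lemma central_class_fun (x : A) : (forall y, x * y = y * x) -> exists f, x = class_fun f.
Proof.
move=> cx.
have conj (s p : 'S_N) : x (s ^ p)%g = x s.
  have /ffunP/(_ (s * p)%g) := cx (δ p).
  rewrite !galg_mulE (bigD1 s) //= [X in _ + X]big1 => [|h /negPf hs]; last first.
    rewrite ffunE -(inj_eq (mulgI h)) mulKVg (inj_eq (mulIg p)) eq_sym hs mulr0 //.
  rewrite [RHS](bigD1 p) //= [X in _ = _ + X]big1 => [|h /negPf hp]; last first.
    by rewrite ffunE hp mul0r.
  by rewrite !addr0 !ffunE mulKg !eqxx mulr1 mul1r conjgE mulgA => ->.
pose f : CF := [ffun mu => if [pick s | cycle_type s == mu] is Some s then x s else 0].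
exists f; apply/ffunP=> s; rewrite !ffunE; case: pickP => [t /eqP/cycle_type_conj[p ->]|].
  by rewrite conj.
by move/(_ s); rewrite eqxx.
Qed.

(* The central Young elements are independent class functions, and class
   functions factor through the cycle type. *)
Lemma one_central_comb : exists f : CF, 1 = central_comb f.
Proof.
have inj : lker (linfun central_comb) == 0%VS.
  rewrite -subv0; apply/subvP=> f; rewrite memv_ker lfunE /= => /eqP f0.
  rewrite memv0; apply/eqP/ffunP=> lam; rewrite [RHS]ffunE.
  have := congr1 (fun x => x * central_young (parts lam)) f0.
  rewrite /= mul0r mulr_suml (bigD1 lam) //= big1 ?addr0 => [|mu ne]; last first.
    rewrite -scalerAl central_young_orthogonal ?scaler0 //; try exact: parts_partition.
    by rewrite (inj_eq (@parts_inj N)).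
  rewrite -scalerAl => /eqP; rewrite scaler_eq0.
  by rewrite (negPf (central_young_sqr_neq0 (parts_partition lam))) orbF => /eqP.
have sub : (limg (linfun central_comb) <= limg (linfun class_fun))%VS.
  apply/subvP=> _ /memv_imgP[f _ ->]; rewrite lfunE /=.
  have [y|g ->] := @central_class_fun (central_comb f).
    rewrite /central_comb mulr_suml mulr_sumr; apply: eq_bigr => lam _.
    by rewrite -scalerAl -scalerAr central_youngC.
  by apply/memv_imgP; exists g; rewrite ?memvf // lfunE.
have : 1 \in limg (linfun central_comb).
  (* By injectivity the smaller space already has as dimension the number of partitions, which
     bounds the dimension of the larger one. *)
  have -> : limg (linfun central_comb) = limg (linfun class_fun).
    apply/eqP; rewrite eqEdim sub /= [\dim (limg (linfun central_comb))]limg_dim_eq.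
      by rewrite -(limg_ker_dim (linfun class_fun) fullv) leq_addl.
    by rewrite (eqP inj) capv0.
  have [y|g ->] := @central_class_fun 1; first by rewrite mul1r mulr1.
  by apply/memv_imgP; exists g; rewrite ?memvf // lfunE.
by case/memv_imgP => f _ ->; exists f; rewrite lfunE.
Qed.

(** Write h as h * 1 and expand 1 into conjugates of Young symmetrizers. *)
Lemma young_complete (h : A) :
  (forall lam x, is_partition N lam -> h * x * youngp lam = 0) -> h = 0.
Proof.
move=> h0; have [f E] := one_central_comb; rewrite -[h]mulr1 E mulr_sumr big1 // => lam _.
rewrite -scalerAr mulr_sumr big1 ?scaler0 // => g _.
by rewrite mulrA [h * _]mulrA h0 ?mul0r //; apply: parts_partition.
Qed.

End Completeness.

(** * Decomposition of idempotents *)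

Lemma cV_inj_left_inverse (F : fieldType) n m (G : 'M[F]_(n, m)) :
  (forall v : 'cV_m, G *m v = 0 -> v = 0) -> exists M : 'M_(m, n), M *m G = 1%:M.
Proof.
move=> inj; exists (pinvmx G); apply: mulVpmx; rewrite /row_full -mxrank_tr.
apply: (@inj_row_free _ m n G^T) => v v0.
by apply: trmx_inj; rewrite trmx0; apply: inj; apply: trmx_inj; rewrite trmx_mul trmxK v0 trmx0.
Qed.

Section Idempotent.
Variables (C : numClosedFieldType) (N : nat).
Local Notation A := (galg C 'S_N).
Local Notation "'δ' s" := (@galg_delta C _ s) (at level 9).
Local Notation c := (@youngp C N).
Implicit Types (e x : A) (lam : seq nat).

Definition sandwich e lam x : A := e * x * c lam.

Fact sandwich_is_linear e lam : linear (sandwich e lam).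
Proof. by move=> a x y; rewrite /sandwich mulrDr mulrDl -scalerAr -scalerAl. Qed.
HB.instance Definition _ e lam :=
  GRing.isLinear.Build C A A *:%R (sandwich e lam) (@sandwich_is_linear e lam).

(** The dimension of e A c_lam; it becomes the multiplicity of S^lam W in e W^{(x) N}. *)
Definition young_mult e lam := \dim (limg (linfun (sandwich e lam))).

(** Products of c A with e A c are multiples of c, which is the pairing. [y] is a basis of e A c,
    and [y'] comes from a left inverse of the matrix of pairings of the [y] with all c g, so that no
    basis of c A e has to be compared with it. The last clause says that the sum of the y_j y'_j,
    divided by n, acts as the identity on e A c. *)
Lemma young_mult_basis e lam : e * e = e -> is_partition N lam ->
  exists n (y y' : 'I_(young_mult e lam) -> A),
  [/\ [/\ n != 0, c lam * c lam = n *: c lam & forall j, exists x, y j = x * c lam],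
      forall j, exists x, y' j = c lam * x,
      forall j, e * y j = y j /\ y' j * e = y' j,
      forall i j, y' i * y j = (i == j)%:R *: c lam
    & forall x, e * x * c lam = n^-1 *: (\sum_j y j * y' j) * (e * x * c lam)].
Proof.
move=> ee pl; set m := young_mult e lam; set U := limg (linfun (sandwich e lam)).
have D := partition_diagram pl.
have [n n0 cc] : exists2 n : C, n != 0 & c lam * c lam = n *: c lam := young_sqr C D.
pose y (j : 'I_m) : A := (vbasis U)`_j.
have inU u : u \in U -> exists x, u = e * x * c lam.
  by case/memv_imgP=> x _ ->; exists x; rewrite lfunE.
have yU j : y j \in U by apply/vbasis_mem/mem_nth; rewrite size_tuple.
have sc g (j : 'I_m) : exists k : C, c lam * δ g * y j = k *: c lam.
  have [x ->] := inU _ (yU j).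
  have [k Hk] : exists k : C, c lam * (δ g * (e * x)) * c lam = k *: c lam := young_scalar D _.
  by exists k; rewrite -Hk !mulrA.
have [G0 HG0] := choice (fun gj : 'S_N * 'I_m => sc gj.1 gj.2).
pose G : 'M[C]_(#|{: 'S_N}|, m) := \matrix_(i, j) G0 (enum_val i, j).
(* With u c = n u, the hypothesis c A u = 0 gives n u u^* u = u c u^* u = 0. *)
have nondeg u : u \in U -> (forall g, c lam * δ g * u = 0) -> u = 0.
  move=> /inU[x Ex] cu0.
  have uc : u * c lam = n *: u by rewrite Ex -[LHS]mulrA cc -scalerAr.
  have cu z : c lam * z * u = 0.
    by rewrite galg_sandwich big1 // => g _; rewrite cu0 scaler0.
  have uuu : u * galg_star u * u = 0.
    apply: (scalerI n0); rewrite scaler0 !scalerAl -uc.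
    by rewrite -[u * c lam * _]mulrA -mulrA cu mulr0.
  apply: galg_starM_eq0; apply: galg_starM_eq0.
  by rewrite galg_starM galg_starK -mulrA [u * _]mulrA uuu mulr0.
have [M MG] : exists M : 'M_(m, #|{: 'S_N}|), M *m G = 1%:M.
  apply: cV_inj_left_inverse => v Gv.
  pose u := \sum_j v j 0 *: y j.
  have u0 : u = 0.
    apply: nondeg => [|g]; first by apply: memv_suml => j _; apply: memvZ.
    have /matrixP/(_ (enum_rank g) 0) := Gv; rewrite !mxE => Gg.
    rewrite /u mulr_sumr (eq_bigr (fun j => (G (enum_rank g) j * v j 0) *: c lam)) => [|j _].
      by rewrite -scaler_suml Gg scale0r.
    by rewrite -scalerAr (HG0 (g, j)) /= scalerA mulrC mxE enum_rankK.
  have /freeP/(_ (fun j => v j 0)) Hv := basis_free (vbasisP U).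
  by apply/matrixP=> j k; rewrite ord1 mxE; apply: Hv.
(* The factor e on the right leaves the pairings unchanged, since e y_j = y_j. *)
pose y' (i : 'I_m) : A := \sum_k M i k *: (c lam * δ (enum_val k) * e).
have ey j : e * y j = y j.
  by have [x ->] := inU _ (yU j); rewrite -[e * x * _]mulrA mulrA ee.
have y'y i j : y' i * y j = (i == j)%:R *: c lam.
  have /matrixP/(_ i j) := MG; rewrite !mxE => <-.
  rewrite /y' mulr_suml scaler_suml; apply: eq_bigr => k _.
  by rewrite -scalerAl -[_ * e * _]mulrA ey (HG0 (enum_val k, j)) /= mxE scalerA.
exists n, y, y'; split=> //.
- by split=> // j; have [x ->] := inU _ (yU j); exists (e * x).
- move=> j; exists (\sum_k M j k *: (δ (enum_val k) * e)).
  rewrite mulr_sumr; apply: eq_bigr => k _.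
  by rewrite -scalerAr mulrA.
- move=> j; split; first exact: ey.
  rewrite mulr_suml; apply: eq_bigr => k _.
  by rewrite -scalerAl -[_ * e * e]mulrA ee.
move=> x; have xU : e * x * c lam \in U.
  by apply/memv_imgP; exists x; rewrite ?memvf // lfunE.
rewrite {1 2}(coord_vbasis xU) mulr_sumr; apply: eq_bigr => j _.
rewrite -[(vbasis U)`_j]/(y j).
rewrite -scalerAr -scalerAl mulr_suml (bigD1 j) //= big1 ?addr0 => [|i ij].
  rewrite -[y j * _ * _]mulrA y'y eqxx scale1r.
  have [z ->] := inU _ (yU j).
  by rewrite -[_ * c lam * c lam]mulrA cc -scalerAr !scalerA divfK.
by rewrite -[y i * _ * _]mulrA y'y (negPf ij) scale0r mulr0.
Qed.

(** Both sides act alike on every e x c_lam, so their difference is killed by completeness. *)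
Lemma idempotent_decomposition e : e * e = e ->
  exists (n : seq nat -> C) (y y' : forall lam, 'I_(young_mult e lam) -> A),
  (forall lam, is_partition N lam ->
   [/\ [/\ n lam != 0, c lam * c lam = n lam *: c lam & forall j, exists x, y lam j = x * c lam],
       forall j, exists x, y' lam j = c lam * x,
       forall j, e * y lam j = y lam j /\ y' lam j * e = y' lam j
     & forall i j, y' lam i * y lam j = (i == j)%:R *: c lam]) /\
  e = \sum_(lam : partition_of N) (n (parts lam))^-1 *:
        \sum_j y (parts lam) j * y' (parts lam) j.
Proof.
move=> ee.
have ex lam : exists t : C * (('I_(young_mult e lam) -> A) * ('I_(young_mult e lam) -> A)),
    is_partition N lam ->
  [/\ [/\ t.1 != 0, c lam * c lam = t.1 *: c lam & forall j, exists x, t.2.1 j = x * c lam],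
      forall j, exists x, t.2.2 j = c lam * x,
      forall j, e * t.2.1 j = t.2.1 j /\ t.2.2 j * e = t.2.2 j,
      forall i j, t.2.2 i * t.2.1 j = (i == j)%:R *: c lam
    & forall x, e * x * c lam = t.1^-1 *: (\sum_j t.2.1 j * t.2.2 j) * (e * x * c lam)].
  have [pl|npl] := boolP (is_partition N lam); last by exists (0, (fun=> 0, fun=> 0)).
  by have [n [y [y' H]]] := young_mult_basis ee pl; exists (n, (y, y')).
pose t lam := projT1 (cid (ex lam)); have tP lam := projT2 (cid (ex lam)).
exists (fun lam => (t lam).1), (fun lam => (t lam).2.1), (fun lam => (t lam).2.2).
split=> [lam pl|]; first by have [] := tP lam pl.
apply/eqP; rewrite -subr_eq0; apply/eqP.
set f := \sum_lam _.
(* This lets f x c be replaced by f (e x c), where the reproducing formula applies. *)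
have fe : f * e = f.
  rewrite /f mulr_suml; apply: eq_bigr => lam _; rewrite -scalerAl mulr_suml.
  congr (_ *: _); apply: eq_bigr => j _.
  by rewrite -mulrA; have [_ _ /(_ j)[_ ->]] := tP _ (parts_partition lam).
apply: young_complete => _ x /parts_ex[lam <-].
have [_ _ _ _ /(_ x)] := tP _ (parts_partition lam).
have -> : (e - f) * x * c (parts lam) = e * x * c (parts lam) - f * (e * x * c (parts lam)).
  by rewrite !mulrBl !mulrA fe.
set w := e * x * _ => E; apply/eqP; rewrite subr_eq0; apply/eqP.
rewrite {1}E /f mulr_suml [RHS](bigD1 lam) //= [X in _ = _ + X]big1 ?addr0 // => mu ne.
rewrite -scalerAl mulr_suml big1 ?scaler0 // => j _.
have [_ /(_ j)[z ->] _ _ _] := tP _ (parts_partition mu).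
have -> : (t (parts mu)).2.1 j * (c (parts mu) * z) * w =
  (t (parts mu)).2.1 j * (c (parts mu) * (z * (e * x)) * c (parts lam)).
  by rewrite /w !mulrA.
rewrite youngp_orthogonal ?mulr0 //; try exact: parts_partition.
by rewrite (inj_eq (@parts_inj N)).
Qed.

End Idempotent.

(** * Tensor powers and plethysms *)

Section TensorAction.
Variables (C : numClosedFieldType) (N : nat).
Local Notation A := (galg C 'S_N).
Local Notation "'δ' s" := (@galg_delta C _ s) (at level 9).
Implicit Types (U V : vectType C) (x y : A) (s t : 'S_N).

Lemma tens_permE V s (v : tens N V) u : tens_perm V s v u = v [ffun i => u (s i)].
Proof. by rewrite lfunE /= ffunE. Qed.

Lemma tens_permM V s t : tens_perm V (s * t)%g = (tens_perm V t \o tens_perm V s)%VF.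
Proof.
apply/lfunP=> v; rewrite comp_lfunE; apply/ffunP=> u; rewrite !tens_permE.
by congr (v _); apply/ffunP=> i; rewrite !ffunE permM.
Qed.

Lemma tens_perm1 V : tens_perm V (1%g : 'S_N) = \1%VF.
Proof.
apply/lfunP=> v; rewrite id_lfunE; apply/ffunP=> u; rewrite tens_permE.
by congr (v _); apply/ffunP=> i; rewrite ffunE perm1.
Qed.

(* The inverse makes the right action by [tens_perm] a left action. *)
Definition tact V x : 'End(tens N V) := \sum_s (x s : C) *: tens_perm V s^-1%g.

Fact tact_is_linear V : linear (tact V).
Proof.
move=> a x y; rewrite /tact scaler_sumr -big_split /=; apply: eq_bigr => s _.
by rewrite !ffunE scalerDl scalerA.
Qed.
HB.instance Definition _ V :=
  GRing.isLinear.Build C A 'End(tens N V) *:%R (tact V) (@tact_is_linear V).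

Lemma tact_delta V s : tact V (δ s) = tens_perm V s^-1%g.
Proof.
rewrite /tact (bigD1 s) //= galg_deltaE eqxx scale1r big1 ?addr0 // => t /negPf ts.
by rewrite galg_deltaE ts scale0r.
Qed.

Lemma tactM V x y : tact V (x * y) = (tact V x \o tact V y)%VF.
Proof.
apply/lfunP=> v; rewrite comp_lfunE [x]galg_sum [y]galg_sum mulr_suml.
rewrite !linear_sum !sum_lfunE; apply: eq_bigr => s _.
rewrite mulr_sumr !linear_sum !sum_lfunE; apply: eq_bigr => t _.
rewrite -scalerAl -scalerAr !linearZ /= !scale_lfunE !linearZ /=.
by rewrite -galg_deltaM !tact_delta invMg tens_permM comp_lfunE.
Qed.

Lemma tact_natural U V (f : 'Hom(U, V)) x :
  (tens_map N f \o tact U x = tact V x \o tens_map N f)%VF.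
Proof.
apply/lfunP=> v; rewrite !comp_lfunE /tact !sum_lfunE linear_sum /=.
apply: eq_bigr => s _; rewrite !scale_lfunE linearZ /=.
by rewrite -!comp_lfunE tens_map_perm.
Qed.

End TensorAction.

(** Rows and columns are preserved by s and by its inverse alike, and the signs agree, so the
    inverse in [tact] merely reindexes both sums. *)
Lemma tact_young (C : numClosedFieldType) (lam : seq nat) (V : vectType C) :
  tact V (@youngp C (sumn lam) lam) = (row_sym lam V \o col_alt lam V)%VF.
Proof.
rewrite /youngp /young tactM; congr (_ \o _)%VF.
  rewrite /sym_of /row_sym linear_sum [RHS](reindex_inj invg_inj) /=.
  by apply: eq_big => [s|s _]; rewrite ?tact_delta // -keepsV.
rewrite /alt_of /col_alt linear_sum [RHS](reindex_inj invg_inj) /=.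
apply: eq_big => [s|s _]; first by rewrite -keepsV.
by rewrite linearZ /= tact_delta odd_permV.
Qed.

(* [tens (sumn lam) W] and [tens N W] are different types when [sumn lam = N]
   holds only propositionally. *)
Lemma schur_embedding (C : numClosedFieldType) N lam (W : vectType C) : sumn lam = N ->
  exists k : 'Hom(Defs.Schur lam W, tens N W),
  [/\ lker k = 0%VS, limg k = limg (tact W (@youngp C N lam))
    & forall g : 'End(W), (k \o schur_map lam g = tens_map N g \o k)%VF].
Proof.
case: N /.
exists (linfun vsval); split.
- apply/eqP; rewrite -subv0; apply/subvP=> x; rewrite memv_ker lfunE /= => /eqP x0.
  by rewrite memv0; apply/eqP/val_inj.
- rewrite tact_young -/(schurtens lam W); apply/vspaceP=> x; apply/memv_imgP/idP.
    by case=> y _ ->; rewrite lfunE; apply: subvsP.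
  by move=> xS; exists (Subvs xS); rewrite ?memvf // lfunE.
move=> g; apply/lfunP=> x.
have gx : tens_map (sumn lam) g (vsval x) \in schurtens lam W.
  by have /subvP := schur_map_stable lam g; apply; apply: memv_img; apply: subvsP.
by move: gx; rewrite !comp_lfunE !lfunE /= => /vsprojK.
Qed.

(** * The wreath product of S_k and S_d acting on d blocks of k positions *)

Section Blocks.
Variables d k : nat.

Definition unidx (i : 'I_(d * k)) : 'I_d * 'I_k :=
  enum_val (cast_ord (esym (mxvec_cast d k)) i).

Lemma unidxK l j : unidx (mxvec_index l j) = (l, j).
Proof. by rewrite /unidx /mxvec_index cast_ordK enum_rankK. Qed.

Lemma mxvec_unidx i : mxvec_index (unidx i).1 (unidx i).2 = i.
Proof. by case: i / mxvec_indexP => l j; rewrite unidxK. Qed.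

Lemma mxvec_index_inj l j l' j' :
  mxvec_index l j = mxvec_index l' j' :> 'I_(d * k) -> l = l' /\ j = j'.
Proof. by move/(congr1 unidx); rewrite !unidxK => -[]. Qed.

Definition wreath_fun (s : 'S_d) (t : {ffun 'I_d -> 'S_k}) (i : 'I_(d * k)) :=
  mxvec_index (s (unidx i).1) (t (unidx i).1 (unidx i).2).

Fact wreath_fun_inj s t : injective (wreath_fun s t).
Proof.
move=> i i' /mxvec_index_inj[/perm_inj E1]; rewrite E1 => /perm_inj E2.
by rewrite -(mxvec_unidx i) E1 E2 mxvec_unidx.
Qed.

Definition wreath s t : 'S_(d * k) := perm (@wreath_fun_inj s t).

Lemma wreathE s t l j : wreath s t (mxvec_index l j) = mxvec_index (s l) (t l j).
Proof. by rewrite permE /wreath_fun unidxK. Qed.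

Lemma wreathM s t s' t' :
  (wreath s t * wreath s' t')%g = wreath (s * s') [ffun l => (t l * t' (s l))%g].
Proof.
by apply/permP=> i; case: i / mxvec_indexP => l j; rewrite permM !wreathE ffunE !permM.
Qed.

Variable C : numClosedFieldType.
Local Notation "'δ' s" := (@galg_delta C _ s) (at level 9).

(** The sum runs over pairs, not over permutations: for k = 0 distinct pairs give the same
    permutation. *)
Definition wreath_sum : galg C 'S_(d * k) :=
  \sum_(p : 'S_d * {ffun 'I_d -> 'S_k}) δ (wreath p.1 p.2).

Definition wreath_avg : galg C 'S_(d * k) :=
  (#|{: 'S_d * {ffun 'I_d -> 'S_k}}|%:R)^-1 *: wreath_sum.

Lemma wreath_card_neq0 : #|{: 'S_d * {ffun 'I_d -> 'S_k}}|%:R != 0 :> C.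
Proof.
rewrite pnatr_eq0 -lt0n; apply/card_gt0P.
by exists (1%g, [ffun=> 1%g]).
Qed.

Lemma wreath_delta_sum s t : δ (wreath s t) * wreath_sum = wreath_sum.
Proof.
pose h (p : 'S_d * {ffun 'I_d -> 'S_k}) := ((s * p.1)%g, [ffun l => (t l * p.2 (s l))%g]).
have injh : injective h.
  move=> [s1 t1] [s2 t2] [/mulgI <- /ffunP E]; congr (_, _); apply/ffunP=> l.
  by have := E (s^-1%g l); rewrite !ffunE permKV => /mulgI.
rewrite /wreath_sum mulr_sumr [RHS](reindex_inj injh) /=; apply: eq_bigr => p _.
by rewrite -galg_deltaM wreathM.
Qed.

Lemma wreath_delta_avg s t : δ (wreath s t) * wreath_avg = wreath_avg.
Proof. by rewrite /wreath_avg -scalerAr wreath_delta_sum. Qed.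

Lemma wreath_avg_idem : wreath_avg * wreath_avg = wreath_avg.
Proof.
rewrite {1}/wreath_avg -scalerAl {1}/wreath_sum mulr_suml.
rewrite (eq_bigr (fun=> wreath_avg)) => [|p _]; last exact: wreath_delta_avg.
by rewrite sumr_const -scaler_nat scalerA mulVf ?scale1r ?wreath_card_neq0.
Qed.

Variable W : vectType C.

Lemma wreath_avgP (y : tens (d * k) W) :
  reflect (forall s t, tens_perm W (wreath s t) y = y) (y \in limg (tact W wreath_avg)).
Proof.
apply: (iffP memv_imgP) => [[z _ ->] s t|inv].
  rewrite -[in LHS](wreath_delta_avg s t) tactM tact_delta comp_lfunE -comp_lfunE -tens_permM.
  by rewrite mulVg tens_perm1 id_lfunE.
exists y; rewrite ?memvf // /wreath_avg /wreath_sum linearZ linear_sum /=.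
rewrite scale_lfunE sum_lfunE (eq_bigr (fun=> y)) => [|p _].
  by rewrite sumr_const -scaler_nat scalerA mulVf ?scale1r ?wreath_card_neq0.
rewrite tact_delta -[in LHS](inv p.1 p.2) -comp_lfunE -tens_permM.
by rewrite mulgV tens_perm1 id_lfunE.
Qed.

End Blocks.

Section Words.
Variables (d k n : nat).
Local Notation word m := {ffun 'I_m -> 'I_n}.

Definition blk (w : word (d * k)) : {ffun 'I_d -> word k} :=
  [ffun l => [ffun j => w (mxvec_index l j)]].
Definition join (z : {ffun 'I_d -> word k}) : word (d * k) :=
  [ffun i => z (unidx i).1 (unidx i).2].

Lemma joinK : cancel join blk.
Proof.
by move=> z; apply/ffunP=> l; apply/ffunP=> j; rewrite !ffunE unidxK.
Qed.

Lemma blkK : cancel blk join.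
Proof. by move=> w; apply/ffunP=> i; rewrite !ffunE mxvec_unidx. Qed.

Lemma sum_words (R : nmodType) (F : word (d * k) -> R) :
  \sum_w F w = \sum_z F (join z).
Proof. by rewrite (reindex join) //; exists blk => w _; rewrite ?joinK ?blkK. Qed.

Lemma prod_mxvec (R : comPzSemiRingType) (F : 'I_(d * k) -> R) :
  \prod_i F i = \prod_l \prod_j F (mxvec_index l j).
Proof.
rewrite pair_bigA /= (reindex (uncurry (@mxvec_index d k))) /=; last exact: curry_mxvec_bij.
by apply: eq_bigr => -[].
Qed.

End Words.

Section SymmetricTensors.
Variables (C : numClosedFieldType) (d : nat) (V : vectType C).

Lemma symtensP (x : tens d V) :
  reflect (forall s, tens_perm V s x = x) (x \in symtens d V).
Proof.
rewrite memvE; apply: (iffP subv_bigcapP) => [H s|H s _].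
  by apply/fixedSpaceP; rewrite memvE; apply: H.
by rewrite -memvE; apply/fixedSpaceP.
Qed.

Definition tens_avg : 'End(tens d V) := (d`!%:R)^-1 *: \sum_(s : 'S_d) tens_perm V s.

Lemma tens_avg_sym x : tens_avg x \in symtens d V.
Proof.
apply/symtensP=> t; rewrite /tens_avg !scale_lfunE linearZ /=; congr (_ *: _).
rewrite !sum_lfunE linear_sum [RHS](reindex_inj (mulIg t)) /=.
by apply: eq_bigr => s _; rewrite tens_permM comp_lfunE.
Qed.

Lemma tens_avg_id x : x \in symtens d V -> tens_avg x = x.
Proof.
move/symtensP=> xS; rewrite /tens_avg scale_lfunE sum_lfunE (eq_bigr (fun=> x)) => [|s _].
  rewrite sumr_const -scaler_nat scalerA card_Sn mulVf ?scale1r //.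
  by rewrite pnatr_eq0 -lt0n fact_gt0.
exact: xS.
Qed.

Definition tens_delta (u : {ffun 'I_d -> 'I_(\dim {:V})}) : tens d V :=
  [ffun v => (v == u)%:R].

Lemma tens_sum (x : tens d V) : x = \sum_u (x u : C) *: tens_delta u.
Proof.
apply/ffunP=> v; rewrite sum_ffunE (bigD1 v) //= big1 ?addr0.
  by rewrite !ffunE eqxx /GRing.scale /= mulr1.
by move=> u /negPf uv; rewrite !ffunE eq_sym uv scaler0.
Qed.

Lemma sym_mapE (U : vectType C) (f : 'Hom(V, U)) (x : Defs.Sym d V) :
  vsval (sym_map d f x) = tens_map d f (vsval x).
Proof.
have fx : tens_map d f (vsval x) \in symtens d U.
  by have /subvP := sym_map_stable d f; apply; apply: memv_img; apply: subvsP.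
by move: fx; rewrite /sym_map /restr !comp_lfunE !lfunE /= => /vsprojK.
Qed.

End SymmetricTensors.

(** * Embedding of S^d(S^k W) into the tensor power of W of degree dk *)

Section Multiplication.
Variables (C : numClosedFieldType) (d k : nat) (W : vectType C).
Local Notation S := (Defs.Sym k W).
Local Notation B := (vbasis {:S}).
Local Notation n := (\dim {:W}).
Local Notation word m := {ffun 'I_m -> 'I_n}.

(* The matrix of the inclusion of S^k W in W^{(x) k}. *)
Definition incl (a : 'I_(\dim {:S})) (v : word k) : C := vsval B`_a v.
(** The matrix of the symmetrization of W^{(x) k} onto S^k W, a retraction of the inclusion. *)
Definition proj (v : word k) (a : 'I_(\dim {:S})) : C :=
  coord B a (vsproj (symtens k W) (tens_avg k W (tens_delta v))).

Lemma sum_coord_incl (x : S) v : \sum_a coord B a x * incl a v = vsval x v.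
Proof.
rewrite [in RHS](coord_vbasis (memvf x)) linear_sum /= sum_ffunE.
by apply: eq_bigr => a _; rewrite ffunE.
Qed.

Lemma incl_proj a b : \sum_v incl a v * proj v b = (a == b)%:R.
Proof.
have aS : vsval (B`_a) \in symtens k W by apply: subvsP.
have : vsproj (symtens k W) (tens_avg k W (vsval B`_a)) = B`_a.
  by rewrite tens_avg_id // vsvalK.
rewrite {1}[vsval _]tens_sum !linear_sum /= => /(congr1 (coord B b)).
rewrite linear_sum /= coord_free ?(basis_free (vbasisP _)) // => <-.
by apply: eq_bigr => v _; rewrite !linearZ.
Qed.

Lemma proj_incl (v v' : word k) :
  \sum_a proj v a * incl a v' = (k`!%:R)^-1 * \sum_(s : 'S_k) ([ffun j => v' (s j)] == v)%:R.
Proof.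
rewrite /proj sum_coord_incl vsprojK ?tens_avg_sym // /tens_avg scale_lfunE sum_lfunE.
rewrite ffunE sum_ffunE; congr (_ * _); apply: eq_bigr => s _.
by rewrite tens_permE ffunE.
Qed.

Lemma incl_perm a (v : word k) (s : 'S_k) : incl a [ffun j => v (s j)] = incl a v.
Proof.
have /symtensP/(_ s)/ffunP/(_ v) : vsval (B`_a) \in symtens k W by apply: subvsP.
by rewrite tens_permE.
Qed.

(** The d-th tensor power of [incl], one factor per block; [unmult] is the same power of [proj]. *)
Definition mult_fun (x : tens d S) : tens (d * k) W :=
  [ffun w => \sum_u (x u : C) * \prod_l incl (u l) (blk w l)].

Fact mult_is_linear : linear mult_fun.
Proof.
move=> a x y; apply/ffunP=> w; rewrite !ffunE /GRing.scale /= mulr_sumr -big_split /=.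
by apply: eq_bigr => u _; rewrite !ffunE mulrDl mulrA.
Qed.
HB.instance Definition _ :=
  GRing.isLinear.Build C (tens d S) (tens (d * k) W) *:%R mult_fun mult_is_linear.

Definition unmult (y : tens (d * k) W) : tens d S :=
  [ffun u : {ffun 'I_d -> 'I_(\dim {:S})} =>
     \sum_w (y w : C) * \prod_l proj (blk w l) (u l)].

Lemma mult_funK : cancel mult_fun unmult.
Proof.
move=> x; apply/ffunP=> u; rewrite ffunE.
under eq_bigr => w _ do rewrite ffunE mulr_suml.
rewrite exchange_big /= (bigD1 u) //= [X in _ + X]big1 => [|u' neq].
  rewrite addr0; under eq_bigr => w _ do rewrite -mulrA -big_split /=.
  rewrite -mulr_sumr sum_words.
  under eq_bigr => z _ do rewrite joinK.
  rewrite -(bigA_distr_bigA (fun l v => incl (u l) v * proj v (u l))) /=.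
  by rewrite big1 ?mulr1 // => l _; rewrite incl_proj eqxx.
have [l neq_l] : exists l, u' l != u l.
  apply/existsP; apply: contraR neq => /existsPn eq_uv.
  by apply/eqP/ffunP=> l; apply/eqP; move: (eq_uv l); rewrite negbK.
under eq_bigr => w _ do rewrite -mulrA -big_split /=.
rewrite -mulr_sumr sum_words.
under eq_bigr => z _ do rewrite joinK.
rewrite -(bigA_distr_bigA (fun l v => incl (u' l) v * proj v (u l))) /=.
by rewrite (bigD1 l) //= incl_proj (negPf neq_l) mul0r mulr0.
Qed.

Lemma mult_perm s t x :
  tens_perm W (wreath s t) (mult_fun x) = mult_fun (tens_perm S s x).
Proof.
apply/ffunP=> w; rewrite tens_permE !ffunE.
pose h (u : {ffun 'I_d -> 'I_(\dim {:S})}) := [ffun i => u (s i)].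
have hinj : injective h.
  move=> u u' /ffunP E; apply/ffunP=> i; have := E (s^-1%g i).
  by rewrite !ffunE permKV.
rewrite [LHS](reindex_inj hinj) /=; apply: eq_bigr => u _.
rewrite tens_permE; congr (_ * _).
rewrite [RHS](reindex_inj (@perm_inj _ s)) /=; apply: eq_bigr => l _.
rewrite /h ffunE -[in RHS](incl_perm _ _ (t l)); congr (incl _ _).
by apply/ffunP=> j; rewrite !ffunE wreathE.
Qed.

(** The composite averages over the permutations inside each block, which fixes y. *)
Lemma mult_unmult y : (forall t, tens_perm W (wreath 1 t) y = y) ->
  mult_fun (unmult y) = y.
Proof.
move=> inv; apply/ffunP=> w; rewrite ffunE.
under eq_bigr => u _ do rewrite ffunE mulr_suml.
rewrite exchange_big /=.
pose f (z : {ffun 'I_d -> word k}) := \prod_l \sum_a proj (z l) a * incl a (blk w l).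
rewrite (eq_bigr (fun w' => y w' * f (blk w'))) => [|w' _]; last first.
  rewrite /f bigA_distr_bigA mulr_sumr; apply: eq_bigr => u _.
  by rewrite -mulrA big_split.
rewrite sum_words.
(* Each of the d blocks contributes the factor 1 / k! of its own average. *)
pose c : C := ((k`!%:R)^-1) ^+ d.
have fE z : f z = c * \sum_(t : {ffun 'I_d -> 'S_k})
    (z == [ffun l => [ffun j => blk w l (t l j)]])%:R.
  rewrite /f; under eq_bigr => l _ do rewrite proj_incl.
  rewrite big_split /= prodr_const card_ord; congr (_ * _).
  rewrite bigA_distr_bigA; apply: eq_bigr => t _.
  have [->|neq] := eqVneq z.
    by rewrite big1 // => l _; rewrite [X in _ == X]ffunE eqxx.
  have [l neq_l] : exists l, [ffun j => blk w l (t l j)] != z l.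
    apply/existsP; apply: contraR neq => /existsPn E; apply/eqP/ffunP=> l.
    by rewrite [RHS]ffunE; apply/esym/eqP; move: (E l); rewrite negbK.
  by rewrite (bigD1 l) //= (negPf neq_l) mul0r.
under eq_bigr => z _ do rewrite joinK fE mulrCA mulr_sumr.
rewrite -mulr_sumr exchange_big /=.
rewrite (eq_bigr (fun=> y w)) => [|t _].
  rewrite sumr_const card_ffun card_Sn card_ord -[_ *+ _]mulr_natl mulrA natrX.
  rewrite /c -exprMn mulVf ?expr1n ?mul1r //.
  by rewrite pnatr_eq0 -lt0n fact_gt0.
rewrite (bigD1 [ffun l => [ffun j => blk w l (t l j)]]) //= eqxx mulr1.
rewrite big1 ?addr0 => [|z /negPf ->]; last by rewrite mulr0.
rewrite -{2}(inv t) tens_permE; congr (y _); apply/ffunP=> i.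
by case: i / mxvec_indexP => l j; rewrite !ffunE unidxK /= ?ffunE wreathE perm1.
Qed.

Lemma mult_natural (g : 'End(W)) x :
  mult_fun (tens_map d (sym_map k g) x) = tens_map (d * k) g (mult_fun x).
Proof.
apply/ffunP=> w; rewrite !lfunE /= !ffunE.
under eq_bigr => v _ do rewrite ffunE mulr_suml.
rewrite exchange_big /=.
under [RHS]eq_bigr => w' _ do rewrite ffunE mulr_suml.
rewrite [RHS]exchange_big /=; apply: eq_bigr => u _.
under eq_bigr => v _ do rewrite -mulrA -big_split /=.
under [RHS]eq_bigr => w' _ do rewrite -mulrA.
rewrite -!mulr_sumr; congr (_ * _).
rewrite -(bigA_distr_bigA (fun l a => coord B a (sym_map k g B`_(u l)) * incl a (blk w l))) /=.
rewrite sum_words.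
pose K (v v' : word k) := \prod_j coord (vbasis {:W}) (v' j) (g (vbasis {:W})`_(v j)).
rewrite [RHS](eq_bigr (fun z : {ffun 'I_d -> word k} =>
   \prod_l (incl (u l) (z l) * K (z l) (blk w l)))) => [|z _].
  rewrite -(bigA_distr_bigA (fun l v => incl (u l) v * K v (blk w l))) /=.
  apply: eq_bigr => l _; rewrite sum_coord_incl sym_mapE lfunE /= ffunE.
  by apply: eq_bigr.
rewrite joinK big_split /=; congr (_ * _); rewrite prod_mxvec.
apply: eq_bigr => l _; apply: eq_bigr => j _; rewrite !ffunE unidxK //.
Qed.

(** Invariance inside the blocks puts a tensor into the d-th tensor power of S^k W, and invariance
    under permuting the blocks makes it symmetric there. *)
Lemma plethysm_embedding :
  exists iota : 'Hom(Defs.Sym d S, tens (d * k) W),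
  [/\ lker iota = 0%VS, limg iota = limg (tact W (wreath_avg d k C))
    & forall g : 'End(W),
      (iota \o sym_map d (sym_map k g) = tens_map (d * k) g \o iota)%VF].
Proof.
exists (linfun mult_fun \o linfun vsval)%VF.
have iE x : (linfun mult_fun \o linfun vsval)%VF x = mult_fun (vsval x).
  by rewrite comp_lfunE !lfunE.
split.
- apply/eqP; rewrite -subv0; apply/subvP=> x; rewrite memv_ker iE.
  move/eqP=> x0; rewrite memv0; apply/eqP/val_inj.
  by apply: (can_inj mult_funK); rewrite x0 linear0.
- apply/vspaceP=> y; apply/memv_imgP/wreath_avgP => [[x _ ->] s t|inv].
    rewrite iE mult_perm; congr (mult_fun _).
    by have /symtensP := subvsP x; apply.
  have yE : mult_fun (unmult y) = y by apply: mult_unmult.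
  have xS : unmult y \in symtens d S.
    apply/symtensP=> s; apply: (can_inj mult_funK).
    by rewrite -(mult_perm s [ffun=> 1%g]) yE inv.
  by exists (Subvs xS); rewrite ?memvf // iE /= yE.
by move=> g; apply/lfunP=> x; rewrite comp_lfunE iE sym_mapE mult_natural comp_lfunE iE.
Qed.

End Multiplication.

(** * Existence of plethysm decompositions *)

Section Existence.
Variables (C : numClosedFieldType) (W : vectType C) (d k : nat).
Local Notation N := (d * k)%N.
Local Notation A := (galg C 'S_N).
Local Notation c := (@youngp C N).
Local Notation X := (Defs.Sym d (Defs.Sym k W)).
Local Notation T := (tens N W).

Lemma plethysm_decomposition_exists : exists m, plethysm_decomposition W d k m.
Proof.
have [iota [ker_iota im_iota nat_iota]] := plethysm_embedding d k W.
set e := wreath_avg d k C in im_iota.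
have ee : e * e = e := wreath_avg_idem d k C.
have [n [y [y' [Hy eE]]]] := idempotent_decomposition ee.
have kap_ex (lam : partition_of N) := schur_embedding W (partition_sumn (parts_partition lam)).
pose kap lam := projT1 (cid (kap_ex lam)).
have kapP lam : [/\ lker (kap lam) = 0%VS, limg (kap lam) = limg (tact W (c (parts lam)))
    & forall g : 'End(W), (kap lam \o schur_map (parts lam) g = tens_map N g \o kap lam)%VF].
  exact: projT2 (cid (kap_ex lam)).
have iota_inj : injective iota by apply/lker0P/eqP.
have kap_inj lam : injective (kap lam) by apply/lker0P/eqP; case: (kapP lam).
exists (young_mult e).
(* As y_j = e y_j, its values lie in the image of [iota], where the partial inverse is exact. *)
pose f (lam : partition_of N) (j : 'I_(young_mult e (parts lam))) :
    'Hom(Defs.Schur (parts lam) W, X) :=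
  (iota^-1 \o (tact W (y (parts lam) j) \o kap lam))%VF.
have eP x : x \in limg (tact W e) -> tact W e x = x.
  by case/memv_imgP=> z _ ->; rewrite -comp_lfunE -tactM ee.
have iota_f lam j x : iota (f lam j x) = tact W (y (parts lam) j) (kap lam x).
  rewrite /f !comp_lfunE limg_lfunVK // im_iota.
  have [_ _ /(_ j)[<- _] _] := Hy _ (parts_partition lam).
  by rewrite tactM comp_lfunE memv_img ?memvf.
clearbody f.
have y'_f lam i j x : tact W (y' (parts lam) i) (iota (f lam j x)) =
    ((i == j)%:R * n (parts lam)) *: kap lam x.
  rewrite iota_f -comp_lfunE -tactM.
  have [[_ cc _] _ _ ->] := Hy _ (parts_partition lam).
  have : kap lam x \in limg (kap lam) by rewrite memv_img ?memvf.
  have [_ -> _] := kapP lam; case/memv_imgP=> z _ ->.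
  by rewrite -comp_lfunE -tactM -scalerAl cc scalerA linearZ scale_lfunE.
have y'_f0 lam mu i j x : lam != mu ->
    tact W (y' (parts lam) i) (iota (f mu j x)) = 0.
  move=> ne; rewrite iota_f -comp_lfunE -tactM.
  have [_ /(_ i)[z ->] _ _] := Hy _ (parts_partition lam).
  have [[_ _ /(_ j)[z' ->]] _ _ _] := Hy _ (parts_partition mu).
  have -> : c (parts lam) * z * (z' * c (parts mu)) = c (parts lam) * (z * z') * c (parts mu).
    by rewrite !mulrA.
  rewrite youngp_orthogonal; try exact: parts_partition.
    by rewrite linear0 zero_lfunE.
  by rewrite (inj_eq (@parts_inj N)).
have n_neq0 (lam : partition_of N) : n (parts lam) != 0.
  by have [[]] := Hy _ (parts_partition lam).
exists f; split.
- move=> lam j; apply/eqP; rewrite -subv0; apply/subvP=> x; rewrite memv_ker => /eqP fx.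
  have := y'_f lam j j x; rewrite fx !linear0 eqxx mul1r => /esym/eqP.
  rewrite scaler_eq0 (negPf (n_neq0 _)) /= => /eqP x0.
  by rewrite memv0; apply/eqP/(kap_inj lam); rewrite x0 linear0.
- move=> lam j g _; apply/lfunP=> x; apply: iota_inj.
  rewrite (comp_lfunE (f lam j)) iota_f (comp_lfunE (sym_map d (sym_map k g))).
  have [_ _ /(_ g)/lfunP/(_ x)] := kapP lam.
  rewrite (comp_lfunE (kap lam)) => ->; rewrite (comp_lfunE (tens_map N g)).
  have /lfunP/(_ (kap lam x)) := tact_natural g (y (parts lam) j).
  rewrite (comp_lfunE (tens_map N g)) (comp_lfunE (tact W (y (parts lam) j))) => <-.
  have /lfunP/(_ (f lam j x)) := nat_iota g.
  by rewrite (comp_lfunE iota) (comp_lfunE (tens_map N g)) iota_f => ->.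
(* Applying the dual element y'_j to a vanishing sum leaves a nonzero multiple of the component at
   (lam, j). *)
- apply/directv_sum_independent => us Hus sum0 [lam j] _.
  have Hx i : exists x, us i = f (tag i) (tagged i) x.
    by case/memv_imgP: (Hus i isT) => x _ ->; exists x.
  have [x xE] := Hx (existT _ lam j).
  have := congr1 (fun u => tact W (y' (parts lam) j) (iota u)) sum0.
  rewrite !linear0 !linear_sum (bigD1 (existT _ lam j)) //= big1 => [|i ne].
    rewrite addr0 xE /= y'_f eqxx mul1r => /eqP.
    rewrite scaler_eq0 (negPf (n_neq0 _)) /= => /eqP x0.
    have -> : x = 0 by apply: (kap_inj lam); rewrite x0 linear0.
    by rewrite linear0.
  have [z ->] := Hx i; case: i ne {Hus} z => mu j' /= ne z.
  have [E|neq] := eqVneq lam mu; last by rewrite y'_f0.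
  case: mu / E in j' ne z *; rewrite y'_f; have [E|] := eqVneq j j'.
    by rewrite E eqxx in ne.
  by rewrite mul0r scale0r.
(* Spanning: z is fixed by e, which is expanded into the products y_j y'_j, and y'_j z lies in the
   copy of S^lam W. *)
apply/eqP; rewrite eqEsubv subvf /=; apply/subvP=> z _.
have iz : iota z = tact W e (iota z) by rewrite eP // -im_iota memv_img ?memvf.
have Hx lam j : exists x, tact W (y' (parts lam) j) (iota z) = kap lam x.
  have [_ /(_ j)[w ->] _ _] := Hy _ (parts_partition lam).
  have : tact W (c (parts lam) * w) (iota z) \in limg (kap lam).
    have [_ -> _] := kapP lam.
    by rewrite tactM comp_lfunE memv_img ?memvf.
  by case/memv_imgP=> x _ ->; exists x.
have -> : z = \sum_(lam : partition_of N) (n (parts lam))^-1 *: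
    \sum_(j < young_mult e (parts lam)) f lam j (projT1 (cid (Hx lam j))).
  apply: iota_inj; rewrite [LHS]iz [X in tact W X _]eE !linear_sum sum_lfunE; apply: eq_bigr => lam _.
  rewrite !linearZ /= scale_lfunE; congr (_ *: _).
  rewrite !linear_sum sum_lfunE; apply: eq_bigr => j _.
  by rewrite /= tactM comp_lfunE iota_f; case: cid => x /= ->.
apply: memv_suml => lam _; apply: memvZ; apply: memv_suml => j _.
apply: (subvP (sumv_sup (Tagged (fun lam => 'I_(young_mult e (parts lam))) j) _ (subvv _))) => //.
by rewrite memv_img ?memvf.
Qed.

End Existence.

(** * Weight spaces *)

Section Eigenspaces.
Variable F : fieldType.

Definition leigenspace (V : vectType F) (p : 'End(V)) (a : F) := lker (p - a *: \1%VF).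

Lemma mem_leigen (V : vectType F) (p : 'End(V)) (a : F) v :
  (v \in leigenspace p a) = (p v == a *: v).
Proof.
by rewrite /leigenspace memv_ker add_lfunE opp_lfunE scale_lfunE id_lfunE subr_eq0.
Qed.

(** The components of an eigenvector in a direct sum of stable subspaces are eigenvectors for the
    same value. *)
Lemma dim_leigen_sum (V : vectType F) (I : finType) (U : I -> vectType F)
    (f : forall i, 'Hom(U i, V)) (p : forall i, 'End(U i)) (q : 'End(V)) (a : F) :
  (forall i, lker (f i) = 0%VS) -> (forall i, (f i \o p i = q \o f i)%VF) ->
  directv (\sum_i limg (f i)) -> (\sum_i limg (f i))%VS = fullv ->
  \dim (leigenspace q a) = (\sum_i \dim (leigenspace (p i) a))%N.
Proof.
move=> ker0 nat dir full.
have fp i x : f i (p i x) = q (f i x) by rewrite -!comp_lfunE nat.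
have inj i : injective (f i) by apply/lker0P; rewrite ker0.
have dirE : directv (\sum_i (f i @: leigenspace (p i) a)).
  apply/directv_sum_independent => us Hus sum0; move: dir => /directv_sum_independent; apply=> //.
  by move=> i Pi; have /subvP := limgS (f i) (subvf (leigenspace (p i) a)); apply; apply: Hus.
have -> : leigenspace q a = (\sum_i (f i @: leigenspace (p i) a))%VS.
  apply/vspaceP=> v; apply/idP/memv_sumP => [|[us Hus ->]]; last first.
    apply: memv_suml => i _; case/memv_imgP: (Hus i isT) => x + ->.
    by rewrite !mem_leigen -fp => /eqP ->; rewrite linearZ.
  rewrite mem_leigen => /eqP qv.
  have /memv_sumP[us Hus vE] : v \in (\sum_i limg (f i))%VS by rewrite full memvf.
  exists us => // i _.
  have us0 j : q (us j) - a *: us j = 0.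
    have /directv_sum_independent := dir; move/(_ (fun j => q (us j) - a *: us j)); apply=> //.
      move=> k _; case/memv_imgP: (Hus k isT) => x _ ->.
      by rewrite -fp memvB ?memvZ ?memv_img ?memvf.
    by rewrite sumrB -scaler_sumr -linear_sum /= -vE qv subrr.
  case/memv_imgP: (Hus i isT) => x _ xE; rewrite xE memv_img // mem_leigen.
  apply/eqP/(inj i); rewrite fp linearZ /=; apply/eqP; rewrite -subr_eq0 -xE.
  by rewrite us0.
rewrite (directvP dirE) /=; apply: eq_bigr => i _.
by rewrite limg_dim_eq // ker0 capv0.
Qed.

Lemma dim_leigen_embedding (U V : vectType F) (f : 'Hom(U, V)) (p : 'End(U)) (q : 'End(V))
    (a : F) (E : {vspace V}) :
  lker f = 0%VS -> (f \o p = q \o f)%VF ->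
  (forall v, (v \in E) = (v \in limg f) && (q v == a *: v)) ->
  \dim (leigenspace p a) = \dim E.
Proof.
move=> ker0 nat EP; have inj : injective f by apply/lker0P; rewrite ker0.
have -> : E = (f @: leigenspace p a)%VS; last by rewrite limg_dim_eq // ker0 capv0.
have fp x : f (p x) = q (f x) by rewrite -!comp_lfunE nat.
apply/vspaceP=> v; rewrite EP; apply/andP/memv_imgP => [[/memv_imgP[x _ ->]]|[x]].
  by rewrite -fp -linearZ (inj_eq inj) => xE; exists x; rewrite ?mem_leigen.
by rewrite mem_leigen => /eqP xE ->; rewrite memv_img ?memvf // -fp xE linearZ.
Qed.

End Eigenspaces.

Section Torus.
Variables (C : numClosedFieldType) (W : vectType C).
Local Notation n := (\dim {:W}).
Local Notation word m := {ffun 'I_m -> 'I_n}.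

(* A diagonal matrix for which the weights (a, b, 0, .., 0) are separated from
   the other ones of the same degree by unique factorization. *)
Definition letter (i : nat) : nat := if i == 0%N then 2 else if i == 1%N then 3 else 5.

Definition torus_fun (v : W) : W :=
  \sum_(i < n) ((letter i)%:R * coord (vbasis {:W}) i v) *: (vbasis {:W})`_i.

Fact torus_fun_is_linear : linear torus_fun.
Proof.
move=> a u v; rewrite /torus_fun scaler_sumr -big_split /=; apply: eq_bigr => i _.
by rewrite linearD linearZ /= scalerA -scalerDl mulrDr mulrCA.
Qed.
HB.instance Definition _ := GRing.isLinear.Build C W W *:%R torus_fun torus_fun_is_linear.

Definition torus : 'End(W) := linfun torus_fun.

Lemma coord_torus (i j : 'I_n) :
  coord (vbasis {:W}) i (torus (vbasis {:W})`_j) = (letter j)%:R * (i == j)%:R.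
Proof.
rewrite lfunE /= /torus_fun linear_sum /= (bigD1 j) //= big1 => [|l lj].
  by rewrite addr0 linearZ /= !coord_free ?(basis_free (vbasisP _)) // eqxx mulr1 eq_sym.
by rewrite linearZ /= coord_free ?(basis_free (vbasisP _)) // eq_sym (negPf lj) mulr0 mul0r.
Qed.

Lemma torus_ker : lker torus = 0%VS.
Proof.
apply/eqP; rewrite -subv0; apply/subvP=> v; rewrite memv_ker => /eqP tv.
rewrite memv0 [v](coord_vbasis (memvf v)); apply/eqP/big1 => i _.
have : coord (vbasis {:W}) i (torus v) = 0 by rewrite tv linear0.
rewrite {1}[v](coord_vbasis (memvf v)) !linear_sum (bigD1 i) //= big1 => [|j ji].
  rewrite !linearZ /= coord_torus eqxx mulr1 addr0 => /eqP; rewrite mulf_eq0.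
  case/orP=> [/eqP ->|]; first by rewrite scale0r.
  by rewrite pnatr_eq0 /letter; case: (nat_of_ord i) => [|[|]].
by rewrite !linearZ /= coord_torus eq_sym (negPf ji) !mulr0.
Qed.

Definition wt m (u : word m) : nat := \prod_i letter (u i).

Lemma tens_torus m (x : tens m W) u : tens_map m torus x u = (wt u)%:R * x u.
Proof.
rewrite lfunE /= ffunE (bigD1 u) //= [X in _ + X]big1 => [|v neq].
  rewrite addr0 mulrC /wt natr_prod; congr (_ * _); apply: eq_bigr => i _.
  by rewrite coord_torus eqxx mulr1.
have [i neq_i] : exists i, u i != v i.
  apply/existsP; apply: contraR neq => /existsPn E.
  by apply/eqP/ffunP=> i; apply/esym/eqP; move: (E i); rewrite negbK.
by rewrite (bigD1 i) //= coord_torus (negPf neq_i) mulr0 mul0r mulr0.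
Qed.

Definition binary m (b : nat) (u : word m) : bool :=
  [forall i, (u i < 2)%N] && (#|[pred i | u i == 1%N :> nat]| == b).

(** The valuations at 2 and 3 count the letters 0 and 1; since a + b = m no position is left for
    another letter. *)
Lemma wtP m (a b : nat) (u : word m) : (a + b = m)%N ->
  (wt u == 2 ^ a * 3 ^ b)%N = binary b u.
Proof.
move=> abm.
pose N0 := #|[pred i | u i == 0%N :> nat]|; pose N1 := #|[pred i | u i == 1%N :> nat]|.
pose N5 := #|[pred i | (1 < u i)%N]|.
have NE : (N0 + N1 + N5 = m)%N.
  rewrite /N0 /N1 /N5 -!sum1_card -[RHS]card_ord -sum1_card.
  rewrite [RHS](bigID (fun i => u i == 0%N :> nat)) /= -addnA; congr (_ + _)%N.
  rewrite [RHS](bigID (fun i => u i == 1%N :> nat)) /=; congr (_ + _)%N.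
    by apply: eq_bigl => i; rewrite !inE; case: (nat_of_ord (u i)) => [|[|]].
  by apply: eq_bigl => i; rewrite !inE; case: (nat_of_ord (u i)) => [|[|]].
have wtE : wt u = (2 ^ N0 * 3 ^ N1 * 5 ^ N5)%N.
  rewrite /wt (bigID (fun i => u i == 0%N :> nat)) /= -mulnA; congr (_ * _)%N.
    rewrite (eq_bigr (fun=> 2%N)) => [|i /eqP ui]; last by rewrite /letter ui.
    by rewrite prod_nat_const.
  rewrite (bigID (fun i => u i == 1%N :> nat)) /=; congr (_ * _)%N.
    rewrite (eq_bigr (fun=> 3%N)) => [|i /andP[_ /eqP ui]]; last by rewrite /letter ui.
    rewrite (eq_bigl (mem [pred i | u i == 1%N :> nat])) ?prod_nat_const // => i.
    by rewrite !inE; case: (nat_of_ord (u i)) => [|[|]].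
  rewrite (eq_bigr (fun=> 5%N)) => [|i /andP[u0 u1]].
    rewrite (eq_bigl (mem [pred i | (1 < u i)%N])) ?prod_nat_const // => i.
    by rewrite !inE; case: (nat_of_ord (u i)) => [|[|]].
  by rewrite /letter (negPf u0) (negPf u1).
rewrite wtE /binary; apply/eqP/andP => [E|[/forallP bin /eqP N1b]].
  have lg p q e : prime q -> logn p (q ^ e) = ((p == q) * e)%N.
    by move=> pq; rewrite lognX logn_prime // mulnC.
  have := congr1 (logn 2) E; have := congr1 (logn 3) E.
  rewrite !lognM ?muln_gt0 ?expn_gt0 // !lg //= !mul0n !mul1n !addn0 !add0n => N1b N0a.
  rewrite -/N1 N1b eqxx; split=> //; apply/forallP=> i; rewrite ltnNge; apply/negP=> ui.
  have : (0 < N5)%N by apply/card_gt0P; exists i.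
  by move: NE; rewrite N0a N1b -abm => /eqP; rewrite -[X in _ == X]addn0 eqn_add2l => /eqP ->.
have N50 : N5 = 0%N.
  by apply: eq_card0 => i; rewrite !inE ltnNge; have := bin i; rewrite ltnS => ->.
have N1E : N1 = b by rewrite /N1.
move: NE; rewrite N50 N1E addn0 -abm => /eqP; rewrite eqn_add2r => /eqP ->.
by rewrite muln1.
Qed.

Lemma torus_eigenP m (a b : nat) (x : tens m W) : (a + b = m)%N ->
  reflect (forall u, x u != 0 -> binary b u)
    (tens_map m torus x == (2 ^ a * 3 ^ b)%:R *: x).
Proof.
move=> abm; apply: (iffP eqP) => [/ffunP E u xu|H].
  have := E u; rewrite tens_torus ffunE => /(mulIf xu)/eqP.
  by rewrite eqr_nat wtP.
apply/ffunP=> u; rewrite tens_torus ffunE.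
have [->|/H] := eqVneq (x u) 0; first by rewrite mulr0 scaler0.
by rewrite -(wtP u abm) => /eqP ->.
Qed.

End Torus.

(** * The multiplicity of the weight (a, b) in a Schur functor *)

Section SchurWeights.
Variables (C : numClosedFieldType) (W : vectType C) (N : nat) (lam : seq nat).
Local Notation n := (\dim {:W}).
Local Notation word := {ffun 'I_N -> 'I_n}.
Local Notation c := (@youngp C N lam).
Local Notation row := (@rowi N lam).
Local Notation col := (@coli N lam).
Local Notation "'δ' s" := (@galg_delta C _ s) (at level 9).
Implicit Types (u v : word) (s t : 'S_N) (i j : 'I_N).
Hypothesis plam : is_partition N lam.
Variables a b : nat.
Hypotheses (le_ba : (b <= a)%N) (abN : (a + b = N)%N).

Local Notation D := (partition_diagram plam).

Lemma tact_tens_delta s u :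
  tact W (δ s) (tens_delta u) = tens_delta [ffun i => u (s i)].
Proof.
rewrite tact_delta; apply/ffunP=> v; rewrite tens_permE !ffunE; congr (nat_of_bool _)%:R.
apply/eqP/eqP=> [<-|->]; apply/ffunP=> i; rewrite !ffunE ?permK ?permKV //.
Qed.

Lemma young_act_col t u : keeps col t ->
  tact W c (tens_delta [ffun i => u (t i)]) = (-1) ^+ t *: tact W c (tens_delta u).
Proof.
move=> kt; rewrite -tact_tens_delta -comp_lfunE -tactM /youngp /young -mulrA.
by rewrite mul_alt_delta // -scalerAr linearZ scale_lfunE.
Qed.

Lemma young_act_repeat u i j : i != j -> col i = col j -> u i = u j ->
  tact W c (tens_delta u) = 0.
Proof.
move=> ne cij uij; have := young_act_col u (keeps_tperm cij).
have -> : [ffun k => u (tperm i j k)] = u.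
  by apply/ffunP=> k; rewrite ffunE; case: tpermP => [->|->|].
rewrite odd_tperm ne expr1 scaleN1r => /eqP.
rewrite -subr_eq0 opprK -mulr2n -scaler_nat scaler_eq0 pnatr_eq0.
by move/eqP.
Qed.

(** Column permutations fix a box that is alone in its column, so the transposition commutes with
    the column sum and is absorbed by the row sum. *)
Lemma young_act_tail u i j : row i = row j ->
  (forall k, col k = col i -> k = i) -> (forall k, col k = col j -> k = j) ->
  tact W c (tens_delta [ffun k => u (tperm i j k)]) = tact W c (tens_delta u).
Proof.
move=> rij ci cj; rewrite -tact_tens_delta -comp_lfunE -tactM; congr (tact W _ _).
have fixi s : keeps col s -> s i = i by move/keepsP=> ks; apply: ci.
have fixj s : keeps col s -> s j = j by move/keepsP=> ks; apply: cj.
rewrite /youngp /young -mulrA.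
have -> : alt_of C col * δ (tperm i j) = δ (tperm i j) * alt_of C col.
  rewrite /alt_of mulr_suml mulr_sumr; apply: eq_bigr => s ks.
  rewrite -scalerAl -scalerAr -!galg_deltaM; congr (_ *: δ _).
  have E : (tperm i j ^ s)%g = tperm i j by rewrite tpermJ fixi ?fixj.
  by rewrite -{1}E conjgE mulKVg.
by rewrite mulrA mul_sym_delta //; apply: keeps_tperm.
Qed.

Lemma row0_col i : row i = 0%N -> i = col i :> nat.
Proof.
by move=> ri; rewrite -{1}(reshape_indexK lam i) -/(row i) ri /flatten_index take0 add0n.
Qed.

Lemma row1_ge i : row i = 1%N -> (nth 0 lam 0 <= i)%N.
Proof.
move=> ri; rewrite -(reshape_indexK lam i) -/(row i) ri /flatten_index.
by case: (lam) => [|p l] //=; rewrite take0 addn0 leq_addr.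
Qed.

Lemma col_lt i : (col i < nth 0 lam (row i))%N.
Proof. by apply: reshape_offsetP; rewrite (partition_sumn plam). Qed.

Lemma row_lt i : (row i < size lam)%N.
Proof. by apply: reshape_indexP; rewrite (partition_sumn plam). Qed.

Lemma box_exists r k : (k < nth 0 lam r)%N -> exists i, row i = r /\ col i = k.
Proof.
move=> lt_k; have lt_f : (flatten_index lam r k < N)%N.
  by have := flatten_indexP lt_k; rewrite (partition_sumn plam).
by exists (Ordinal lt_f); rewrite /rowi /coli /= flatten_indexKl // flatten_indexKr.
Qed.

Lemma binary_count1 u : binary b u -> forall i, u i = 0%N :> nat \/ u i = 1%N :> nat.
Proof.
by case/andP=> /forallP bin _ i; have := bin i; case: (nat_of_ord (u i)) => [|[|]]; auto.
Qed.

Lemma binary_opposite u v i :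
  (forall k, u k = 0%N :> nat \/ u k = 1%N :> nat) ->
  (forall k, v k = 0%N :> nat \/ v k = 1%N :> nat) ->
  binary b u -> binary b v -> u i = 1%N :> nat -> v i = 0%N :> nat ->
  exists j, u j = 0%N :> nat /\ v j = 1%N :> nat.
Proof.
move=> bu bv /andP[_ /eqP ub] /andP[_ /eqP vb] ui vi.
have [/existsP[j /andP[/eqP uj /eqP vj]]|/existsPn no] :=
  boolP [exists j, (u j == 0%N :> nat) && (v j == 1%N :> nat)]; first by exists j.
have : (#|[pred k | v k == 1%N :> nat]| < #|[pred k | u k == 1%N :> nat]|)%N.
  apply: proper_card; apply/fintype.properP; split.
    apply/fintype.subsetP=> k; rewrite !inE => vk.
    by have := no k; rewrite vk andbT; case: (bu k) => ->.
  by exists i; rewrite !inE ?ui ?vi.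
by rewrite ub vb ltnn.
Qed.

(** Two letters cannot fill three boxes of the first column without repetition. *)
Lemma young_act_tall u : binary b u -> (2 < size lam)%N -> tact W c (tens_delta u) = 0.
Proof.
move=> bu sz.
have pos r : (r < size lam)%N -> (0 < nth 0 lam r)%N.
  move=> lt_r; rewrite lt0n; apply/negP=> /eqP E.
  by case/and3P: plam => _ /negP[]; rewrite -E mem_nth.
have [i0 [r0 c0]] := box_exists (pos 0%N (ltnW (ltnW sz))).
have [i1 [r1 c1]] := box_exists (pos 1%N (ltnW sz)).
have [i2 [r2 c2]] := box_exists (pos 2%N sz).
have ne (i j : 'I_N) : row i != row j -> i != j by apply: contraNneq => ->.
have eqv i j : u i = u j :> nat -> u i = u j by move/val_inj.
have n01 : i0 != i1 by apply: ne; rewrite r0 r1.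
have n02 : i0 != i2 by apply: ne; rewrite r0 r2.
have n12 : i1 != i2 by apply: ne; rewrite r1 r2.
case: (binary_count1 bu i0) => u0; case: (binary_count1 bu i1) => u1;
case: (binary_count1 bu i2) => u2;
first [ by apply: (young_act_repeat n01); rewrite ?c0 ?c1 //; apply: eqv; rewrite u0 u1
      | by apply: (young_act_repeat n02); rewrite ?c0 ?c2 //; apply: eqv; rewrite u0 u2
      | by apply: (young_act_repeat n12); rewrite ?c1 ?c2 //; apply: eqv; rewrite u1 u2 ].
Qed.

(** Without a repetition each of the first lam_2 columns contains a letter 1, giving more than b of
    them. *)
Lemma young_act_wide u : binary b u -> (b < nth 0 lam 1)%N -> tact W c (tens_delta u) = 0.
Proof.
move=> bu lt_b.
have [/existsP[i /existsP[j /and3P[ne /eqP cij /eqP uij]]]|no] :=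
  boolP [exists i, exists j, [&& i != j, col i == col j & u i == u j]].
  exact: (young_act_repeat ne cij uij).
have ex (k : 'I_(nth 0 lam 1)%N) : exists i, col i = k /\ u i = 1%N :> nat.
  have [i1 [r1 c1]] := box_exists (ltn_ord k).
  have [i0 [r0 c0]] := box_exists (leq_trans (ltn_ord k) (partition_mono plam (leq0n 1))).
  case: (binary_count1 bu i1) => u1; last by exists i1.
  case: (binary_count1 bu i0) => u0; last by exists i0.
  case/existsP: no; exists i0; apply/existsP; exists i1.
  rewrite c0 c1 eqxx /= -[u i0 == _]val_eqE /= u0 u1 eqxx andbT.
  by apply/eqP=> E; move: r0; rewrite E r1.
have [f Hf] := choice ex.
have finj : injective f.
  by move=> k k' E; apply: val_inj; rewrite /= -(Hf k).1 -(Hf k').1 E.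
have : (#|codom f| <= #|[pred i | u i == 1%N :> nat]|)%N.
  apply: subset_leq_card; apply/fintype.subsetP=> i /codomP[k ->].
  by rewrite inE (Hf k).2.
rewrite card_codom // card_ord; case/andP: bu => _ /eqP ->.
by rewrite leqNgt lt_b.
Qed.

Section TwoRows.
Hypotheses (sz2 : (size lam <= 2)%N) (le_qb : (nth 0 lam 1 <= b)%N).
(** The reference word 0^a 1^b in the row-by-row numbering. As a <= lam_1 and lam_2 <= b <= a, the
    second row holds only 1 and the boxes above it hold only 0. *)
Variable u0 : word.
Hypothesis u0E : forall i, (u0 i : nat) = (a <= i)%N.

Lemma le_a_p : (a <= nth 0 lam 0)%N.
Proof.
have : (nth 0 lam 0 + nth 0 lam 1)%N = N.
  rewrite -[RHS](partition_sumn plam).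
  by move: sz2; case: (lam) => [|p [|q [|]]] //= _; rewrite ?addn0.
by move=> E; lia.
Qed.

Lemma row_cases i : row i = 0%N \/ row i = 1%N.
Proof. by have := leq_trans (row_lt i) sz2; case: (row i) => [|[|]]; auto. Qed.

Lemma u0_row1 i : row i = 1%N -> u0 i = 1%N :> nat.
Proof. by move/row1_ge => ge_p; rewrite u0E (leq_trans le_a_p ge_p). Qed.

Lemma u0_short i : row i = 0%N -> (col i < nth 0 lam 1)%N -> u0 i = 0%N :> nat.
Proof.
move=> ri ci; rewrite u0E (row0_col ri); apply/eqP; rewrite eqb0 -ltnNge.
by rewrite (leq_trans ci) // (leq_trans le_qb).
Qed.

Lemma u0_column i j : i != j -> col i = col j -> (u0 i : nat) = (1 - u0 j)%N.
Proof.
move=> ne cij; have rne : row i <> row j.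
  by move=> rij; case/eqP: ne; apply: D.1.
case: (row_cases i) => ri; case: (row_cases j) => rj; try by rewrite ri rj in rne.
  by rewrite (u0_row1 rj) u0_short // cij; have := col_lt j; rewrite rj.
by rewrite (u0_row1 ri) u0_short // -cij; have := col_lt i; rewrite ri.
Qed.

Lemma binary_u0 : binary b u0.
Proof.
apply/andP; split; first by apply/forallP=> i; rewrite u0E; case: (a <= i)%N.
apply/eqP; have : (#|[pred i | u0 i == 1%N :> nat]| + a = N)%N; last by move=> E; lia.
rewrite -[RHS]card_ord -(cardC [pred i | u0 i == 1%N :> nat]); congr (_ + _)%N.
have leaN : (a <= N)%N by rewrite -abN leq_addr.
rewrite -[LHS]card_ord -sum1_card (big_ord_widen_cond _ xpredT (fun=> 1%N) leaN) -sum1_card.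
by apply: eq_bigl => i; rewrite !inE u0E ltnNge; case: leqP.
Qed.

(* Induction on the number of letters in which u differs from u0: a column
   transposition or a transposition of two tail boxes of the first row removes
   two differences. *)
Lemma young_act_line u : binary b u ->
  tact W c (tens_delta u) \in <[tact W c (tens_delta u0)]>%VS.
Proof.
have [m] := ubnP #|[pred i | u i != u0 i]|; elim: m u => // m IHm u lt_m bu.
have [->|/eqP neq] := eqVneq u u0; first exact: memv_line.
have [/existsP[i /existsP[j /and3P[ne /eqP cij /eqP uij]]]|/existsPn no] :=
  boolP [exists i, exists j, [&& i != j, col i == col j & u i == u j]].
  by rewrite (young_act_repeat ne cij uij) mem0v.
have proper i j : i != j -> col i = col j -> u i != u j.
  by move=> ne cij; have /existsPn/(_ j) := no i; rewrite ne cij eqxx.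
have step i j : i != j -> u i != u0 i -> u j = u0 i -> u i = u0 j ->
    (#|[pred k | [ffun k => u (tperm i j k)] k != u0 k]| < m)%N /\
    binary b [ffun k => u (tperm i j k)].
  move=> ne di uj ui; split.
    apply: (@leq_trans #|[pred k | u k != u0 k]|); last by rewrite -ltnS.
    apply: proper_card; apply/fintype.properP; split.
      apply/fintype.subsetP=> k; rewrite !inE ffunE; case: tpermP => [->|->|//].
        by rewrite uj eqxx.
      by rewrite ui eqxx.
    by exists i; rewrite !inE // ffunE tpermL uj eqxx.
  case/andP: bu => /forallP bin /eqP bE; apply/andP; split.
    by apply/forallP=> k; rewrite ffunE.
  rewrite -bE -!sum1_card [X in X == _](reindex_inj (@perm_inj _ (tperm i j))) /=.
  by apply/eqP/eq_bigl => k; rewrite !inE ffunE tpermK.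
have bin k := binary_count1 bu k; have bin0 k := binary_count1 binary_u0 k.
have neqN (x y : 'I_n) : x != y -> nat_of_ord x <> y.
  by move=> ne E; case/eqP: ne; apply: val_inj.
have [/existsP[i /existsP[j /and3P[ne /eqP cij di]]]|/existsPn nopair] :=
  boolP [exists i, exists j, [&& i != j, col i == col j & u i != u0 i]].
  have u0c := u0_column ne cij; have prop := neqN _ _ (proper _ _ ne cij).
  have di' := neqN _ _ di.
  have [uj ui] : u j = u0 i /\ u i = u0 j.
    split; apply: val_inj => /=;
      move: (bin i) (bin j) (bin0 i) (bin0 j) prop di' u0c; lia.
  have [lt_m' bu'] := step i j ne di uj ui.
  have := IHm _ lt_m' bu'; rewrite young_act_col; last exact: keeps_tperm.
  by rewrite odd_tperm ne expr1 scaleN1r memvN.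
(* Every remaining difference is alone in its column, hence lies in the first row, so two of them
   can be exchanged by [young_act_tail]. *)
have single i : u i != u0 i -> forall k, col k = col i -> k = i.
  move=> di k ck; apply/eqP; rewrite eq_sym; apply/negPn/negP=> ne.
  by have /existsPn/(_ k) := nopair i; rewrite ne ck eqxx di.
have top i : u i != u0 i -> row i = 0%N.
  move=> di; case: (row_cases i) => // ri.
  have [|k [rk ck]] := D.2 i 0%N; first by rewrite ri.
  by rewrite -(single _ di _ ck) rk.
have [i di] : exists i, u i != u0 i.
  apply/existsP; apply: contraT => /existsPn E; case: neq.
  by apply/ffunP=> i; apply/eqP; move: (E i); rewrite negbK.
have [j [uj ui]] : exists j, u j = u0 i /\ u i = u0 j.
  have di' := neqN _ _ di; case: (bin i) (bin0 i) => ui [] u0i; try by rewrite ui u0i in di'.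
    have [j [u0j uj]] := binary_opposite bin0 bin binary_u0 bu u0i ui.
    by exists j; split; apply: val_inj; rewrite /= ?uj ?u0i ?ui ?u0j.
  have [j [uj u0j]] := binary_opposite bin bin0 bu binary_u0 ui u0i.
  by exists j; split; apply: val_inj; rewrite /= ?uj ?u0i ?ui ?u0j.
have ne : i != j by apply: contraNneq di => E; rewrite ui E.
have dj : u j != u0 j by rewrite uj -ui eq_sym.
have [lt_m' bu'] := step i j ne di uj ui.
have := IHm _ lt_m' bu'; rewrite young_act_tail //; try exact: single.
by rewrite !top.
Qed.

(** In the coefficient of u0 only the trivial column permutation contributes, so no signs occur, and
    the identity contributes 1. *)
Lemma young_act_u0_neq0 : tact W c (tens_delta u0) != 0.
Proof.
suff : tact W c (tens_delta u0) u0 != 0.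
  by apply: contra_neq => ->; rewrite ffunE.
have -> : tact W c (tens_delta u0) u0 =
  \sum_(r : 'S_N | keeps row r) \sum_(s : 'S_N | keeps col s)
     (-1) ^+ s * (u0 == [ffun i => u0 ((r * s)%g i)])%:R :> C.
  rewrite /youngp /young /sym_of mulr_suml linear_sum sum_lfunE sum_ffunE.
  apply: eq_bigr => r _; rewrite /alt_of mulr_sumr linear_sum sum_lfunE sum_ffunE.
  apply: eq_bigr => s _; rewrite /= -scalerAr linearZ scale_lfunE ffunE -galg_deltaM.
  by rewrite tact_tens_delta ffunE.
have only1 r : keeps row r -> \sum_(s : 'S_N | keeps col s)
    (-1) ^+ s * (u0 == [ffun i => u0 ((r * s)%g i)])%:R =
    (u0 == [ffun i => u0 (r i)])%:R :> C.
  move=> kr; rewrite (bigD1 1%g) /=; last by apply/keepsP=> i; rewrite perm1.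
  rewrite odd_perm1 mul1r mulg1 big1 ?addr0 // => s /andP[ks s1].
  case: eqP => [E|]; last by rewrite mulr0.
  (* If s moved a box k of the second row, its new box would carry 0; but u0 (s k) = u0 (r^-1 k) =
     1, as r^-1 k is again in the second row. *)
  case/eqP: s1; have fix1 k : row k = 1%N -> s k = k.
    move=> rk; apply/eqP/negPn/negP=> ne.
    have := u0_column ne (keepsP _ _ ks k); rewrite (u0_row1 rk).
    have /ffunP/(_ (r^-1%g k)) := E; rewrite ffunE permM permKV => /(congr1 val) /= <-.
    rewrite u0_row1 //.
    by move: kr; rewrite -keepsV => /keepsP ->.
  apply/permP=> k; rewrite perm1; apply/eqP/negPn/negP=> ne.
  have := u0_column ne (keepsP _ _ ks k).
  have r0 : row k = 0%N by case: (row_cases k) => // /fix1 sk; rewrite sk eqxx in ne.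
  case: (row_cases (s k)) => [rsk|/fix1/perm_inj sk]; last by rewrite sk eqxx in ne.
  by case/eqP: ne; apply: D.1; rewrite ?rsk ?r0 //; apply: (keepsP _ _ ks).
rewrite (eq_bigr _ only1) gt_eqF // (bigD1 1%g) /=; last by apply/keepsP=> i; rewrite perm1.
have -> : [ffun i => u0 ((1%g : 'S_N) i)] = u0 by apply/ffunP=> i; rewrite ffunE perm1.
by rewrite eqxx ltr_pwDl // sumr_ge0 // => r _; rewrite ler0n.
Qed.

End TwoRows.
End SchurWeights.

(** The weight space is spanned by the images under c of the binary words, all of which lie on one
    line or vanish. *)
Lemma schur_weight_dim (C : numClosedFieldType) (W : vectType C) (N a b : nat) (lam : seq nat) :
  is_partition N lam -> (b <= a)%N -> (a + b = N)%N -> ((0 < N)%N -> (1 < \dim {:W})%N) ->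
  \dim (leigenspace (schur_map lam (torus W)) (2 ^ a * 3 ^ b)%:R) =
  ((size lam <= 2) && (nth 0 lam 1 <= b))%N.
Proof.
move=> plam le_ba abN dimW.
have [kap [ker0 im natk]] := schur_embedding W (partition_sumn plam).
set c := @youngp C N lam in im.
have [n n0 cc] : exists2 n : C, n != 0 & c * c = n *: c := young_sqr C (partition_diagram plam).
have ex (i : 'I_N) : exists x : 'I_(\dim {:W}), (x : nat) = (a <= i)%N.
  have lt_x : ((a <= i)%N < \dim {:W})%N.
    apply: leq_trans (dimW (leq_ltn_trans (leq0n i) (ltn_ord i))).
    by case: (a <= i)%N.
  by exists (Ordinal lt_x).
have [f Hf] := choice ex; pose u0 := finfun f.
have u0E i : (u0 i : nat) = (a <= i)%N by rewrite ffunE Hf.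
pose L := if ((size lam <= 2) && (nth 0 lam 1 <= b))%N then <[tact W c (tens_delta u0)]>%VS else 0%VS.
have actL u : binary b u -> tact W c (tens_delta u) \in L.
  move=> bu; rewrite /L; case: ifP => [/andP[sz q]|/negbT].
    exact: (young_act_line plam le_ba abN sz q u0E).
  rewrite negb_and -!ltnNge => /orP[sz|q].
    by rewrite (young_act_tall plam bu sz) mem0v.
  by rewrite (young_act_wide plam bu q) mem0v.
have LP v : (v \in L) = (v \in limg kap) && (tens_map N (torus W) v == (2 ^ a * 3 ^ b)%:R *: v).
  apply/idP/andP => [|[]].
    rewrite /L; case: ifP => [/andP[sz q]|_]; last first.
      by rewrite memv0 => /eqP ->; rewrite mem0v linear0 scaler0.
    case/vlineP=> k ->; split; first by rewrite im memvZ // memv_img ?memvf.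
    have /lfunP/(_ (tens_delta u0)) := tact_natural (torus W) c.
    rewrite !comp_lfunE linearZ /= => ->.
    have /eqP -> : tens_map N (torus W) (tens_delta u0) == (2 ^ a * 3 ^ b)%:R *: tens_delta u0.
      apply/(torus_eigenP _ abN) => u; rewrite ffunE pnatr_eq0 eqb0 negbK => /eqP ->.
      by apply: (binary_u0 plam le_ba abN sz q u0E).
    by rewrite linearZ /= !scalerA mulrC.
  rewrite im => /memv_imgP[z _ zE] /(torus_eigenP _ abN) bv.
  (* Up to the factor n, c is a projection, and v lies in its image. *)
  have -> : v = n^-1 *: tact W c v.
    by rewrite zE -comp_lfunE -tactM cc linearZ scale_lfunE scalerA mulVf ?scale1r.
  apply: memvZ; rewrite [v]tens_sum linear_sum; apply: memv_suml => u _.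
  rewrite linearZ /=; have [->|/bv bu] := eqVneq (v u) 0; first by rewrite scale0r mem0v.
  by apply: memvZ; apply: actL.
rewrite (dim_leigen_embedding ker0 (natk (torus W)) LP) /L.
case: ifP => [/andP[sz q]|_]; last by rewrite dimv0.
by rewrite dim_vline (young_act_u0_neq0 plam le_ba abN sz q u0E).
Qed.

(** [None] marks the points where the functions must vanish, the other values the classes on which
    they are constant. *)
Lemma dim_class_functions (F : fieldType) (X Q : finType) (q : X -> option Q)
    (E : {vspace {ffun X -> F^o}}) :
  (forall z, exists x, q x = Some z) ->
  (forall y, y \in E <-> exists f : Q -> F, y = [ffun x => oapp f 0 (q x)]) ->
  \dim E = #|Q|.
Proof.
move=> surj EP.
pose psi (f : {ffun Q -> F^o}) : {ffun X -> F^o} := [ffun x => oapp f 0 (q x)].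
have psi_lin : linear psi.
  move=> a f g; apply/ffunP=> x; rewrite !ffunE; case: (q x) => [z|] /=.
    by rewrite !ffunE.
  by rewrite scaler0 addr0.
pose L := GRing.isLinear.Build F _ _ *:%R psi psi_lin.
pose P : {linear _ -> _} := HB.pack psi L.
have -> : E = limg (linfun P).
  apply/vspaceP=> y; apply/idP/memv_imgP => [/EP[f ->]|[f _ ->]].
    exists (finfun f); rewrite ?memvf // lfunE; apply/ffunP=> x; rewrite !ffunE.
    by case: (q x) => [z|] //=; rewrite ffunE.
  by apply/EP; exists f; rewrite lfunE.
rewrite limg_dim_eq; first by rewrite dimvf; apply: muln1.
apply/eqP; rewrite capfv -subv0; apply/subvP=> f; rewrite memv_ker lfunE => /eqP /ffunP f0.
rewrite memv0; apply/eqP/ffunP=> z; have [x qx] := surj z.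
by have := f0 x; rewrite !ffunE qx.
Qed.

Lemma perm_eq_bool (s t : seq bool) : size s = size t -> count id s = count id t -> perm_eq s t.
Proof.
move=> sz ct; apply/allP=> x _; apply/eqP; case: x => /=.
  by rewrite (eq_count (a2 := id)) 1?[RHS](eq_count (a2 := id)) // => -[].
have c (l : seq bool) : (count_mem false l + count id l = size l)%N.
  by rewrite -(count_predC id l) addnC; congr (_ + _)%N; apply: eq_count => -[].
by apply/eqP; rewrite -(eqn_add2r (count id s)) {2}ct !c sz.
Qed.

(** Partitions of b with at most d parts, each at most k, padded with zeros. *)
Definition boxed d k (b : nat) (t : d.-tuple 'I_k.+1) : bool :=
  sorted (fun x y : 'I_k.+1 => (y <= x)%N) t && (\sum_(i < d) tnth t i == b)%N.

(** * The multiplicity of the weight (a, b) in S^d(S^k W) *)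

Section SymWeights.
Variables (C : numClosedFieldType) (W : vectType C) (d k : nat).
Local Notation n := (\dim {:W}).
Local Notation word m := {ffun 'I_m -> 'I_n}.
Local Notation N := (d * k)%N.

Definition geI (x y : 'I_k.+1) := (y <= x)%N.

Definition ones (v : word k) : nat := #|[pred j | v j == 1%N :> nat]|.

Lemma ones_le v : (ones v < k.+1)%N.
Proof. by rewrite ltnS -[X in (_ <= X)%N]card_ord; apply: max_card. Qed.

Definition block_ones (w : word N) : d.-tuple 'I_k.+1 :=
  [tuple Ordinal (ones_le (blk w l)) | l < d].

(** On binary words this is a complete invariant of the orbit under the wreath product. *)
Definition type_of_word (w : word N) : d.-tuple 'I_k.+1 := [tuple of sort geI (block_ones w)].

Lemma sum_block_ones w :
  (\sum_(l < d) tnth (block_ones w) l)%N = #|[pred i | w i == 1%N :> nat]|.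
Proof.
rewrite -sum1_card [RHS]big_mkcond (reindex (uncurry (@mxvec_index d k))) /=; last exact: curry_mxvec_bij.
pose F l j := if w (mxvec_index l j) == 1%N :> nat then 1%N else 0%N.
rewrite [RHS](eq_bigr (fun p => F p.1 p.2)) => [|[] //]; rewrite -(pair_bigA _ F) /=.
apply: eq_bigr => l _; rewrite tnth_mktuple /= /ones -sum1_card [LHS]big_mkcond /=.
by apply: eq_bigr => j _; rewrite !inE !ffunE.
Qed.

(** First the blocks are permuted to match the numbers of ones, then the positions inside each
    block. *)
Lemma type_of_word_eqP (w w' : word N) : (forall i, (w i < 2)%N) -> (forall i, (w' i < 2)%N) ->
  type_of_word w = type_of_word w' ->
  exists s t, w' = [ffun i => w (wreath s t i)].
Proof.
move=> bw bw' tyE.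
have tr : transitive geI by move=> x y z /= yx zy; apply: leq_trans zy yx.
have anti : antisymmetric geI.
  by move=> x y; rewrite andbC => /anti_leq E; apply: val_inj.
have tot : total geI by move=> x y; apply: leq_total.
have /(tuple_permP (t := block_ones w))[s E] : perm_eq (block_ones w') (block_ones w).
  by apply/(perm_sortP tot tr anti); have := congr1 val tyE.
have blkE l : ones (blk w' l) = ones (blk w (s l)).
  have := congr1 (fun t => nat_of_ord (nth ord0 t l)) E.
  by rewrite -!tnth_nth !tnth_mktuple.
have tE l : exists t : 'S_k, forall j,
    (blk w' l j == 1%N :> nat) = (blk w (s l) (t j) == 1%N :> nat).
  pose bt (v : word k) := [tuple v j == 1%N :> nat | j < k].
  have ct v : count id (bt v) = ones v.
    rewrite /ones /bt /= count_map -sum1_count -sum1_card big_enum_cond /=.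
    by apply: eq_bigl => j; rewrite !inE.
  have /(tuple_permP (t := bt (blk w (s l))))[t Et] : perm_eq (bt (blk w' l)) (bt (blk w (s l))).
    by apply: perm_eq_bool; rewrite ?size_tuple // !ct blkE.
  exists t => j; have := congr1 (fun u => nth false u j) Et.
  by rewrite -!tnth_nth !tnth_mktuple.
have [t Ht] := choice tE.
exists s, (finfun t); apply/ffunP=> i; case: i / mxvec_indexP => l j.
apply: val_inj; rewrite ffunE wreathE ffunE /=.
have := Ht l j; rewrite !ffunE => E1.
have := bw (mxvec_index (s l) (t l j)); have := bw' (mxvec_index l j).
by case: (nat_of_ord _) E1 => [|[|]] //; case: (nat_of_ord _) => [|[|]].
Qed.

Lemma block_ones_wreath (w : word N) s t l :
  tnth (block_ones [ffun i => w (wreath s t i)]) l = tnth (block_ones w) (s l).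
Proof.
apply: val_inj; rewrite !tnth_mktuple /= /ones -!sum1_card.
rewrite [RHS](reindex_inj (@perm_inj _ (t l))) /=; apply: eq_bigl => j.
by rewrite !inE !ffunE wreathE.
Qed.

Lemma type_of_word_wreath (w : word N) s t :
  type_of_word [ffun i => w (wreath s t i)] = type_of_word w.
Proof.
have tr : transitive geI by move=> x y z /= yx zy; apply: leq_trans zy yx.
have anti : antisymmetric geI.
  by move=> x y; rewrite andbC => /anti_leq E; apply: val_inj.
have tot : total geI by move=> x y; apply: leq_total.
apply: val_inj; apply/(perm_sortP tot tr anti).
apply/(tuple_permP (t := block_ones w)); exists s.
by congr val; apply: eq_from_tnth => l; rewrite block_ones_wreath tnth_mktuple.
Qed.

Lemma binary_perm m b (w : word m) (s : 'S_m) :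
  binary b [ffun i => w (s i)] = binary b w.
Proof.
rewrite /binary; congr andb; last congr (eq_op _ b).
  apply/forallP/forallP=> H i; last by rewrite ffunE.
  by have := H (s^-1%g i); rewrite ffunE permKV.
rewrite -!sum1_card [RHS](reindex_inj (@perm_inj _ s)) /=.
by apply: eq_bigl => i; rewrite !inE ffunE.
Qed.

Lemma boxed_type_of_word b (w : word N) : binary b w -> boxed b (type_of_word w).
Proof.
case/andP=> _ /eqP bw; rewrite /boxed; apply/andP; split.
  by apply: sort_sorted => x y; apply: leq_total.
have E (t : d.-tuple 'I_k.+1) : (\sum_(i < d) tnth t i = \sum_(x <- t) x)%N.
  by rewrite big_tuple.
by rewrite E (perm_big _ (permEl (perm_sort _ _))) -E sum_block_ones bw.
Qed.

Definition weight_class b (w : word N) : option {t : d.-tuple 'I_k.+1 | boxed b t} :=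
  if binary b w then insub (type_of_word w) else None.

Lemma weight_class_surj b z : ((0 < N)%N -> (1 < n)%N) -> exists w, weight_class b w = Some z.
Proof.
move=> dimW; case: z => t bt.
(* Block l starts with t_l ones, followed by zeros. *)
have ex (i : 'I_N) : exists x : 'I_n, (x : nat) = ((unidx i).2 < tnth t (unidx i).1)%N.
  have lt_x : (((unidx i).2 < tnth t (unidx i).1)%N < n)%N.
    apply: leq_trans (dimW (leq_ltn_trans (leq0n i) (ltn_ord i))).
    by rewrite ltnS leq_b1.
  by exists (Ordinal lt_x).
have [w0 Hf] : exists w0 : word N, forall i,
    (w0 i : nat) = ((unidx i).2 < tnth t (unidx i).1)%N.
  by have [f Hf] := choice ex; exists (finfun f) => i; rewrite ffunE.
exists w0.
have bE : block_ones w0 = t.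
  apply: eq_from_tnth => l; apply: val_inj; rewrite tnth_mktuple /= /ones.
  have le_k : (tnth t l <= k)%N by rewrite -ltnS.
  rewrite -[RHS]card_ord -!sum1_card (big_ord_widen_cond _ xpredT (fun=> 1%N) le_k).
  by apply: eq_bigl => j; rewrite !inE !ffunE Hf unidxK /= eqb1.
case/andP: (bt) => srt /eqP sumb.
have bw : binary b w0.
  apply/andP; split; first by apply/forallP=> i; rewrite Hf ltnS leq_b1.
  by rewrite -sum_block_ones bE sumb.
have tE : type_of_word w0 = t.
  rewrite /type_of_word bE; apply: val_inj; apply: sorted_sort => //.
  by move=> x y z /= yx zy; apply: leq_trans zy yx.
by rewrite /weight_class bw tE insubT; congr Some; apply: val_inj.
Qed.

(** Invariant tensors of this weight are the functions supported on binary words and constant on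
    their orbits. *)
Lemma sym_weight_dim a b : (a + b = N)%N -> ((0 < N)%N -> (1 < n)%N) ->
  \dim (leigenspace (sym_map d (sym_map k (torus W))) (2 ^ a * 3 ^ b)%:R) =
  #|[pred t : d.-tuple 'I_k.+1 | boxed b t]|.
Proof.
move=> abN dimW; have [iota [ker0 im nati]] := plethysm_embedding d k W.
pose E := (limg iota :&: leigenspace (tens_map N (torus W)) (2 ^ a * 3 ^ b)%:R)%VS.
rewrite (@dim_leigen_embedding _ _ _ iota _ (tens_map N (torus W)) _ E) //; last first.
  by move=> v; rewrite memv_cap mem_leigen.
rewrite -card_sig; apply: (dim_class_functions (q := weight_class b)).
  by move=> z; apply: weight_class_surj.
move=> y; rewrite memv_cap mem_leigen im; split=> [/andP[/wreath_avgP inv /(torus_eigenP _ abN) supp]|[f yE]].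
  pose f (z : {t : d.-tuple 'I_k.+1 | boxed b t}) : C :=
    if [pick w | weight_class b w == Some z] is Some w then y w else 0.
  exists f; apply/ffunP=> w; rewrite ffunE.
  case E1 : (weight_class b w) => [z|] /=; last first.
    have [//|/supp bw] := eqVneq (y w) 0.
    by move: E1; rewrite /weight_class bw (insubT _ (boxed_type_of_word bw)).
  rewrite /f; case: pickP => [w' /eqP E2|/(_ w)]; last by rewrite E1 eqxx.
  move: E1 E2; rewrite /weight_class; case: ifP => // bw; case: ifP => // bw'.
  move=> E1 E2; have [s [t ->]] : exists s t, w = [ffun i => w' (wreath s t i)].
    apply: type_of_word_eqP.
    - by case/andP: bw' => /forallP.
    - by case/andP: bw => /forallP.
    move: E1 E2; rewrite (insubT _ (boxed_type_of_word bw)).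
    rewrite (insubT _ (boxed_type_of_word bw')) => -[E1] [E2].
    by have := congr1 val (etrans E2 (esym E1)).
  by rewrite -[in RHS](inv s t) tens_permE.
apply/andP; split.
  apply/wreath_avgP => s t; apply/ffunP=> w; rewrite tens_permE yE !ffunE.
  by rewrite /weight_class binary_perm type_of_word_wreath.
apply/(torus_eigenP _ abN) => w; rewrite yE ffunE /weight_class.
by case: ifP => //= _; rewrite eqxx.
Qed.

End SymWeights.

(** * Partitions in a box *)

Lemma card_bij_on (A B : finType) (P : pred A) (Q : pred B) (f : A -> B) :
  {in P &, injective f} -> (forall a, P a -> Q (f a)) ->
  (forall b, Q b -> exists2 a, P a & f a = b) -> #|P| = #|Q|.
Proof.
move=> finj fPQ fsurj; rewrite -(card_in_image finj); apply: eq_card => b.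
apply/fintype.imageP/idP => [[a Pa ->]|/fsurj[a Pa <-]]; first exact: fPQ.
by exists a.
Qed.

Lemma card_ord_interval m lo hi : (hi <= m)%N ->
  #|[pred i : 'I_m | (lo <= i < hi)%N]| = (hi - lo)%N.
Proof.
move=> le_m; rewrite -sum1_card -(big_ord_widen_cond _ (fun i => lo <= i)%N (fun=> 1%N) le_m).
elim: hi {le_m} => [|h IHh]; first by rewrite big_ord0.
rewrite big_mkcond big_ord_recr -big_mkcond /= IHh; case: leqP => le_lo /=; lia.
Qed.

(* [(y, z)] stands for the partition [(b - y - z, y, z)] of [b]. *)
Definition two_small K b (p : 'I_K.+1 * 'I_K.+1) : bool :=
  [&& (p.2 <= p.1)%N, (2 * p.1 + p.2 <= b)%N & (b <= K + p.1 + p.2)%N].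

(** With x = b - y - z, the condition y <= x reads 2 y + z <= b and x <= K reads b <= K + y + z. *)
Lemma card_boxed_3 K b :
  #|[pred t : 3.-tuple 'I_K.+1 | boxed b t]| = #|[pred p | @two_small K b p]|.
Proof.
have tE (t : 3.-tuple 'I_K.+1) : exists x y z, t = [tuple x; y; z].
  case: t => -[|x [|y [|z [|]]]] //= i; exists x, y, z; exact: val_inj.
have bE (x y z : 'I_K.+1) :
    boxed b [tuple x; y; z] = [&& (y <= x)%N, (z <= y)%N & (x + y + z == b)%N].
  by rewrite /boxed /= !big_ord_recl big_ord0 /= addn0 !(tnth_nth x) /= andbT addnA andbA.
pose f (t : 3.-tuple 'I_K.+1) := (tnth t (inord 1), tnth t (inord 2)).
have fE (x y z : 'I_K.+1) : f [tuple x; y; z] = (y, z).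
  by rewrite /f !(tnth_nth x) /= !inordK.
apply: (card_bij_on (f := f)) => [t t'|t|[y z]].
- have [x [y [z ->]]] := tE t; have [x' [y' [z' ->]]] := tE t'.
  rewrite !inE !bE !fE => /and3P[_ _ /eqP E] /and3P[_ _ /eqP E'] [yy zz].
  have -> : x = x' by apply: val_inj => /=; rewrite yy zz in E; lia.
  by rewrite yy zz.
- have [x [y [z ->]]] := tE t; rewrite /= bE fE => /and3P[le1 le2 /eqP E].
  have := ltn_ord x; rewrite /two_small /= => lt_x; lia.
rewrite /= /two_small /= => /and3P[le1 le2 le3].
have lt_x : (b - y - z < K.+1)%N by lia.
exists [tuple (Ordinal lt_x); y; z]; last exact: fE.
by rewrite /= bE /=; lia.
Qed.

(** Conjugation of partitions: [ct r t], the number of parts at least r, is the r-th part of the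
    conjugate, and the last two of its three parts are the pair (y, z). *)
Lemma card_boxed_box3 K b :
  #|[pred t : K.-tuple 'I_4 | boxed b t]| = #|[pred p | @two_small K b p]|.
Proof.
pose ct (r : nat) (t : K.-tuple 'I_4) := count (fun x : 'I_4 => (r <= x)%N) t.
have ct_le r t : (ct r t <= K)%N by apply: leq_trans (count_size _ _) _; rewrite size_tuple.
have sumE (t : K.-tuple 'I_4) : (\sum_(i < K) tnth t i = ct 1 t + ct 2 t + ct 3 t)%N.
  rewrite -(big_tuple _ _ _ xpredT (fun x : 'I_4 => nat_of_ord x)) /ct.
  elim: (tval t) => [|x l IHl] /=; first by rewrite big_nil.
  rewrite big_cons IHl; case: x => -[|[|[|[|]]]] //= _; lia.
have ct_mono r s (t : K.-tuple 'I_4) : (r <= s)%N -> (ct s t <= ct r t)%N.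
  by move=> le_rs; apply: sub_count => x /= /(leq_trans le_rs).
pose f (t : K.-tuple 'I_4) : 'I_K.+1 * 'I_K.+1 := (inord (ct 2 t), inord (ct 3 t)).
have f1 t : (f t).1 = ct 2 t :> nat by rewrite inordK // ltnS ct_le.
have f2 t : (f t).2 = ct 3 t :> nat by rewrite inordK // ltnS ct_le.
apply: (card_bij_on (f := f)) => [t t'|t|[y z]].
- rewrite !inE /boxed !sumE => /andP[st /eqP bt] /andP[st' /eqP bt'] E.
  have E2 : ct 2 t = ct 2 t' by rewrite -!f1 E.
  have E3 : ct 3 t = ct 3 t' by rewrite -!f2 E.
  have E1 : ct 1 t = ct 1 t'.
    by move: bt; rewrite -bt' E2 E3 => /eqP; rewrite !eqn_add2r => /eqP.
  apply: val_inj; apply: (sorted_eq _ _ st st').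
  + by move=> a c e /= ac ce; apply: leq_trans ce ac.
  + by move=> a c; rewrite andbC => /anti_leq ac; apply: val_inj.
  apply/allP=> x _; apply/eqP.
  (* Differences of consecutive [ct] give the multiplicity of each value, which determines a sorted
     tuple. *)
  have cE (u : K.-tuple 'I_4) (r : 'I_4) : (count_mem r u + ct r.+1 u = ct r u)%N.
    rewrite /ct -(@count_predUI _ (pred1 r)) [X in (_ + X)%N](_ : _ = 0%N); last first.
      rewrite (eq_count (a2 := pred0)) ?count_pred0 // => a /=.
      by case: eqP => [->|] //=; rewrite ltnn.
    rewrite addn0; apply: eq_count => a /=.
    by rewrite -val_eqE /= [RHS]leq_eqVlt eq_sym.
  have ct4 (u : K.-tuple 'I_4) : ct 4 u = 0%N.
    rewrite /ct (eq_count (a2 := pred0)) ?count_pred0 // => a /=.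
    by rewrite leqNgt ltn_ord.
  have ct0 (u : K.-tuple 'I_4) : ct 0 u = K.
    by rewrite /ct (eq_count (a2 := predT)) ?count_predT ?size_tuple.
  have ctE r : (r <= 4)%N -> ct r t = ct r t'.
    by case: r => [|[|[|[|[|//]]]]] _ //; rewrite ?ct0 ?ct4.
  by apply: (@addIn (ct x.+1 t)); rewrite [in RHS]ctE ?ltn_ord // !cE ctE // ltnW ?ltn_ord.
- rewrite /= /boxed sumE /two_small f1 f2 => /andP[_ /eqP <-].
  have := ct_mono 2%N 3%N t isT; have := ct_mono 1%N 2%N t isT; have := ct_le 1%N t.
  by move: (ct 1%N t) (ct 2%N t) (ct 3%N t); clear; lia.
rewrite /= /two_small /= => /and3P[le1 le2 le3].
pose x := (b - y - z)%N.
(* The part with index i is the number of columns among x, y, z that are longer than i. *)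
have lt4 (i : 'I_K) : ((i < x) + (i < y) + (i < z) < 4)%N by lia.
pose t := [tuple (Ordinal (lt4 i)) | i < K].
have ctE r m : (m <= K)%N -> (forall i : 'I_K, (r <= (i < x) + (i < y) + (i < z)) = (i < m))%N ->
    ct r t = m.
  move=> le_m rE; rewrite /ct /t /= count_map -sum1_count big_enum_cond /=.
  rewrite (eq_bigl (fun i : 'I_K => (i < m)%N)); last by move=> i; rewrite /= rE.
  by rewrite -(big_ord_widen_cond _ xpredT (fun=> 1%N) le_m) sum1_card card_ord.
have c1 : ct 1 t = x by apply: ctE => [|i]; rewrite /x; lia.
have c2 : ct 2 t = y by apply: ctE => [|i]; rewrite /x; have := ltn_ord y; lia.
have c3 : ct 3 t = z by apply: ctE => [|i]; rewrite /x; have := ltn_ord z; lia.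
exists t; last first.
  by rewrite /f c2 c3; congr (_, _); apply: val_inj; rewrite /= inordK.
rewrite /= /boxed sumE c1 c2 c3; apply/andP; split; last by rewrite /x; lia.
apply: (@homo_sorted _ _ _ (fun i j : 'I_K => (i < j)%N)) => [i j lt_ij /=|]; first by lia.
have := iota_ltn_sorted 0 K; rewrite -val_enum_ord sorted_map //.
Qed.

(* The condition 2 y + z <= b only fails for b - 1 when 2 y + z = b, and
   b - 1 <= K + y + z only fails for b when y + z = s (here s is one less than in 4s, 5s). *)
Lemma two_small_difference s :
  (#|[pred p | @two_small (4 * s.+1) (5 * s.+1) p]| + s.+2./2 =
   #|[pred p | @two_small (4 * s.+1) (5 * s.+1).-1 p]| +
     ((5 * s.+1)./2.+1 - (5 * s.+1 + 2) %/ 3))%N.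
Proof.
set K := (4 * s.+1)%N; set b := (5 * s.+1)%N.
have KE : K = (4 * s.+1)%N by [].
have bE : b = (5 * s.+1)%N by [].
clearbody K b.
pose S1 := [pred p | @two_small K b p]; pose S0 := [pred p | @two_small K b.-1 p].
have cap : #|[predI S1 & S0]| = #|[predI S0 & S1]|.
  by apply: eq_card => p; rewrite !inE andbC.
rewrite -(cardID S0 S1) -(cardID S1 S0) cap -!addnA; congr (_ + _)%N.
rewrite addnC; congr (_ + _)%N.
  (* Pairs only in the set for b - 1: y = s - z with z <= y, that is 2 z <= s. *)
  have le_h : (s.+2./2 <= K.+1)%N by lia.
  rewrite -[LHS]subn0 -(card_ord_interval 0 le_h); apply/esym.
  apply: (card_bij_on (f := fun p : 'I_K.+1 * 'I_K.+1 => p.2)) => [[y z] [y' z']|[y z]|z].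
  - rewrite !inE /two_small /= => H H' zz; congr (_, _) => //.
    by apply: val_inj => /=; move: (congr1 val zz) H H'; rewrite /=; lia.
  - by rewrite !inE /two_small /=; lia.
  rewrite /= => lt_z; have lt_y : (s - z < K.+1)%N by lia.
  exists (Ordinal lt_y, z) => //; rewrite !inE /two_small /= ; move: lt_z; lia.
(* Pairs only in the set for b: z = b - 2 y with 0 <= z <= y, so y runs from b / 3 rounded up to b /
   2 rounded down. *)
have le_h : (b./2.+1 <= K.+1)%N by lia.
rewrite -(card_ord_interval _ le_h).
apply: (card_bij_on (f := fun p : 'I_K.+1 * 'I_K.+1 => p.1)) => [[y z] [y' z']|[y z]|y].
- rewrite !inE /two_small /= => H H' yy; congr (_, _) => //.
  by apply: val_inj => /=; move: (congr1 val yy) H H'; rewrite /=; lia.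
- by rewrite !inE /two_small /=; lia.
rewrite /= => lt_y; have lt_z : (b - 2 * y < K.+1)%N by move: lt_y; lia.
exists (y, Ordinal lt_z) => //; rewrite !inE /two_small /= ; move: lt_y; lia.
Qed.

(** * The plethysm coefficients *)

Lemma weight_count (C : numClosedFieldType) (W : vectType C) d k m a b :
  plethysm_decomposition W d k m -> (b <= a)%N -> (a + b = d * k)%N ->
  ((0 < d * k)%N -> (1 < \dim {:W})%N) ->
  #|[pred t : d.-tuple 'I_k.+1 | boxed b t]| =
  (\sum_(lam : partition_of (d * k)%N)
     m (parts lam) * ((size (parts lam) <= 2) && (nth 0 (parts lam) 1 <= b)))%N.
Proof.
move=> [f [ker0 natf dir full]] le_ba abN dimW.
rewrite -(sym_weight_dim abN dimW).
rewrite (dim_leigen_sum _ (fun i => ker0 (tag i) (tagged i)) _ dir full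
  (p := fun i => schur_map (parts (tag i)) (torus W))); last first.
  by move=> i; apply: natf; apply: torus_ker.
rewrite -(@sig_big_dep _ _ _ _ (fun lam : partition_of (d * k) => 'I_(m (parts lam)))
  xpredT (fun=> xpredT)
  (fun lam _ => \dim (leigenspace (schur_map (parts lam) (torus W)) (2 ^ a * 3 ^ b)%:R))) /=.
apply: eq_bigr => lam _; rewrite sum_nat_const card_ord.
by rewrite (schur_weight_dim (parts_partition lam) le_ba abN dimW).
Qed.

(** Subtract the counts for the weights (a, b) and (a + 1, b - 1): among shapes with at most two
    rows only mu has second part exactly b. *)
Lemma two_row_coefficient (C : numClosedFieldType) (W : vectType C) d k m a b mu :
  plethysm_decomposition W d k m -> (b <= a)%N -> (a + b = d * k)%N ->
  ((0 < d * k)%N -> (1 < \dim {:W})%N) ->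
  is_partition (d * k)%N mu -> (size mu <= 2)%N -> nth 0%N mu 1 = b ->
  #|[pred t : d.-tuple 'I_k.+1 | boxed b t]| =
  (m mu + if b is b'.+1 then #|[pred t : d.-tuple 'I_k.+1 | boxed b' t]| else 0)%N.
Proof.
move=> dec le_ba abN dimW pmu szmu mub.
have [mu' mu'E] := parts_ex pmu.
have only lam : is_partition (d * k)%N lam -> (size lam <= 2)%N -> nth 0%N lam 1 = b -> lam = mu.
  move=> plam szlam lamb.
  have E l : is_partition (d * k)%N l -> (size l <= 2)%N -> (nth 0 l 0 + nth 0 l 1 = d * k)%N.
    move=> pl; rewrite -(partition_sumn pl).
    by case: l {pl} => [|p [|q [|]]] //= _; rewrite ?addn0.
  apply: nth_inj_nonzero => [||[|[|r]]].
  - by case/and3P: plam.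
  - by case/and3P: pmu.
  - by have := E _ plam szlam; have := E _ pmu szmu; rewrite lamb mub; lia.
  - by rewrite lamb mub.
  by rewrite !nth_default // ?(leq_trans szlam) ?(leq_trans szmu).
have nth1_neq lam : lam != mu' -> (size (parts lam) <= 2)%N -> nth 0%N (parts lam) 1 <> b.
  move=> ne szl lamb; case/eqP: ne; apply: parts_inj; rewrite mu'E.
  exact: only (parts_partition lam) szl lamb.
rewrite (weight_count dec le_ba abN dimW) (bigD1 mu') //= mu'E szmu mub leqnn muln1.
congr (_ + _)%N; case: b => [|b] in le_ba abN mub only nth1_neq *.
  apply: big1 => lam ne; have := nth1_neq _ ne.
  by case: leqP => //= _; rewrite ?muln0 // leqn0; case: eqP => [E /(_ isT E)|]; rewrite ?muln0.
rewrite (weight_count (a := a.+1) (b := b) dec) ?addSnnS //; last by lia.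
rewrite [RHS](bigD1 mu') //= mu'E mub ltnn andbF muln0 add0n.
apply: eq_bigr => lam ne; congr (_ * nat_of_bool _)%N.
have := nth1_neq _ ne; case: (size _ <= 2)%N => //= /(_ isT)/eqP neq.
by rewrite leq_eqVlt (negPf neq) ltnS.
Qed.

(** If a is positive then so is b, so lam has two nonzero parts unless it is empty; the bound on dim
    W therefore supplies the two letters needed for the weights. *)
Lemma plethysm_coefficient_boxed (C : numClosedFieldType) d k (a b : nat) (lam : seq nat) c :
  (b <= a)%N -> (a + b = d * k)%N -> (0 < a -> 0 < b)%N -> nzparts lam = nzparts [:: a; b] ->
  (#|[pred t : d.-tuple 'I_k.+1 | boxed b t]| =
   c + if b is b'.+1 then #|[pred t : d.-tuple 'I_k.+1 | boxed b' t]| else 0)%N ->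
  plethysm_coefficient C d k lam c.
Proof.
move=> le_ba abN ab_pos lamE count W; rewrite lamE => dimW.
split=> [|m dec]; first exact: plethysm_decomposition_exists.
have abE : (nzparts [:: a; b] = if (0 < b)%N then [:: a; b] else [::]).
  rewrite /nzparts /= -!lt0n; move: le_ba ab_pos; case: (b) => [|b'] /=.
    by case: (a) => [|a'] //= _ /(_ isT).
  by case: (a).
have dimN : ((0 < d * k)%N -> (1 < \dim {:W})%N).
  move: dimW; rewrite abE -abN => dimW ab0; move: dimW.
  by have -> : (0 < b)%N by move: le_ba ab_pos ab0; lia.
apply/eqP; rewrite -(eqn_add2r (if b is b'.+1 then #|[pred t : d.-tuple 'I_k.+1 | boxed b' t]| else 0)%N).
rewrite -count (two_row_coefficient (mu := nzparts [:: a; b]) dec le_ba abN dimN) //.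
- rewrite abE /is_partition; case: ifP => b0 /=; last first.
    by rewrite -abN; move: le_ba ab_pos b0; lia.
  by rewrite le_ba !inE addn0 abN eqxx !andbT; move: le_ba b0; lia.
- by rewrite abE; case: ifP.
by rewrite abE; case: ifP => //=; case: (b).
Qed.

Lemma phi_count s : exists c : nat,
  [/\ (#|[pred p | @two_small (4 * s) (5 * s) p]| =
        c + if (5 * s)%N is b.+1 then #|[pred p | @two_small (4 * s) b p]| else 0)%N
    & c%:R = phi s].
Proof.
case: s => [|s].
  exists 1%N; split; last by [].
  rewrite (eq_card (B := predT)) => [|[[x lx] [y ly]]]; last first.
    by rewrite !inE /two_small /=; case: x y lx ly => [|//] [|//].
  by rewrite card_prod card_ord.
have diff := two_small_difference s.
pose q := (s.+1 %/ 6)%N; pose r := (s.+1 %% 6)%N.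
have sE : s.+1 = (6 * q + r)%N by rewrite /q /r mulnC -divn_eq.
have lt_r : (r < 6)%N by rewrite ltn_pmod.
(* The list consists of phi(0), ..., phi(5), and phi grows by 2 over each period of 6. *)
exists (2 * q + nth 0 [:: 1; 0; 1; 1; 2; 1] r)%N; split.
  have cE : (2 * q + nth 0 [:: 1; 0; 1; 1; 2; 1] r + s.+2./2 =
      (5 * s.+1)./2.+1 - (5 * s.+1 + 2) %/ 3)%N.
    by clearbody q r; case: r lt_r sE => [|[|[|[|[|[|]]]]]] //= _ sE; lia.
  move: diff; rewrite -cE addnA [(_ + (_ + _))%N]addnC => /addIn ->.
  by rewrite mulnS addSn.
rewrite phiE -/r [in RHS]sE natrD natrM.
clearbody q r; case: r lt_r {sE} => [|[|[|[|[|[|]]]]]] //= _;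
  rewrite /r_periodic /= natrD natrM; lra.
Qed.

Theorem theorem5 (R : realType) :
  [/\ forall s : nat, exists c : nat,
        [/\ plethysm_coefficient R[i] 3 (4 * s)
              [seq (s * x)%N | x <- [:: 7; 5; 0]%N] c,
            plethysm_coefficient R[i] (4 * s) 3
              [seq (s * x)%N | x <- [:: 7; 5; 0]%N] c
          & c%:R = phi s],
      ~ (exists (n : nat) (a b c : 'cV[rat]_n),
           [/\ (0 < n)%N, inhom_has_dim a b c 1
             & forall s : nat,
                 lattice_count (inhom_polytope a (s%:R *: b) c) (phi s)])
    & ~ (exists (n m : nat) (A : 'M[rat]_(n, m)) (b : 'cV[rat]_n),
           forall s : nat, lattice_count (dilate s (polyhedron A b)) (phi s))].
Proof.
split=> [s||]; last exact: phi_not_ehrhart.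
  have [c [count cphi]] := phi_count s; exists c.
  have lamE : nzparts [seq (s * x)%N | x <- [:: 7; 5; 0]%N] = nzparts [:: (7 * s)%N; (5 * s)%N].
    by rewrite /= muln0 [(s * 7)%N]mulnC [(s * 5)%N]mulnC.
  split=> //.
  - apply: (plethysm_coefficient_boxed (a := (7 * s)%N) (b := (5 * s)%N)) => //; try by lia.
    by rewrite card_boxed_3 count; case: (5 * s)%N => // b; rewrite card_boxed_3.
  - apply: (plethysm_coefficient_boxed (a := (7 * s)%N) (b := (5 * s)%N)) => //; try by lia.
    by rewrite card_boxed_box3 count; case: (5 * s)%N => // b; rewrite card_boxed_box3.
by move=> [n [a [b [c [_ _ H]]]]]; apply: (phi_not_inhom H).
Qed.
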